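(* Let $\mathbb K$ be a field of characteristic $0$ and let $\mathfrak g$ be a semisimple Lie algebra over $\mathbb K$. Let $\mathfrak L=\mathfrak g\times\mathbb Kt$, with $\mathbb Kt$ the one-dimensional abelian Lie algebra. Then: 1. All Lie bialgebra structures on $\mathfrak L$ are coboundary and determined by a Lie bialgebra structure on $\mathfrak g$, denoted by $\delta_{\mathfrak g}(x)=\mathrm{ad}_x(r)$, with $r\in\Lambda^2\mathfrak g$ satisfying $[r,r]\in(\Lambda^3\mathfrak g)^{\mathfrak g}$, and a biderivation $D\colon(\mathfrak g,\delta_{\mathfrak g})\to(\mathfrak g,\delta_{\mathfrak g})$, which is necessarily of the form $\mathrm{ad}_H$ with $H\in\mathrm{Ker}\,\delta_{\mathfrak g}$. The cobracket on $\mathfrak L$ is given by $$\delta(x)=\mathrm{ad}_x(r)+[H,x]\wedge t=\mathrm{ad}_x(r-H\wedge t)$$ for any $x\in\mathfrak g$, and $\delta(t)=0$. The element $H$ may be multiplied by a nonzero scalar without changing the isomorphism class of the Lie bialgebra $\mathfrak L$. 2. Assume in addition that $\mathbb K$ is $\mathbb C$ or $\mathbb R$ and that $(\mathfrak g,\delta_{\mathfrak g})$ is factorizable or (when $\mathbb K=\mathbb R$) almost factorizable. Put $\mathfrak g_{\mathbb C}=\mathfrak g$ if $\mathbb K=\mathbb C$ and $\mathfrak g_{\mathbb C}=\mathfrak g\otimes_{\mathbb R}\mathbb C$ if $\mathbb K=\mathbb R$, and assume that the cobracket on $\mathfrak g_{\mathbb C}$ (that is, $\delta_{\mathfrak g}$,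 respectively $\delta_{\mathfrak g}\otimes_{\mathbb R}\mathrm{id}_{\mathbb C}$) is $x\mapsto \mathrm{ad}_x(\rho)$ with $\rho\in\mathfrak g_{\mathbb C}\otimes\mathfrak g_{\mathbb C}$ a Belavin–Drinfeld classical r-matrix with Cartan subalgebra $\mathfrak h\subset\mathfrak g_{\mathbb C}$ and BD-triple $(\Gamma_1,\Gamma_2,\tau)$. Then an element $H\in\mathfrak g$ lies in $\mathrm{Ker}\,\delta_{\mathfrak g}$ if and only if $H\in\mathfrak h$ and $\tau\alpha(H)=\alpha(H)$ for all $\alpha\in\Gamma_1$.
   Context: A Lie bialgebra is a Lie algebra $\mathfrak g$ with a linear map $\delta\colon\mathfrak g\to\Lambda^2\mathfrak g$ satisfying co-Jacobi and the 1-cocycle condition $\delta[x,y]=\mathrm{ad}_x\delta(y)-\mathrm{ad}_y\delta(x)$. It is coboundary if there is $r\in\Lambda^2\mathfrak g$ with $\delta(x)=\mathrm{ad}_x(r)$ for all $x$. Here $[r,r]\in\Lambda^3\mathfrak g$ is $\mathrm{CYB}(r)=[r^{12},r^{13}]+[r^{12},r^{23}]+[r^{13},r^{23}]$ (up to normalization). A biderivation is a linear map $D\colon\mathfrak g\to\mathfrak g$ that is a derivation and a coderivation, i.e. $(D\otimes\mathrm{id}+\mathrm{id}\otimes D)\delta=\delta D$. $(\mathfrak g,\delta)$ is factorizable if there is $r\in\mathfrak g\otimes\mathfrak g$ with $\delta(x)=\mathrm{ad}_x(r)$ for all $x$, $\mathrm{CYB}(r)=0$, and whose symmetric component induces a nondegenerate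 inner product on $\mathfrak g^*$. A real Lie bialgebra is almost factorizable if it is not factorizable but its complexification is factorizable. Semisimple Lie algebras are finite dimensional. Belavin–Drinfeld classical r-matrix on a complex semisimple Lie algebra $\mathfrak a$: fix a nondegenerate symmetric invariant bilinear form $(-,-)$ on $\mathfrak a$ with Casimir element $\Omega\in(S^2\mathfrak a)^{\mathfrak a}$, a Cartan subalgebra $\mathfrak h$, with root system $\Phi$, positive roots $\Phi^+$ and simple roots $\Delta$. A BD-triple $(\Gamma_1,\Gamma_2,\tau)$ consists of subsets $\Gamma_1,\Gamma_2\subseteq\Delta$ and a bijection $\tau\colon\Gamma_1\to\Gamma_2$ preserving the inner product such that for each $\alpha\in\Gamma_1$ there is a positive integer $n$ with $\tau^n(\alpha)\in\Gamma_2\setminus\Gamma_1$. Let $\widetilde\Gamma_i$ be the set of positive roots in the subgroup generated by $\Gamma_i$; extending $\tau$ additively, write $\alpha\prec\beta$ if $\alpha\in\widetilde\Gamma_1$, $\beta\in\widetilde\Gamma_2$ and $\beta=\tau^n(\alpha)$ for some positive integer $n$. A continuous parameter is $r_0\in\mathfrak h\otimes\mathfrak h$ with $(\tau(\alpha)\otimes\mathrm{id}+\mathrm{id}\otimes\alpha)r_0=0$ for all $\alpha\in\Gamma_1$ and $r_0+r_0^{21}=\Omega_0$, the $\mathfrak h\otimes\mathfrak h$-component of $\Omega$. Then $$\rho=r_0+\sum_{\alpha\in\Phi^+}x_{-\alpha}\otimes x_\alpha+\sum_{\alpha\in\Phi^+:\ \alpha\prec\beta}(x_{-\alpha}\otimes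 x_\beta-x_\beta\otimes x_{-\alpha}),$$ where $x_{\pm\alpha}\in\mathfrak a_{\pm\alpha}$ are root vectors with $(x_\alpha,x_{-\alpha})=1$. *)

(* Defs.v *)
From HB Require Import structures.
From mathcomp Require Import all_boot all_order all_algebra.
From mathcomp Require Import boolp reals complex.
From mathcomp Require Import ring lra.

Set Implicit Arguments.
Unset Strict Implicit.
Unset Printing Implicit Defensive.

Import GRing.Theory.
Local Open Scope ring_scope.

HB.mixin Record Vector_isLie (K : fieldType) (V : Type) of Vector K V := {
  lie : V -> V -> V;
  lie_is_linearl : forall y, linear (fun x => lie x y);
  lie_is_linearr : forall x, linear (lie x);
  liexx : forall x, lie x x = 0;
  lie_jacobi : forall x y z,
    lie x (lie y z) + lie y (lie z x) + lie z (lie x y) = 0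
}.

#[short(type="lieAlgType")]
HB.structure Definition Lie (K : fieldType) :=
  {V of Vector_isLie K V & Vector K V}.

(* The regular module K^o is the one-dimensional abelian Lie algebra. *)
Section RegularLie.
Variable K : fieldType.

Definition reg_lie (x y : K^o) : K^o := 0.

Fact reg_lie_linearl y : linear (fun x => reg_lie x y).
Proof. by move=> a u v; rewrite /reg_lie scaler0 addr0. Qed.
Fact reg_lie_linearr x : linear (reg_lie x).
Proof. by move=> a u v; rewrite /reg_lie scaler0 addr0. Qed.
Fact reg_liexx x : reg_lie x x = 0.
Proof. by []. Qed.
Fact reg_lie_jacobi x y z :
  reg_lie x (reg_lie y z) + reg_lie y (reg_lie z x)
    + reg_lie z (reg_lie x y) = 0.
Proof. by rewrite /reg_lie !addr0. Qed.

HB.instance Definition _ := Vector_isLie.Build K K^o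
  reg_lie_linearl reg_lie_linearr reg_liexx reg_lie_jacobi.
End RegularLie.

Section ProdLie.
Variables (K : fieldType) (g h : lieAlgType K).

Definition prod_lie (x y : g * h) : g * h := (lie x.1 y.1, lie x.2 y.2).

Fact prod_lie_linearl y : linear (fun x => prod_lie x y).
Proof. by move=> a u v; rewrite /prod_lie /= !lie_is_linearl. Qed.
Fact prod_lie_linearr x : linear (prod_lie x).
Proof. by move=> a u v; rewrite /prod_lie /= !lie_is_linearr. Qed.
Fact prod_liexx x : prod_lie x x = 0.
Proof. by rewrite /prod_lie !liexx. Qed.
Fact prod_lie_jacobi x y z :
  prod_lie x (prod_lie y z) + prod_lie y (prod_lie z x)
    + prod_lie z (prod_lie x y) = 0.
Proof.
rewrite /prod_lie /=.
by apply/pair_equal_spec; split; rewrite /= lie_jacobi.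
Qed.

HB.instance Definition _ := Vector_isLie.Build K (g * h)%type
  prod_lie_linearl prod_lie_linearr prod_liexx prod_lie_jacobi.
End ProdLie.

Section LieTheory.
Variables (K : fieldType) (g : lieAlgType K).
Implicit Types (x y z : g) (U V : {vspace g}).

Lemma lieDr x y z : lie x (y + z) = lie x y + lie x z.
Proof. by have := lie_is_linearr x 1 y z; rewrite !scale1r. Qed.
Lemma lieDl z x y : lie (x + y) z = lie x z + lie y z.
Proof. by have := lie_is_linearl z 1 x y; rewrite !scale1r. Qed.
Lemma lie0r x : lie x 0 = 0.
Proof. by apply: (addrI (lie x 0)); rewrite -lieDr !addr0. Qed.
Lemma lie0l x : lie 0 x = 0.
Proof. by apply: (addrI (lie 0 x)); rewrite -lieDl !addr0. Qed.
Lemma lieZr c x y : lie x (c *: y) = c *: lie x y.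
Proof. by have := lie_is_linearr x c y 0; rewrite !addr0 lie0r addr0. Qed.
Lemma lieZl c x y : lie (c *: x) y = c *: lie x y.
Proof. by have := lie_is_linearl y c x 0; rewrite !addr0 lie0l addr0. Qed.
Lemma lieNr x y : lie x (- y) = - lie x y.
Proof. by rewrite -scaleN1r lieZr scaleN1r. Qed.
Lemma lieC x y : lie x y = - lie y x.
Proof.
have := liexx (x + y); rewrite lieDr !lieDl !liexx add0r addr0 addrC => /eqP.
by rewrite addr_eq0 => /eqP.
Qed.

Definition ad x : 'End(g) := linfun (lie x).

Lemma adE x y : ad x y = lie x y.
Proof.
pose lx := GRing.isLinear.Build K g g *:%R (lie x) (@lie_is_linearr _ _ x).
pose f : {linear g -> g} := HB.pack (lie x) lx.
exact: (lfunE f).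
Qed.

Definition liev U V : {vspace g} :=
  <<[seq lie u v | u <- vbasis U, v <- vbasis V]>>%VS.

Definition ideal U : Prop := forall x u, u \in U -> lie x u \in U.
Definition subalgebra U : Prop :=
  forall u v, u \in U -> v \in U -> lie u v \in U.
Definition solvable U : Prop :=
  exists n, iter n (fun W => liev W W) U = 0%VS.
Definition nilpotent U : Prop := exists n, iter n (liev U) U = 0%VS.

Definition semisimple : Prop :=
  forall U, ideal U -> solvable U -> U = 0%VS.

Definition cartan U : Prop :=
  [/\ subalgebra U, nilpotent U
    & forall x, (forall u, u \in U -> lie x u \in U) -> x \in U].
End LieTheory.
Arguments semisimple {K} g.

Lemma vect_coordP (K : fieldType) (V : vectType K) (x y : V) :
  (forall i, coord (vbasis {:V}) i x = coord (vbasis {:V}) i y) -> x = y.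
Proof.
move=> e; rewrite (coord_vbasis (memvf x)) (coord_vbasis (memvf y)).
by apply: eq_bigr => i _; rewrite e.
Qed.

(* U (x) V is encoded by matrices of coordinates in the bases vbasis {:U},
   vbasis {:V}; lift_tensor and tens_ext below give its universal property. *)
Definition tens (K : fieldType) (U V : vectType K) : Type :=
  'M[K]_(\dim {:U}, \dim {:V}).
HB.instance Definition _ (K : fieldType) (U V : vectType K) :=
  Vector.copy (tens U V) 'M[K]_(\dim {:U}, \dim {:V}).

Section Tensor.
Variables (K : fieldType) (U V : vectType K).

Definition tensor (u : U) (v : V) : tens U V :=
  \matrix_(i, j) (coord (vbasis {:U}) i u * coord (vbasis {:V}) j v).

Definition lift (W : lmodType K) (f : U -> V -> W) (A : tens U V) : W :=
  \sum_(i < \dim {:U}) \sum_(j < \dim {:V})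
     (A : 'M_(_, _)) i j *: f (vbasis {:U})`_i (vbasis {:V})`_j.

Lemma lift_tensor (W : lmodType K) (f : U -> V -> W) u v :
  (forall v, linear (fun u => f u v)) -> (forall u, linear (f u)) ->
  lift f (tensor u v) = f u v.
Proof.
move=> fl fr.
have sl v' : {morph (fun u' => f u' v') : a b / a + b} /\
             (forall a b, f (a *: b) v' = a *: f b v').
  have f0 : f 0 v' = 0.
    have := fl v' 1 0 0; rewrite !scale1r addr0 => e.
    by apply: (addrI (f 0 v')); rewrite addr0 -e.
  split=> [a b|a b]; first by have := fl v' 1 a b; rewrite !scale1r.
  by have := fl v' a b 0; rewrite !addr0 f0 addr0.
have sr u' : {morph f u' : a b / a + b} /\
             (forall a b, f u' (a *: b) = a *: f u' b).
  have f0 : f u' 0 = 0.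
    have := fr u' 1 0 0; rewrite !scale1r addr0 => e.
    by apply: (addrI (f u' 0)); rewrite addr0 -e.
  split=> [a b|a b]; first by have := fr u' 1 a b; rewrite !scale1r.
  by have := fr u' a b 0; rewrite !addr0 f0 addr0.
have suml v' I r (F : I -> U) :
    f (\sum_(i <- r) F i) v' = \sum_(i <- r) f (F i) v'.
  elim/big_rec2: _ => [|i y1 y2 _ <-]; last by rewrite (sl v').1.
  by have := (sl v').2 0 0; rewrite !scale0r.
have sumr u' I r (F : I -> V) :
    f u' (\sum_(i <- r) F i) = \sum_(i <- r) f u' (F i).
  elim/big_rec2: _ => [|i y1 y2 _ <-]; last by rewrite (sr u').1.
  by have := (sr u').2 0 0; rewrite !scale0r.
rewrite {2}(coord_vbasis (memvf u)) {2}(coord_vbasis (memvf v)) suml.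
rewrite /lift; apply: eq_bigr => i _; rewrite (sl _).2 sumr scaler_sumr.
by apply: eq_bigr => j _; rewrite mxE (sr _).2 scalerA.
Qed.

Lemma tens_ext (W : lmodType K) (f1 f2 : {linear tens U V -> W}) :
  (forall u v, f1 (tensor u v) = f2 (tensor u v)) -> f1 =1 f2.
Proof.
move=> eqf A.
suff -> : A = \sum_(i < \dim {:U}) \sum_(j < \dim {:V})
    (A : 'M_(_, _)) i j *: tensor (vbasis {:U})`_i (vbasis {:V})`_j.
  rewrite !linear_sum; apply: eq_bigr => i _; rewrite !linear_sum.
  by apply: eq_bigr => j _; rewrite !linearZ /= eqf.
rewrite [LHS](matrix_sum_delta (A : 'M_(_, _))).
apply: eq_bigr => i _; apply: eq_bigr => j _; congr (_ *: _).
apply/matrixP=> i' j'; rewrite !mxE !coord_free ?(basis_free (vbasisP _)) //.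
by rewrite -natrM mulnb (eq_sym i) (eq_sym j).
Qed.

End Tensor.

Section TensorOps.
Variables (K : fieldType).

Definition tmap (U U' V V' : vectType K) (f : U -> U') (h : V -> V')
  : tens U V -> tens U' V' := lift (fun u v => tensor (f u) (h v)).

Definition tswap (U V : vectType K) : tens U V -> tens V U :=
  lift (fun u v => tensor v u).

Definition wedge (U : vectType K) (u v : U) : tens U U :=
  tensor u v - tensor v u.

Definition tens3 (U : vectType K) := tens (tens U U) U.
Definition tensor3 (U : vectType K) (u v w : U) : tens3 U :=
  tensor (tensor u v : tens U U) w.
Definition lift3 (U : vectType K) (W : lmodType K) (f : U -> U -> U -> W)
  : tens3 U -> W := lift (fun A w => lift (fun u v => f u v w) A).
Definition tcycle (U : vectType K) : tens3 U -> tens3 U :=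
  lift3 (fun u v w => tensor3 v w u).
Definition tswap12 (U : vectType K) : tens3 U -> tens3 U :=
  lift3 (fun u v w => tensor3 v u w).
Definition tswap23 (U : vectType K) : tens3 U -> tens3 U :=
  lift3 (fun u v w => tensor3 u w v).

(* Exterior powers are realized as antisymmetric tensors (they are only used
   in characteristic zero). *)
Definition Lambda2 (U : vectType K) (r : tens U U) : Prop := tswap r = - r.
Definition Lambda3 (U : vectType K) (s : tens3 U) : Prop :=
  tswap12 s = - s /\ tswap23 s = - s.

Variable g : lieAlgType K.

Definition ad2 (x : g) : tens g g -> tens g g :=
  lift (fun u v => tensor (lie x u) v + tensor u (lie x v)).

Definition ad3 (x : g) : tens3 g -> tens3 g :=
  lift3 (fun u v w => tensor3 (lie x u) v w + tensor3 u (lie x v) w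
                        + tensor3 u v (lie x w)).

(* With r = \sum a (x) b = \sum c (x) d, the summands are [r12, r13],
   [r12, r23] and [r13, r23]. *)
Definition CYB (r : tens g g) : tens3 g :=
  lift (fun a b => lift (fun c d =>
    tensor3 (lie a c) b d + tensor3 a (lie b c) d + tensor3 a c (lie b d))
    r) r.

Definition cobracket_of (r : tens g g) : 'Hom(g, tens g g) :=
  linfun (fun x => ad2 x r).

End TensorOps.

Section Bialgebra.
Variables (K : fieldType) (g : lieAlgType K).
Implicit Types (d : 'Hom(g, tens g g)) (D : 'End(g)).

Definition co_jacobi d : Prop := forall x,
  let s := tmap d id (d x) : tens3 g in s + tcycle s + tcycle (tcycle s) = 0.

Definition cocycle d : Prop := forall x y,
  d (lie x y) = ad2 x (d y) - ad2 y (d x).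

Definition lie_bialgebra d : Prop :=
  [/\ forall x, Lambda2 (d x), co_jacobi d & cocycle d].

Definition coboundary d : Prop :=
  exists r, Lambda2 r /\ (forall x, d x = ad2 x r).

Definition derivation D : Prop := forall x y,
  D (lie x y) = lie (D x) y + lie x (D y).

Definition coderivation d D : Prop := forall x,
  tmap D id (d x) + tmap id D (d x) = d (D x).

Definition biderivation d D : Prop := derivation D /\ coderivation d D.

Definition symmetric_part (r : tens g g) : tens g g :=
  2%:R^-1 *: (r + tswap r).

Definition dual_pairing (s : tens g g) (xi eta : 'Hom(g, K^o)) : K :=
  lift (fun u v => (xi u * eta v : K^o)) s.

Definition factorizable d : Prop := exists r,
  [/\ forall x, d x = ad2 x r,
      CYB r = 0
    & forall xi, (forall eta, dual_pairing (symmetric_part r) xi eta = 0) ->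
        xi = 0].

End Bialgebra.

Section AbelianExtension.
Variables (K : fieldType) (g : lieAlgType K).

Definition incl (x : g) : g * K^o := (x, 0).
Definition tvec : g * K^o := (0, 1).

(* r - H /\ t *)
Definition ext_tensor (r : tens g g) (H : g) : tens (g * K^o)%type (g * K^o)%type :=
  tmap incl incl r - wedge (incl H) tvec.
End AbelianExtension.
Arguments tvec {K} g.

Definition bialgebra_iso (K : fieldType) (g1 g2 : lieAlgType K)
    (d1 : 'Hom(g1, tens g1 g1)) (d2 : 'Hom(g2, tens g2 g2)) : Prop :=
  exists f : 'Hom(g1, g2),
    [/\ bijective f,
        forall x y, f (lie x y) = lie (f x) (f y)
      & forall x, tmap f f (d1 x) = d2 (f x)].

(* The complexification of V, with (x, y) standing for x + i y. *)
Definition cplx (R : rcfType) (V : vectType R) : Type := (V * V)%type.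

Section Complexification.
Variables (R : rcfType) (V : vectType R).
Local Notation C := R[i].

HB.instance Definition _ := GRing.Zmodule.copy (cplx V) (V * V)%type.

Definition cplx_scale (c : C) (z : cplx V) : cplx V :=
  (complex.Re c *: z.1 - complex.Im c *: z.2,
   complex.Re c *: z.2 + complex.Im c *: z.1).

Fact cplx_scalerA a b z :
  cplx_scale a (cplx_scale b z) = cplx_scale (a * b) z.
Proof.
case: a b z => [a a'] [b b'] [x y]; rewrite /cplx_scale /=.
by congr (_, _); apply: vect_coordP => i;
  rewrite !(linearD, linearN, linearZ) /=; ring.
Qed.
Fact cplx_scale1r : left_id 1 cplx_scale.
Proof. by case=> x y; rewrite /cplx_scale /= !scale1r !scale0r subr0 addr0. Qed.
Fact cplx_scalerDr : right_distributive cplx_scale +%R.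
Proof.
move=> a [x y] [x' y']; rewrite /cplx_scale /=; congr (_, _) => /=.
  by rewrite !scalerDr opprD addrACA.
by rewrite !scalerDr addrACA.
Qed.
Fact cplx_scalerDl z : {morph cplx_scale^~ z : a b / a + b}.
Proof.
move: z => [x y] [a a'] [b b']; rewrite /cplx_scale /=; congr (_, _) => /=.
  by rewrite !scalerDl opprD addrACA.
by rewrite !scalerDl addrACA.
Qed.

HB.instance Definition _ := GRing.Zmodule_isLmodule.Build C (cplx V)
  cplx_scalerA cplx_scale1r cplx_scalerDr cplx_scalerDl.

Fact cplx_vect_axiom : Vector.axiom (\dim {:V}) (cplx V).
Proof.
pose b := vbasis {:V}.
pose f (z : cplx V) : 'rV[C]_(\dim {:V}) :=
  \row_i Complex (coord b i z.1) (coord b i z.2).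
pose f' (r : 'rV[C]_(\dim {:V})) : cplx V :=
  (\sum_i complex.Re (r 0 i) *: b`_i, \sum_i complex.Im (r 0 i) *: b`_i).
exists f.
  move=> [c c'] [x y] [x' y']; apply/rowP => i; rewrite !mxE /=.
  by apply/eqP; rewrite eq_complex /=; apply/andP; split; apply/eqP;
    rewrite !(linearD, linearN, linearZ) /= ?mulrN.
exists f'.
  move=> [x y]; congr (_, _); rewrite [RHS](coord_vbasis (memvf _));
    by apply: eq_bigr => i _; rewrite mxE.
move=> r; apply/rowP=> i; rewrite mxE /=.
rewrite !coord_sum_free ?(basis_free (vbasisP _)) //.
by case: (r 0 i).
Qed.

HB.instance Definition _ := Lmodule_hasFinDim.Build C (cplx V) cplx_vect_axiom.

Definition to_cplx (x : V) : cplx V := (x, 0).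
End Complexification.

Section ComplexLie.
Variables (R : rcfType) (g : lieAlgType R).

Definition cplx_lie (z w : cplx g) : cplx g :=
  (lie z.1 w.1 - lie z.2 w.2, lie z.1 w.2 + lie z.2 w.1).

Fact cplx_lie_linearr z : linear (cplx_lie z).
Proof.
move=> [a a'] [x y] [x' y']; case: z => [u v].
rewrite /cplx_lie /=; congr (_, _) => /=; rewrite !(lieDr, lieNr, lieZr);
  by apply: vect_coordP => i; rewrite !(linearD, linearN, linearZ) /=; ring.
Qed.

Let cplx_lieC z w : cplx_lie z w = - cplx_lie w z.
Proof.
case: z w => [x y] [x' y']; rewrite /cplx_lie /=; congr (_, _) => /=;
  by rewrite ![lie x _]lieC ![lie y _]lieC; apply: vect_coordP => i;
     rewrite !(linearD, linearN) /=; ring.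
Qed.

Fact cplx_lie_linearl w : linear (fun z => cplx_lie z w).
Proof.
by move=> a u v; rewrite !(cplx_lieC _ w) cplx_lie_linearr opprD scalerN.
Qed.
Fact cplx_liexx z : cplx_lie z z = 0.
Proof.
by case: z => x y; rewrite /cplx_lie /= !liexx subrr (lieC y) subrr.
Qed.
Fact cplx_lie_jacobi x y z :
  cplx_lie x (cplx_lie y z) + cplx_lie y (cplx_lie z x)
    + cplx_lie z (cplx_lie x y) = 0.
Proof.
case: x y z => [x x'] [y y'] [z z'].
rewrite /cplx_lie /=; congr (_, _) => /=; rewrite !(lieDr, lieNr);
  apply: vect_coordP => i; rewrite !(linearD, linearN, linear0) /=;
  have J (a b c : g) := congr1 (coord (vbasis {:g}) i) (lie_jacobi a b c);
  have {}J (a b c : g) : coord (vbasis {:g}) i (lie a (lie b c))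
    = - coord (vbasis {:g}) i (lie b (lie c a))
      - coord (vbasis {:g}) i (lie c (lie a b))
    by have := J a b c; rewrite !linearD linear0 /=; lra.
- have := J x y z; have := J x y' z'; have := J x' y z'; have := J x' y' z.
  lra.
- have := J x' y z; have := J x y' z; have := J x y z'; have := J x' y' z'.
  lra.
Qed.

HB.instance Definition _ := Vector_isLie.Build R[i] (cplx g)
  cplx_lie_linearl cplx_lie_linearr cplx_liexx cplx_lie_jacobi.

Definition to_cplx2 (A : tens g g) : tens (cplx g) (cplx g) :=
  \sum_(i < \dim {:g}) \sum_(j < \dim {:g})
    real_complex R ((A : 'M_(_, _)) i j)
      *: tensor (to_cplx (vbasis {:g})`_i) (to_cplx (vbasis {:g})`_j).

Lemma to_cplx2_tensor (u v : g) :
  to_cplx2 (tensor u v) = tensor (to_cplx u) (to_cplx v).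
Proof.
have toE (x : g) : to_cplx x = \sum_(i < \dim {:g})
    real_complex R (coord (vbasis {:g}) i x) *: to_cplx (vbasis {:g})`_i.
  have toZ (c : R) (y : g) : real_complex R c *: to_cplx y = to_cplx (c *: y).
    rewrite [LHS]/(cplx_scale _ _) /cplx_scale /to_cplx /=.
    by rewrite !scale0r scaler0 subr0 addr0.
  have toD (y z : g) : to_cplx (y + z) = to_cplx y + to_cplx z.
    by rewrite /to_cplx -[RHS]/(y + z, 0 + 0) addr0.
  under eq_bigr do rewrite toZ.
  rewrite -(big_morph (@to_cplx R g) toD (erefl : to_cplx 0 = 0)).
  by rewrite -coord_vbasis ?memvf.
rewrite [in RHS]toE [in RHS](toE v).
apply/matrixP=> k l; rewrite /to_cplx2 summxE mxE !linear_sum /= mulr_suml.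
apply: eq_bigr => i _; rewrite summxE mulr_sumr; apply: eq_bigr => j _.
by rewrite !mxE !linearZ /= rmorphM /= mulrACA.
Qed.

Definition cplx_cobracket (d : 'Hom(g, tens g g))
  : 'Hom(cplx g, tens (cplx g) (cplx g)) :=
  linfun (fun z : cplx g => to_cplx2 (d z.1) + Complex 0 1 *: to_cplx2 (d z.2)).

Definition almost_factorizable (d : 'Hom(g, tens g g)) : Prop :=
  ~ factorizable d /\ factorizable (cplx_cobracket d).

End ComplexLie.

Section BelavinDrinfeld.
Variables (K : fieldType) (a : lieAlgType K).

(* A bilinear form, encoded as a linear map to the dual space. *)
Definition bilform (U : vectType K) := 'Hom(U, 'Hom(U, K^o)).

Definition invariant_form (B : bilform a) : Prop :=
  [/\ forall x y, B x y = B y x,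
      forall x y z, B (lie x y) z = B x (lie y z)
    & forall x, (forall y, B x y = 0) -> x = 0].

(* The element \sum_i e_i (x) e^i, where e^i is the B-dual basis of e_i. *)
Definition casimir (B : bilform a) : tens a a :=
  \sum_(i < \dim {:a})
    tensor (vbasis {:a})`_i
      ((B^-1)%VF (linfun (coord (vbasis {:a}) i : a -> K^o))).

Variable h : {vspace a}.

Definition hdual := 'Hom(subvs_of h, K^o).
Implicit Types (al be : hdual) (G Phi Delta : seq hdual).

(* Meaningful for x \in h. *)
Definition evalh al (x : a) : K := al (vsproj h x).

Definition root_space al : {vspace a} :=
  (\bigcap_(i < \dim h)
     lker (ad (vbasis h)`_i - evalh al (vbasis h)`_i *: \1)%VF)%VS.

Lemma root_spaceP al x :
  x \in root_space al <-> (forall y, y \in h -> lie y x = evalh al y *: x).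
Proof.
have ladE i : (x \in lker (ad (vbasis h)`_i - evalh al (vbasis h)`_i *: \1)%VF)
    = (lie (vbasis h)`_i x == evalh al (vbasis h)`_i *: x).
  by rewrite memv_ker !lfun_simp adE subr_eq0.
split=> [|xP]; last first.
  rewrite memvE; apply/subv_bigcapP => i _; rewrite -memvE ladE xP //.
  by apply: vbasis_mem; rewrite mem_nth ?size_tuple.
rewrite memvE => /subv_bigcapP xP y yh; rewrite (coord_vbasis yh).
pose lx := GRing.isLinear.Build K a a *:%R (fun y => lie y x)
  (@lie_is_linearl _ _ x).
pose f : {linear a -> a} := HB.pack (fun y => lie y x) lx.
rewrite -[LHS]/(f _) /evalh !linear_sum /= scaler_suml.
apply: eq_bigr => i _; rewrite !linearZ /= lieZl; apply: etrans (scalerA _ _ _).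
congr (_ *: _).
have lt_i : (i < size (vbasis h))%N by rewrite size_tuple.
by apply/eqP; rewrite -ladE memvE xP.
Qed.

Definition is_root al : Prop := al <> 0 /\ root_space al <> 0%VS.

Definition root_system Phi : Prop :=
  uniq Phi /\ (forall al, al \in Phi <-> is_root al).

Definition hform (B : bilform a) : bilform (subvs_of h) :=
  linfun (fun y : subvs_of h =>
    (B (vsval y) \o linfun (vsval : subvs_of h -> a))%VF).

(* The form induced by B on the dual of h: both arguments are moved to h
   along the isomorphism y |-> B y. *)
Definition hdual_form (B : bilform a) al be : K :=
  hform B (((hform B)^-1)%VF al) (((hform B)^-1)%VF be).

Definition nonneg_comb Delta be : Prop :=
  exists c : hdual -> nat, be = \sum_(al <- Delta) al *+ c al.

Definition simple_roots Phi Delta : Prop :=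
  [/\ free Delta, {subset Delta <= Phi}
    & forall be, be \in Phi ->
        nonneg_comb Delta be \/ nonneg_comb Delta (- be)].

Definition positive Phi Delta be : Prop :=
  be \in Phi /\ nonneg_comb Delta be.

Definition BD_triple (B : bilform a) Delta G1 G2 (tau : hdual -> hdual)
    : Prop :=
  [/\ [/\ uniq G1, uniq G2, {subset G1 <= Delta} & {subset G2 <= Delta}],
      {in G1 &, injective tau} /\ [seq tau al | al <- G1] =i G2,
      {in G1 &, forall al be,
         hdual_form B (tau al) (tau be) = hdual_form B al be}
    & forall al, al \in G1 -> exists n : nat,
        [/\ (0 < n)%N, forall k, (k < n)%N -> iter k tau al \in G1,
            iter n tau al \in G2 & iter n tau al \notin G1]].

Definition zspan G be : Prop :=
  exists c : hdual -> int, be = \sum_(al <- G) al *~ c al.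

(* The graph of the additive extension of tau to the subgroup generated by
   G1. *)
Definition tau_additive G1 (tau : hdual -> hdual) al be : Prop :=
  exists c : hdual -> int,
    al = \sum_(ga <- G1) ga *~ c ga /\ be = \sum_(ga <- G1) tau ga *~ c ga.

Definition BD_prec Phi Delta G1 G2 tau al be : Prop :=
  [/\ positive Phi Delta al /\ zspan G1 al,
      positive Phi Delta be /\ zspan G2 be
    & exists (n : nat) (s : nat -> hdual),
        [/\ (0 < n)%N, s 0%N = al, s n = be
          & forall k, (k < n)%N -> tau_additive G1 tau (s k) (s k.+1)]].

Definition tens_sub (U V : {vspace a}) : {vspace tens a a} :=
  <<[seq tensor u v | u <- vbasis U, v <- vbasis V]>>%VS.

(* The projection of a onto h along the sum of the root spaces. *)
Definition proj_h Phi : 'End(a) :=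
  daddv_pi h (\sum_(al <- Phi) root_space al)%VS.

Definition continuous_parameter (B : bilform a) Phi G1
    (tau : hdual -> hdual) (r0 : tens a a) : Prop :=
  [/\ r0 \in tens_sub h h,
      forall al, al \in G1 ->
        lift (fun u v => evalh (tau al) u *: v + evalh al v *: u) r0 = 0
    & r0 + tswap r0 = tmap (proj_h Phi) (proj_h Phi) (casimir B)].

Definition root_vectors (B : bilform a) Phi (x : hdual -> a) : Prop :=
  forall al, al \in Phi -> x al \in root_space al /\ B (x al) (x (- al)) = 1.

Definition BD_rmatrix_of Phi Delta G1 G2 tau (r0 : tens a a) (x : hdual -> a)
    : tens a a :=
  r0 + \sum_(al <- Phi | `[< positive Phi Delta al >]) tensor (x (- al)) (x al)
     + \sum_(al <- Phi | `[< positive Phi Delta al >])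
         \sum_(be <- Phi | `[< BD_prec Phi Delta G1 G2 tau al be >])
           (tensor (x (- al)) (x be) - tensor (x be) (x (- al))).

Definition BD_rmatrix G1 G2 tau (rho : tens a a) : Prop :=
  cartan h /\
  exists (B : bilform a) Phi Delta (r0 : tens a a) (x : hdual -> a),
    [/\ invariant_form B, root_system Phi /\ simple_roots Phi Delta,
        BD_triple B Delta G1 G2 tau, continuous_parameter B Phi G1 tau r0
      & root_vectors B Phi x /\
        rho = BD_rmatrix_of Phi Delta G1 G2 tau r0 x].

End BelavinDrinfeld.

(* Main.v *)
Require Import Defs.
From HB Require Import structures.
From mathcomp Require Import all_boot all_order all_algebra falgebra fieldext.
From mathcomp Require Import boolp reals complex ring.

Set Implicit Arguments.
Unset Strict Implicit.
Unset Printing Implicit Defensive.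

Import Order.TTheory GRing.Theory Num.Theory.
Local Open Scope ring_scope.

(** The first part rests on two facts about a semisimple Lie algebra [g] in
characteristic 0: Whitehead's first lemma, that every 1-cocycle of [g] with
values in a finite-dimensional module is a coboundary ([whitehead]), and the
vanishing of the invariants of the exterior square of [g] ([ss_invariant2]).
A cobracket is a 1-cocycle, hence of the form [ad2 x r], and [r] can be made
antisymmetric. For such an [r] the co-Jacobi expression of [x] is
[- ad3 x (CYB r)] ([co_jacobi_CYB]), so co-Jacobi says that [CYB r] is
invariant. A derivation of [g] is [ad H] by Whitehead again; it is a
coderivation exactly when [dg (lie H x) = ad2 H (dg x)], which by the cocycle
identity says that [dg H] is an invariant bivector, that is [dg H = 0].

On [L = g * K t] the cobracket kills [t], since [d t] is invariant and [L] has
no nonzero [g]-invariant bivector ([invariant2_ext]); restricted to [g] it is a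
1-cocycle, hence a coboundary. Splitting an antisymmetric tensor of [L] into its
[g]-part [r] and its [t]-part [- H /\ t], the co-Jacobi expression splits into
that of [ad2 x r] and a term carrying [dg (lie H x) - ad2 H (dg x)]
([co_jacobi_ext]), so it vanishes exactly when [ad H] is a biderivation.
Rescaling [t] rescales [H].

Whitehead's lemma is proved over the ground field itself. An element [x] of
the derived algebra of the radical of a trace form acts nilpotently
([trace_radical_nilpotent]): over a splitting field one constructs a polynomial
in the matrix of [x] whose eigenvalues are the images of those of [x] under an
additive integer-valued function, and the trace of its product with [x] is a
sum of positive multiples of squares. With Engel's theorem this makes the
Killing form nondegenerate, and it makes the trace form of a nontrivial
representation nonzero, which yields a Casimir operator that is not nilpotent;
a cocycle splits off the part on which this operator is invertible, and
induction on the rank of the complementary idempotent finishes the proof.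

For the second part, identify a tensor with an operator by contraction with the
invariant form, and let [P] be the operator of [rho] ([contr]). The cobracket is
antisymmetric, so [rho + tswap rho] is invariant; its operator commutes with
[ad] and fixes every root vector, hence is the identity ([contr_sym_id]). This
gives the root decomposition, and also that [P] and [1 - P] are adjoint to each
other, so that the generalized eigenspaces of [P] for the eigenvalues 0 and 1
are isotropic. As [tau] eventually leaves [G1], the explicit formula for [rho]
shows that positive root vectors lie in the eigenspace for 1 and negative ones
in that for 0 ([pos_gen_kernel], [neg_gen_kernel]). If [ad2 H rho = 0], then [ad H]
commutes with [P] and preserves both spaces; the norm of [lie H (x ga)] being 0
forces [H] to be orthogonal to [x ga] ([isotropic_root_coord]), so [H] lies in
[h]. Pairing [P (lie H (x al)) = lie H (P (x al))] with the vector of weight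
[- tau al] then gives [tau al H = al H]; conversely these equations make every
term of [rho] invariant under [H]. The real case reduces to the complex one,
because the complexification of [g] again has no nonzero abelian ideal
([cplx_no_abelian]). *)

(** * Splitting fields and traces of polynomials in a matrix *)

Lemma irreducible_factor (K : fieldType) (p : {poly K}) :
  (1 < size p)%N -> exists2 q : {poly K}, irreducible_poly q & q %| p.
Proof.
have [n] := ubnP (size p); elim: n p => // n IHn p /ltnSE sp p1.
have [irr|nirr] := pselect (irreducible_poly p); first by exists p.
have /existsNP[q /not_implyP[q1 /not_implyP[qp nqp]]] :
    ~ (forall q : {poly K}, size q != 1 -> q %| p -> q %= p).
  by move=> h; apply: nirr.
have p0 : p != 0 by rewrite -size_poly_gt0 (ltn_trans _ p1).
have q0 : q != 0 by apply: contraNneq p0 => q0; rewrite -dvd0p -q0.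
have q_gt1 : (1 < size q)%N.
  by rewrite ltn_neqAle eq_sym q1 size_poly_gt0.
have [|k kirr kq] := IHn q _ q_gt1.
  apply: leq_trans sp; rewrite ltn_neqAle dvdp_leq // andbT.
  by apply/negP => /eqP e; apply: nqp; rewrite -dvdp_size_eqp // e.
by exists k => //; apply: dvdp_trans kq qp.
Qed.

(** A root of an irreducible factor is adjoined, the corresponding linear factor
is divided out, and the degree of the quotient drops; the leading coefficient is
kept so that [p] need not be monic. *)
Lemma splitting_extension (K : fieldType) (p : {poly K}) : p != 0 ->
  exists (L : fieldType) (iota : {rmorphism K -> L}) (s : seq L),
    map_poly iota p = iota (lead_coef p) *: \prod_(z <- s) ('X - z%:P).
Proof.
have [n] := ubnP (size p); elim: n K p => // n IHn K p /ltnSE sp p0.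
have [p1|p1] := leqP (size p) 1.
  exists K, (GRing.RMorphism.clone _ _ idfun _), [::].
  rewrite big_nil map_poly_id // (size1_polyC p1) lead_coefC.
  by rewrite alg_polyC.
have [q qirr qp] := irreducible_factor p1.
have [L0 _ [z qz _]] := irredp_FAdjoin qirr.
pose i0 : {rmorphism K -> L0} := in_alg L0.
have pz : root (map_poly i0 p) z.
  by case/dvdpP: qp => u ->; rewrite rmorphM /= rootM qz orbT.
have [p' p'E] := factor_theorem _ _ pz.
have p'0 : p' != 0.
  by apply: contraNneq p0 => p'0; move: p'E; rewrite p'0 mul0r => /eqP;
     rewrite map_poly_eq0.
have [] := IHn L0 p' _ p'0.
  have := congr1 (fun r : {poly L0} => size r) p'E.
  rewrite size_map_poly size_Mmonic ?monicXsubC // size_XsubC addn2 /= => e.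
  by rewrite -ltnS -e.
move=> L [i1 [s p's]].
exists L, (GRing.RMorphism.clone _ _ (i1 \o i0) _), (i1 z :: s).
rewrite map_poly_comp /= p'E rmorphM /= p's big_cons rmorphB /= map_polyX.
rewrite map_polyC /= mulrC -scalerAr; congr (_ *: _); congr (i1 _).
have := congr1 lead_coef p'E.
by rewrite lead_coef_Mmonic ?monicXsubC // lead_coef_map => <-.
Qed.

Section TraceSplit.
Variable L : fieldType.

Lemma horner_mx_XsubC n (X : 'M[L]_n.+1) l :
  horner_mx X ('X - l%:P) = X - l%:M.
Proof. by rewrite rmorphB /= horner_mx_X horner_mx_C. Qed.

(** Taylor expansion to first order, in the form used to peel off one eigenvalue. *)
Lemma horner_mx_at n (X : 'M[L]_n.+1) l (p : {poly L}) :
  exists q : {poly L}, p = p.[l]%:P + ('X - l%:P) * q.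
Proof.
have /factor_theorem[q e] : root (p - p.[l]%:P) l.
  by rewrite /root hornerD hornerN hornerC subrr.
by exists q; rewrite mulrC -e addrC subrK.
Qed.

(** The multiset of eigenvalues, obtained without triangularizing [X]: if
[X - l] has the rank factorization [C R], then [R X = X' R] with [X' = R C + l],
a smaller matrix killed by one factor less, and
[tr p(X) - tr p(X') = p(l) (n - rank (X - l))] because [tr (C M R) = tr (M R C)]. The
positivity of the multiplicities is what makes sums of squares weighted by them
definite. *)
Lemma mxtrace_horner_split (s : seq L) n (X : 'M[L]_n.+1) :
  \prod_(l <- s) (X - l%:M) = 0 ->
  exists t : seq (L * nat),
    [/\ {subset unzip1 t <= s}, all (fun k => 0 < k)%N (unzip2 t),
        \prod_(lk <- t) (X - lk.1%:M) = 0
      & forall p, \tr (horner_mx X p) = \sum_(lk <- t) p.[lk.1] *+ lk.2].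
Proof.
elim: s n X => [|l s IHs] n X.
  by rewrite big_nil => /eqP; rewrite oner_eq0.
rewrite big_cons => X0; pose N := X - l%:M.
have tr_l p : \tr (p.[l]%:M : 'M[L]_n.+1) = p.[l] *+ n.+1 by rewrite mxtrace_scalar.
case/boolP: (N \is a GRing.unit) => [Nu|].
  have {}X0 : \prod_(l <- s) (X - l%:M) = 0.
    by have := congr1 ( *%R N^-1) X0; rewrite mulr0 mulKr.
  have [t [ts tp t0 tE]] := IHs n X X0; exists t; split=> // z /ts.
  by rewrite inE => ->; rewrite orbT.
rewrite -[_ \is a _]/(N \in unitmx) -row_free_unit => nN.
have ltr : (\rank N < n.+1)%N by rewrite ltn_neqAle nN rank_leq_row.
have CRE : col_base N *m row_base N = N := mulmx_base N.
have frC : row_free (row_base N) := row_base_free N.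
have fC : row_full (col_base N) := col_base_full N.
move: (col_base N) (row_base N) CRE frC fC; case rE: (\rank N) => [|r] C R CRE frR fuC.
  exists [:: (l, n.+1)]; rewrite /= big_seq1 /=; split=> //.
  - by move=> z; rewrite !inE => ->.
  - by rewrite -/N -CRE; apply/matrixP=> i j; rewrite !mxE big_ord0.
  move=> p; rewrite big_seq1 /= -tr_l.
  have [q ->] := horner_mx_at X l p.
  rewrite rmorphD rmorphM /= horner_mx_XsubC -/N -CRE horner_mx_C hornerD hornerM.
  rewrite hornerXsubC subrr mul0r addr0 hornerC.
  suff -> : C *m R = 0 by rewrite mul0r addr0.
  by apply/matrixP=> i j; rewrite !mxE big_ord0.
(* [X] acts on the range of [X - l] as [X'] acts on coordinates. *)
pose X' := R *m C + l%:M.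
have XR : R *m X = X' *m R.
  have -> : X = C *m R + l%:M by rewrite CRE /N subrK.
  by rewrite mulmxDr mulmxDl mulmxA scalar_mxC.
have hR p : R *m horner_mx X p = horner_mx X' p *m R.
  elim/poly_ind: p => [|p c IHp]; first by rewrite !rmorph0 mulmx0 mul0mx.
  rewrite !rmorphD !rmorphM /= !horner_mx_X !horner_mx_C mulmxDr mulmxDl.
  rewrite scalar_mxC -!mulmxE mulmxA IHp.
  by rewrite -[in LHS]mulmxA XR mulmxA.
have prodE k (Y : 'M[L]_k.+1) (u : seq L) :
    \prod_(z <- u) (Y - z%:M) = horner_mx Y (\prod_(z <- u) ('X - z%:P)).
  by rewrite rmorph_prod /=; apply: eq_bigr => z _; rewrite horner_mx_XsubC.
have X'0 : \prod_(z <- s) (X' - z%:M) = 0.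
  apply: (row_free_inj frR); apply: (row_full_inj fuC).
  by rewrite mul0mx mulmx0 prodE -hR mulmxA CRE -prodE.
have [t [ts tp t0 tE]] := IHs _ _ X'0.
exists ((l, n.+1 - r.+1)%N :: t); split.
- move=> z; rewrite !inE => /orP[->//|/ts ->]; exact: orbT.
- by rewrite /= tp subn_gt0 -rE ltr.
- rewrite big_cons /= -/N -CRE -(big_map fst xpredT (fun z => X - z%:M)) prodE.
  rewrite -mulmxE -mulmxA hR -prodE big_map.
  by rewrite t0 mul0mx mulmx0.
move=> p; rewrite big_cons /= -tE mulrnBr ?(leq_trans _ ltr) ?rE //.
have [q pE] := horner_mx_at X l p; rewrite {1}pE rmorphD rmorphM /= horner_mx_C.
rewrite horner_mx_XsubC -/N -CRE mxtraceD tr_l -addrA; congr (_ + _).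
rewrite -mulmxE -mulmxA hR mxtrace_mulC -mulmxA.
have -> : R *m C = X' - l%:M by rewrite addrK.
rewrite -horner_mx_XsubC mulmxE -rmorphM /= [q * _]mulrC.
have -> : ('X - l%:P) * q = p - p.[l]%:P by rewrite {1}pE addrAC subrr add0r.
by rewrite rmorphB /= horner_mx_C raddfB /= mxtrace_scalar addrC.
Qed.
End TraceSplit.

(** * Integer functionals, interpolation and generalized eigenvectors *)

(** A subspace of maximal dimension among those contained in [P] is all of [P]. *)
Lemma vspace_of_pred (K : fieldType) (V : vectType K) (P : V -> Prop) :
  P 0 -> (forall a u v, P u -> P v -> P (a *: u + v)) ->
  exists U : {vspace V}, forall v, v \in U <-> P v.
Proof.
move=> P0 PD.
pose Q n := `[< exists U : {vspace V}, \dim U = n /\ forall v, v \in U -> P v >].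
have exQ : exists n, Q n.
  exists 0%N; apply/asboolP; exists 0%VS; rewrite dimv0; split=> // v.
  by rewrite memv0 => /eqP->.
have ubQ n : Q n -> (n <= \dim {:V})%N.
  by move=> /asboolP[U [<- _]]; rewrite dimvS ?subvf.
case: (ex_maxnP exQ ubQ) => n /asboolP[U [Un UP]] nmax.
exists U => v; split=> [/UP//|Pv]; apply: contrapT => /negP vU.
have: Q (\dim (U + <[v]>)); last first.
  move=> /nmax; rewrite -Un leqNgt => /negP; apply.
  rewrite ltn_neqAle dimvS ?addvSl // andbT; apply: contra vU => /eqP e.
  have /eqP -> : U == (U + <[v]>)%VS by rewrite eqEdim addvSl -e leqnn.
  by rewrite (subvP (addvSr _ _)) ?memv_line.
apply/asboolP; exists (U + <[v]>)%VS; split=> // w.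
move=> /memv_addP[u uU [w' /vlineP[k ->] ->]].
by rewrite addrC; apply: PD => //; apply: UP.
Qed.

Lemma char0_natr_eq0 (L : fieldType) : [pchar L] =i pred0 ->
  forall n, (n%:R == 0 :> L) = (n == 0)%N.
Proof. by move=> ch0; apply/pcharf0P. Qed.

Lemma char0_intr_eq0 (L : fieldType) : [pchar L] =i pred0 ->
  forall m : int, (m%:~R == 0 :> L) = (m == 0).
Proof.
move=> ch0 [n|n]; first by rewrite -pmulrn char0_natr_eq0.
by rewrite NegzE mulrNz oppr_eq0 -pmulrn char0_natr_eq0 // oppr_eq0.
Qed.

(** The integer relations between the [s i] span a rational subspace that does
not contain the basis vector of [i0], since [s i0] is nonzero and the
characteristic is 0; some coordinate of the projection off this subspace is
nonzero at [i0], and clearing denominators makes it integral. *)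
Lemma int_functional (L : fieldType) k (s : 'I_k -> L) i0 :
  [pchar L] =i pred0 -> s i0 != 0 ->
  exists2 q : 'I_k -> int, q i0 != 0 &
    forall d : 'I_k -> int, \sum_i s i *~ d i = 0 -> \sum_i d i * q i = 0.
Proof.
move=> ch0 s0.
(* Rational multiples of integer relations between the [s i]. *)
pose P (c : 'rV[rat]_k) := exists (m : int) (d : 'I_k -> int),
  [/\ m != 0, forall i, m%:~R * c 0 i = (d i)%:~R & \sum_i s i *~ d i = 0].
have [U UP] : exists U : {vspace 'rV[rat]_k}, forall v, v \in U <-> P v.
  apply: vspace_of_pred.
    exists 1, (fun=> 0); split=> // [i|]; first by rewrite mxE mulr0.
    by rewrite big1.
  move=> a u v [m1 [d1 [m10 d1E d1s]]] [m2 [d2 [m20 d2E d2s]]].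
  exists (denq a * m1 * m2), (fun i => numq a * m2 * d1 i + denq a * m1 * d2 i).
  split=> [|i|].
  - by rewrite !mulf_neq0 ?denq_neq0.
  - rewrite !mxE mulrDr !(rmorphM, rmorphD) /= -d1E -d2E numqE.
    congr (_ + _); last by rewrite !mulrA.
    by rewrite !mulrA [_ * a]mulrC -!mulrA; congr (_ * (_ * _)); rewrite mulrCA.
  under eq_bigr do rewrite mulrzDr [numq a * m2 * _]mulrC [denq a * m1 * _]mulrC !mulrzA.
  by rewrite big_split /= -!mulrz_suml d1s d2s !mul0rz addr0.
pose e : 'rV[rat]_k := delta_mx 0 i0.
pose f (c : 'rV[rat]_k) : 'rV[rat]_k := c - projv U c.
have fe : f e != 0.
  rewrite /f subr_eq0; apply/negP => /eqP eU.
  have /UP[m [d [m0 dE ds]]] : e \in U by rewrite eU memv_proj.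
  have d0 i : i != i0 -> d i = 0.
    move=> ii0; apply/eqP; rewrite -(intr_eq0 rat) -dE mxE (negPf ii0) andbF.
    by rewrite mulr0.
  have dm : d i0 = m.
    by apply/eqP; rewrite -(eqr_int rat) -dE mxE !eqxx mulr1.
  move: ds; rewrite (bigD1 i0) //= big1 => [|i /d0->]; last by rewrite mulr0z.
  rewrite addr0 dm -mulrzr => /eqP; rewrite mulf_eq0 (negPf s0) char0_intr_eq0 //.
  by rewrite (negPf m0).
have [j fej] : exists j, f e 0 j != 0.
  by apply/existsP; rewrite -negb_forall; apply: contra fe => /forallP f0;
     apply/eqP/rowP => j; rewrite [RHS]mxE; apply/eqP.
pose qr i := f (delta_mx 0 i) 0 j.
have [q' [a a0 q'E]] := rat_poly_scale (\poly_(i < k) (if insub i is Some o then qr o else 0)).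
have qE (i : 'I_k) : qr i = a%:~R^-1 * (q'`_i)%:~R.
  have := congr1 (fun p : {poly rat} => p`_i) q'E.
  by rewrite /= coef_poly ltn_ord valK coefZ coef_map_id0.
exists (fun i => q'`_i).
  by apply: contraNneq fej => e0; rewrite -/e -/(qr i0) qE e0 mulr0.
move=> d ds; pose c : 'rV[rat]_k := \row_i (d i)%:~R.
have cU : c \in U.
  by apply/UP; exists 1, d; split=> // i; rewrite mul1r mxE.
have fc : f c = 0 by rewrite /f projv_id ?subrr.
have cE : c = \sum_i (d i)%:~R *: delta_mx 0 i.
  by rewrite [LHS]row_sum_delta; apply: eq_bigr => i _; rewrite mxE.
have : f c 0 j = \sum_i (d i)%:~R * qr i.
  rewrite /f cE linear_sum -sumrB summxE; apply: eq_bigr => i _.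
  by rewrite linearZ -scalerBr mxE.
rewrite fc mxE => /esym e0; apply/eqP.
rewrite -(intr_eq0 rat) rmorph_sum /=.
have -> : \sum_i (d i * q'`_i)%:~R = a%:~R * \sum_i (d i)%:~R * qr i.
  rewrite mulr_sumr; apply: eq_bigr => i _; rewrite qE rmorphM /=.
  by rewrite [RHS]mulrCA mulVKf ?intr_eq0.
by rewrite e0 mulr0.
Qed.

(** The version indexed by the eigenvalues themselves: [q] respects every additive
relation between elements of [s], as an additive map from the group they generate
to the integers would. *)
Lemma int_functional_seq (L : fieldType) (s : seq L) l0 :
  [pchar L] =i pred0 -> l0 \in s -> l0 != 0 ->
  exists2 q : L -> int, q l0 != 0 &
    forall t : seq (L * int), {subset unzip1 t <= s} ->
      \sum_(lc <- t) lc.1 *~ lc.2 = 0 -> \sum_(lc <- t) lc.2 * q lc.1 = 0.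
Proof.
move=> ch0 l0s l00.
pose sf (i : 'I_(size s)) := s`_i.
have ix l : l \in s -> (index l s < size s)%N by rewrite index_mem.
have [q0 q00 q0P] := @int_functional L _ sf (Ordinal (ix _ l0s)) ch0
  (eq_ind_r (fun z => z != 0) l00 (nth_index 0 l0s)).
pose q l := if insub (index l s) is Some i then q0 i else 0.
have qE l (ls : l \in s) : q l = q0 (Ordinal (ix _ ls)).
  by rewrite /q insubT ?ix // => ls'; congr q0; apply: val_inj.
exists q; first by rewrite qE.
move=> t ts t0.
pose d (i : 'I_(size s)) := \sum_(lc <- t | index lc.1 s == i) lc.2.
have dE (M : zmodType) (F : 'I_(size s) -> int -> M) (G : L -> int -> M) :
    (forall i, {morph F i : a b / a + b >-> a + b}) -> (forall i, F i 0 = 0) ->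
    (forall l (ls : l \in s) c, F (Ordinal (ix _ ls)) c = G l c) ->
    \sum_i F i (d i) = \sum_(lc <- t) G lc.1 lc.2.
  move=> FD F0 FG; under eq_bigr => i _ do rewrite /d (big_morph _ (FD i) (F0 i)).
  rewrite (exchange_big_dep xpredT) //= big_seq [RHS]big_seq.
  apply: eq_bigr => lc /(map_f fst)/ts ls; rewrite -FG.
  by rewrite (big_pred1 (Ordinal (ix _ ls))) // => i; rewrite /= eq_sym.
rewrite -(dE _ (fun i c => c * q0 i) (fun l c => c * q l)); first apply: q0P.
- rewrite (dE _ (fun i c => sf i *~ c) (fun l c => l *~ c)) => [//|i a b|//|l ls c].
    by rewrite mulrzDr.
  by rewrite /sf /= nth_index.
- by move=> i a b; rewrite mulrDl.
- by move=> i; rewrite mul0r.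
- by move=> l ls c; rewrite qE.
Qed.

Lemma crt_const (L : fieldType) (s : seq L) N (f : L -> L) :
  exists p : {poly L}, forall z, z \in s -> ('X - z%:P) ^+ N %| p - (f z)%:P.
Proof.
elim: s => [|z s [p pP]]; first by exists 0.
have [zs|zs] := boolP (z \in s).
  by exists p => y; rewrite inE => /orP[/eqP->|]; exact: pP.
pose a : {poly L} := ('X - z%:P) ^+ N; pose b : {poly L} := \prod_(y <- s) ('X - y%:P) ^+ N.
have : coprimep a b.
  rewrite coprimep_expl // /b big_seq; elim/big_rec: _ => [|y c ys cc].
    by rewrite coprimep1.
  rewrite coprimepMr cc andbT coprimep_expr // coprimep_XsubC root_XsubC.
  by apply: contraNneq zs => <-.
move=> /Bezout_eq1_coprimepP [[u v] /= uv].
exists (p + v * b * ((f z)%:P - p)) => y; rewrite inE => /predU1P[->|ys].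
  have -> : p + v * b * ((f z)%:P - p) - (f z)%:P = (p - (f z)%:P) * u * a.
    have -> : v * b = 1 - u * a by rewrite -uv addrAC subrr add0r.
    by ring.
  by rewrite dvdp_mull.
rewrite addrAC dvdp_add ?pP // mulrAC dvdp_mull // /b.
by rewrite (big_rem y ys) /= dvdp_mulr.
Qed.

(** As in the binomial formula, each of the [p + q] applications of [T3] falls on [v] or on
[w], so every term has [p] of them on [v] or [q] on [w]. *)
Lemma iter_leibniz (U V W : zmodType) (b : U -> V -> W) T1 T2 T3 p q v w :
  (forall v, b v 0 = 0) -> (forall w, b 0 w = 0) ->
  {morph T3 : x y / x + y} -> 
  (forall v w, T3 (b v w) = b (T1 v) w + b v (T2 w)) ->
  iter p T1 v = 0 -> iter q T2 w = 0 -> iter (p + q) T3 (b v w) = 0.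
Proof.
move=> b0r b0l TD TL.
have T30 : T3 0 = 0 by apply: (addrI (T3 0)); rewrite -TD !addr0.
have it0 n : iter n T3 0 = 0 by elim: n => //= n ->.
have itD n x y : iter n T3 (x + y) = iter n T3 x + iter n T3 y.
  by elim: n => //= n ->; rewrite TD.
have [k] := ubnP (p + q); elim: k p q v w => // k IHk [|p] q v w.
  by move=> _ /= -> _; rewrite b0l it0.
case: q => [|q]; first by move=> _ _ /= ->; rewrite b0r it0.
rewrite ltnS => le v0 w0; rewrite addSn iterSr TL itD.
have e1 : iter (p + q.+1) T3 (b (T1 v) w) = 0.
  by apply: IHk => //; rewrite -iterSr.
have e2 : iter (p + q.+1) T3 (b v (T2 w)) = 0.
  by rewrite -addSnnS; apply: IHk => //; rewrite -?iterSr // addSnnS.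
by rewrite e1 e2 addr0.
Qed.

(** The generalized eigenvectors of a matrix with split annihilating polynomial
span the space; it is stated as an induction principle for additive properties. *)
Lemma gen_eigen_span (L : fieldType) n k (X : 'M[L]_n) N (P : 'M[L]_(n, k) -> Prop)
    (s : seq L) w :
  P 0 -> (forall a b, P a -> P b -> P (a + b)) -> (size s <= N)%N ->
  (forall z u, z \in s -> (X - z%:M) ^+ N *m u = 0 -> P u) ->
  \prod_(z <- s) (X - z%:M) *m w = 0 -> P w.
Proof.
move=> P0 PD; case: n => [|n] in X P P0 PD w *.
  by move=> *; rewrite [w]flatmx0 -[0](flatmx0 0).
have [m] := ubnP (size s); elim: m s w => // m IHm [|z s] w.
  by move=> _ _ _; rewrite big_nil mul1mx => ->.
move=> sm sN Pz w0.
pose c := count (pred1 z) (z :: s); pose s' := [seq y <- s | y != z].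
pose a : {poly L} := ('X - z%:P) ^+ c; pose b : {poly L} := \prod_(y <- s') ('X - y%:P).
have prodE (u : seq L) : \prod_(y <- u) (X - y%:M) = horner_mx X (\prod_(y <- u) ('X - y%:P)).
  by rewrite rmorph_prod /=; apply: eq_bigr => y _; rewrite horner_mx_XsubC.
have abE : \prod_(y <- z :: s) ('X - y%:P) = a * b.
  rewrite (bigID (pred1 z)) /=; congr (_ * _).
    rewrite /a /c; elim: (z :: s) => [|y u IHu]; first by rewrite big_nil expr0.
    by rewrite big_cons /= IHu; case: eqP => [->|]; rewrite ?exprS.
  by rewrite big_cons eqxx /= /b big_filter.
have cN : (c <= N)%N by apply: leq_trans (count_size _ _) sN.
have s's : (size s' <= size s)%N by rewrite size_filter count_size.
have : coprimep a b.
  rewrite coprimep_expl // /b big_seq; elim/big_rec: _ => [|y d].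
    by rewrite coprimep1.
  rewrite mem_filter => /andP[yz _] cc.
  by rewrite coprimepMr cc andbT coprimep_XsubC root_XsubC.
move=> /Bezout_eq1_coprimepP [[u v] /= uv].
have -> : w = horner_mx X (u * a) *m w + horner_mx X (v * b) *m w.
  by rewrite -mulmxDl -rmorphD /= uv rmorph1 mul1mx.
have hx p q : horner_mx X p *m (horner_mx X q *m w) = horner_mx X (p * q) *m w.
  by rewrite mulmxA rmorphM.
apply: PD; last first.
  apply: (Pz z); first exact: mem_head.
  rewrite -horner_mx_XsubC -rmorphXn /= hx -(subnK cN) exprD -/a.
  rewrite [v * b]mulrC mulrA -[_ * a * b]mulrA -abE mulrC mulrA rmorphM /= -prodE -mulmxE -mulmxA w0.
  by rewrite mulmx0.
apply: (IHm s').
- by apply: leq_ltn_trans s's _; rewrite -ltnS.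
- by apply: leq_trans s's _; apply: leq_trans sN => /=.
- move=> y x; rewrite mem_filter => /andP[_ ys]; apply: Pz.
  by rewrite inE ys orbT.
rewrite prodE hx -/b mulrCA [b * a]mulrC -abE rmorphM /= -prodE.
by rewrite -mulmxE -mulmxA w0 mulmx0.
Qed.

(** The powers of [X - l] are invertible modulo a polynomial that does not vanish at [l]. *)
Lemma gen_eigen_notin (L : fieldType) n k (X : 'M[L]_n) M (w : 'M[L]_(n, k)) (s : seq L) l :
  l \notin s -> \prod_(z <- s) (X - z%:M) = 0 -> (X - l%:M) ^+ M *m w = 0 -> w = 0.
Proof.
case: n => [|n] in X w * => ls X0 w0; first by rewrite [w]flatmx0.
pose a : {poly L} := ('X - l%:P) ^+ M; pose b : {poly L} := \prod_(y <- s) ('X - y%:P).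
have : coprimep a b.
  rewrite coprimep_expl // /b big_seq; elim/big_rec: _ => [|y d ys cc].
    by rewrite coprimep1.
  rewrite coprimepMr cc andbT coprimep_XsubC root_XsubC.
  by apply: contraNneq ls => <-.
move=> /Bezout_eq1_coprimepP [[u v] /= uv].
have <- : horner_mx X (u * a + v * b) *m w = w by rewrite uv rmorph1 mul1mx.
rewrite rmorphD !rmorphM /= rmorphXn rmorph_prod /= horner_mx_XsubC.
under eq_bigr do rewrite horner_mx_XsubC.
by rewrite X0 mulr0 addr0 -mulmxE -mulmxA w0 mulmx0.
Qed.

Lemma iter_mulmx (L : fieldType) n k (A : 'M[L]_n) (w : 'M[L]_(n, k)) p :
  iter p (mulmx A) w = A ^+ p *m w.
Proof. by elim: p => [|p IHp]; rewrite /= ?mul1mx // IHp exprS -mulmxE mulmxA. Qed.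

Lemma Cayley_Hamilton_split (K L : fieldType) (iota : {rmorphism K -> L}) n
   (Z : 'M[K]_n) (r : {poly K}) c (s : seq L) :
  map_poly iota (char_poly Z * r) = c *: \prod_(z <- s) ('X - z%:P) -> c != 0 ->
  \prod_(z <- s) (map_mx iota Z - z%:M) = 0.
Proof.
case: n => [|n] in Z *; first by move=> _ _; rewrite [LHS]flatmx0 [RHS]flatmx0.
move=> E c0; pose Z' := map_mx iota Z.
have -> : \prod_(z <- s) (Z' - z%:M) = horner_mx Z' (\prod_(z <- s) ('X - z%:P)).
  by rewrite rmorph_prod /=; apply: eq_bigr => z _; rewrite horner_mx_XsubC.
have -> : \prod_(z <- s) ('X - z%:P) = c^-1 *: map_poly iota (char_poly Z * r).
  by rewrite E scalerA mulVf // scale1r.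
rewrite linearZ /= rmorphM /= rmorphM /= map_char_poly Cayley_Hamilton mul0r.
by rewrite scaler0.
Qed.

(** * Radicals of trace forms *)

Definition is_rep (K : fieldType) (g : lieAlgType K) m (phi : g -> 'M[K]_m) :=
  forall x y, phi (lie x y) = phi x *m phi y - phi y *m phi x.

Lemma pchar0_rmorph (K L : fieldType) (iota : {rmorphism K -> L}) :
  [pchar K] =i pred0 -> [pchar L] =i pred0.
Proof.
by move=> ch0 p; rewrite -ch0 -(fmorph_pchar iota).
Qed.

Section TraceRadical.
Variables (K : fieldType) (g : lieAlgType K) (m : nat) (phi : {linear g -> 'M[K]_m.+1}).
Hypothesis (ch0 : [pchar K] =i pred0) (phi_rep : is_rep phi).

(** Let [x] be the sum and [X] its matrix. Over a splitting field take an
additive integer-valued [q] on the eigenvalues of [X] and of [ad x] with [q l0] nonzero at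
a given nonzero eigenvalue [l0] of [X], and let [y] be the polynomial in [X]
acting as [q l] on the generalized eigenspace of [l]. Since [q] is additive,
bracketing with [y] multiplies the matrix of an [ad x]-eigenvector by a scalar, so
it preserves the span of the representation and the trace of [X y] vanishes.
Here the hypothesis enters through the expression of [x] as a sum of brackets.
But this trace is [sum k l q(l)], and applying [q] to this relation gives
[sum k q(l)^2 = 0] with positive [k]. *)
Lemma trace_radical_nilpotent I (r : seq I) (u v : I -> g) :
  (forall i y, \tr (phi (u i) *m phi y) = 0) ->
  exists N, phi (\sum_(i <- r) lie (u i) (v i)) ^+ N = 0.
Proof.
move=> u_rad; set x := \sum_(i <- r) _.
pose bs := vbasis {:g}; pose n := \dim {:g}.
pose Z0 : 'M[K]_n := \matrix_(i, j) coord bs i (lie x bs`_j).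
have p0 : char_poly (phi x) * char_poly Z0 != 0.
  by rewrite mulf_neq0 // monic_neq0 ?char_poly_monic.
have [L [iota [s sE]]] := splitting_extension p0.
have lc0 : iota (lead_coef (char_poly (phi x) * char_poly Z0)) != 0.
  by rewrite fmorph_eq0 lead_coef_eq0.
pose X := map_mx iota (phi x); pose Z := map_mx iota Z0.
have X0 : \prod_(z <- s) (X - z%:M) = 0 by apply: Cayley_Hamilton_split sE lc0.
have Z0' : \prod_(z <- s) (Z - z%:M) = 0.
  by rewrite mulrC in sE lc0; apply: Cayley_Hamilton_split sE lc0.
have ch0L := pchar0_rmorph iota ch0.
have [t [ts tp t0 tE]] := mxtrace_horner_split X0.
pose N := size s.
suff all0 : all (fun lk => lk.1 == 0) t.
  exists (size t); apply: (map_mx_inj (f := iota)).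
  rewrite rmorphXn rmorph0 /= -/X -t0.
  elim: (t) all0 => [|[l k] t' IHt] /=; first by rewrite big_nil expr0.
  by move=> /andP[/eqP-> /IHt {}IHt]; rewrite big_cons exprS IHt /= raddf0 subr0.
apply/allP => -[l0 k0] lk0 /=; apply/negPn/negP => l00.
have l0s : l0 \in s by apply: ts; apply/mapP; exists (l0, k0).
have [q q0 qP] := int_functional_seq ch0L l0s l00.
pose f (l : L) : L := (q l)%:~R.
(* The exponent [N + N] covers the eigenvectors produced by [phiL_shift]. *)
have [p pP] := crt_const s (N + N) f.
pose y := horner_mx X p.
have yE l (w : 'cV[L]_m.+1) : l \in s -> (X - l%:M) ^+ (N + N) *m w = 0 ->
    y *m w = f l *: w.
  move=> ls w0; have /dvdpP[h hE] := pP l ls.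
  have -> : y = (f l)%:M + horner_mx X (p - (f l)%:P).
    by rewrite rmorphB /= horner_mx_C addrC subrK.
  rewrite hE rmorphM rmorphXn /= horner_mx_XsubC mulmxDl -mulmxE -mulmxA w0.
  by rewrite mulmx0 addr0 mul_scalar_mx.
(* The representation after extension of scalars, on coordinate vectors. *)
pose phiL (c : 'cV[L]_n) : 'M[L]_m.+1 := \sum_(j < n) c j 0 *: map_mx iota (phi bs`_j).
have phiLD a b : phiL (a + b) = phiL a + phiL b.
  by rewrite /phiL -big_split; apply: eq_bigr => j _; rewrite mxE scalerDl.
have phiLZ k a : phiL (k *: a) = k *: phiL a.
  by rewrite /phiL scaler_sumr; apply: eq_bigr => j _; rewrite mxE scalerA.
have phiL0 : phiL 0 = 0 by rewrite -(scale0r 0) phiLZ scale0r.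
pose cv (z : g) : 'cV[K]_n := \col_i coord bs i z.
have phiLcv z : map_mx iota (phi z) = phiL (map_mx iota (cv z)).
  rewrite {1}(coord_vbasis (memvf z)) linear_sum /= map_mx_sum /=.
  by apply: eq_bigr => j _; rewrite linearZ /= map_mxZ !mxE.
have phiL_ad c : X *m phiL c - phiL c *m X = phiL (Z *m c).
  rewrite /phiL mulmx_sumr mulmx_suml -sumrB.
  under eq_bigr => j _ do rewrite -scalemxAr -scalemxAl -scalerBr -!map_mxM -map_mxB -phi_rep.
  under eq_bigr => j _ do rewrite phiLcv /phiL scaler_sumr.
  rewrite exchange_big /=; apply: eq_bigr => i _.
  rewrite !mxE scaler_suml; apply: eq_bigr => j _.
  by rewrite !mxE scalerA mulrC.
have phiL_shift (c : 'cV[L]_n) (w : 'cV[L]_m.+1) l k :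
    (Z - l%:M) ^+ N *m c = 0 -> (X - k%:M) ^+ N *m w = 0 ->
    (X - (l + k)%:M) ^+ (N + N) *m (phiL c *m w) = 0.
  rewrite -!iter_mulmx => c0 w0.
  apply: (@iter_leibniz _ _ _ (fun c w => phiL c *m w)) c0 w0 => [c'|w'|a b|c' w'].
  - by rewrite mulmx0.
  - by rewrite phiL0 mul0mx.
  - by rewrite mulmxDr.
  have XE : X *m phiL c' = phiL (Z *m c') + phiL c' *m X by rewrite -phiL_ad subrK.
  have phiLB : phiL (Z *m c' - l *: c') = phiL (Z *m c') - l *: phiL c'.
    by rewrite phiLD -scaleN1r phiLZ phiLZ scaleN1r.
  rewrite mulmxA mulmxBl XE [(Z - _) *m c']mulmxBl !mul_scalar_mx phiLB.
  rewrite [(X - _) *m w']mulmxBl mul_scalar_mx mulmxBr -scalemxAr !mulmxBl mulmxDl.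
  by rewrite -!scalemxAl scalerDl mulmxA opprD addrACA.
have radL i c : \tr (map_mx iota (phi (u i)) *m phiL c) = 0.
  rewrite mulmx_sumr linear_sum /= big1 // => j _.
  by rewrite -scalemxAr linearZ /= -map_mxM trace_map_mx u_rad rmorph0 mulr0.
have comm_tr i c : \tr (map_mx iota (phi (u i)) *m (phiL c *m y - y *m phiL c)) = 0.
  have ZC : \prod_(z <- s) (Z - z%:M) *m c = 0 by rewrite Z0' mul0mx.
  apply: (gen_eigen_span (P := fun c => \tr (map_mx iota (phi (u i)) *m (phiL c *m y - y *m phiL c)) = 0)) (leqnn N) _ ZC.
  - by rewrite phiL0 mul0mx mulmx0 subrr mulmx0 linear0.
  - move=> a b a0 b0; rewrite phiLD mulmxDl [y *m _]mulmxDr opprD addrACA mulmxDr.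
    by rewrite linearD /= a0 b0 addr0.
  move=> l {}c ls c0.
  suff [d dE] : exists d, phiL c *m y - y *m phiL c = d *: phiL c.
    by rewrite dE -scalemxAr linearZ /= radL mulr0.
  have [[[k k'] /= [ks k's lE]]|nolk] :=
      pselect (exists kk : L * L, [/\ kk.1 \in s, kk.2 \in s & l + kk.1 = kk.2]).
    exists (f k - f k').
    suff: forall w : 'cV[L]_m.+1, (phiL c *m y - y *m phiL c) *m w = ((f k - f k') *: phiL c) *m w.
      move=> e; apply/matrixP=> a b.
      by have := congr1 (fun M : 'cV[L]__ => M a 0) (e (delta_mx b 0)); rewrite -!colE !mxE.
    move=> w; have wX : \prod_(z <- s) (X - z%:M) *m w = 0 by rewrite X0 mul0mx.
    apply: (gen_eigen_span (P := fun w => (phiL c *m y - y *m phiL c) *m w = ((f k - f k') *: phiL c) *m w)) (leqnn N) _ wX.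
    - by rewrite !mulmx0.
    - by move=> a b ea eb; rewrite !mulmxDr ea eb.
    move=> h {}w hs w0.
    have w00 : (X - h%:M) ^+ (N + N) *m w = 0 by rewrite exprD -mulmxE -mulmxA w0 mulmx0.
    rewrite mulmxBl -!mulmxA (yE h) // -scalemxAr -scalemxAl.
    have cw0 := phiL_shift _ _ _ _ c0 w0.
    have [lhs|lhs] := boolP (l + h \in s); last first.
      by rewrite (gen_eigen_notin lhs X0 cw0) !(mulmx0, scaler0) subrr.
    rewrite (yE (l + h)) // -scalerBl; congr (_ *: _).
    (* The relation [h - (l + h) - k + k' = 0] between elements of [s]. *)
    have := qP [:: (h, 1); (l + h, -1); (k, -1); (k', 1)].
    rewrite !big_cons !big_nil /= !mulrN1z !mulr1z !mulN1r !mul1r !addr0 => e.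
    rewrite /f -!rmorphB /=; congr (_%:~R); apply/eqP; rewrite -subr_eq0 -e.
    - by apply/eqP; ring.
    - by move=> z; rewrite !inE => /or4P[] /eqP->.
    - by rewrite -lE; ring.
  (* No two eigenvalues of [X] differ by [l], so [phiL c] kills every eigenvector. *)
  exists 0; rewrite scale0r.
  suff -> : phiL c = 0 by rewrite mulmx0 mul0mx subr0.
  suff: forall w : 'cV[L]_m.+1, phiL c *m w = 0.
    move=> e; apply/matrixP=> a b.
    by have := congr1 (fun M : 'cV[L]__ => M a 0) (e (delta_mx b 0)); rewrite -!colE !mxE.
  move=> w; have wX : \prod_(z <- s) (X - z%:M) *m w = 0 by rewrite X0 mul0mx.
  apply: (gen_eigen_span (P := fun w => phiL c *m w = 0)) (leqnn N) _ wX.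
  - by rewrite !mulmx0.
  - by move=> a b ea eb; rewrite !mulmxDr ea eb addr0.
  move=> h {}w hs w0; apply: gen_eigen_notin X0 (phiL_shift _ _ _ _ c0 w0).
  by apply/negP => lhs; apply: nolk; exists (h, l + h).
have trXy : \tr (X *m y) = 0.
  rewrite /X /x linear_sum /= map_mx_sum mulmx_suml linear_sum /= big1 // => i _.
  rewrite phi_rep map_mxB !map_mxM mulmxBl linearB /=.
  set U := map_mx iota (phi (u i)); set V := map_mx iota (phi (v i)).
  rewrite -(mulmxA V) (mxtrace_mulC V) -!mulmxA -linearB /= -mulmxBr.
  by rewrite /V phiLcv comm_tr.
have : \tr (X *m y) = \tr (horner_mx X ('X * p)) by rewrite rmorphM /= horner_mx_X.
rewrite trXy tE.
have pE l : l \in s -> p.[l] = f l.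
  move=> ls; have /dvdpP[h hE] := pP l ls.
  have N0 : (0 < N + N)%N by rewrite addn_gt0 /N; case: (s) ls.
  apply/eqP; rewrite -subr_eq0 -[f l](hornerC _ l) -hornerN -hornerD hE hornerM horner_exp.
  by rewrite hornerXsubC subrr expr0n -[(_ == 0)%N]negbK -lt0n N0 mulr0.
have -> : \sum_(lk <- t) ('X * p).[lk.1] *+ lk.2 =
    \sum_(lc <- [seq (lk.1, q lk.1 * lk.2%:Z) | lk <- t]) lc.1 *~ lc.2.
  rewrite big_map /= big_seq [RHS]big_seq; apply: eq_bigr => lk lkt.
  rewrite hornerM hornerX pE; last by apply: ts; apply: map_f.
  by rewrite mulrzA -pmulrn /f mulrzr.
move=> /esym/qP; rewrite big_map /= => e.
have {e} : \sum_(lk <- t) q lk.1 * lk.2%:Z * q lk.1 = 0.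
  apply: e => z /mapP[_ /mapP[lk lkt ->] /= ->].
  by apply: ts; apply: map_f.
apply/eqP; rewrite psumr_neq0 => [|lk _]; last first.
  by rewrite mulrAC mulr_ge0 // -expr2 sqr_ge0.
apply/hasP; exists (l0, k0) => //=.
have k00 : (0 < k0)%N by apply: (allP tp); apply/mapP; exists (l0, k0).
by rewrite mulrAC mulr_gt0 // ?ltz_nat // lt_def sqr_ge0 mulf_neq0.
Qed.
End TraceRadical.

(** * Engel's theorem *)

(** As [x] normalizes [S], every product of elements of [S + <[x]>] can be
rewritten with its powers of [x] on the right of the elements of [S]; [m] consecutive
factors thus gain one factor from [S]. *)
Lemma engel_step (K : fieldType) (A : falgType K) (S : {vspace A}) x N m :
  (S ^+ N = 0)%VS -> x ^+ m = 0 ->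
  (forall s, s \in S -> s * x - x * s \in S) ->
  ((S + <[x]>) ^+ (m * N) = 0)%VS.
Proof.
move=> SN xm Sx; pose R k := (S ^+ k * fullv)%VS.
have RS k : R k.+1 = (S * R k)%VS by rewrite /R expvSl prodvA.
have SR k : (S * R k <= R k)%VS.
  by rewrite /R prodvA -expvSl expvSr -prodvA prodvSr ?subvf.
have xS : (<[x]> * S <= S * <[x]> + S)%VS.
  apply/prodvP => _ s /vlineP[a ->] sS.
  have -> : a *: x * s = a *: (s * x) - a *: (s * x - x * s).
    by rewrite scalerBr opprB addrC subrK scalerAl.
  rewrite memv_add ?memvN ?memvZ ?Sx //.
  by rewrite memv_mul ?memv_line.
have xR k : (<[x]> * R k <= R k)%VS.
  elim: k => [|k IHk]; first by rewrite /R expv0 prod1v subvf.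
  rewrite RS prodvA; apply: subv_trans (prodvSl _ xS) _.
  by rewrite prodvDl subv_add -prodvA !prodvSr.
have xjR j k : (<[x]> ^+ j * R k <= R k)%VS.
  elim: j => [|j IHj]; first by rewrite expv0 prod1v.
  by rewrite expvSl -prodvA; apply: subv_trans (prodvSr _ IHj) (xR k).
pose T := (S + <[x]>)%VS.
have TR j k : (T ^+ j * R k <= R k.+1 + <[x]> ^+ j * R k)%VS.
  elim: j => [|j IHj]; first by rewrite !expv0 prod1v addvSr.
  rewrite !expvSl -!prodvA; apply: subv_trans (prodvSr _ IHj) _.
  rewrite prodvDr subv_add; apply/andP; split.
    rewrite prodvDl subv_add (subv_trans (SR _)) ?addvSl //.
    by rewrite (subv_trans (xR _)) ?addvSl.
  by rewrite prodvDl addvS // RS prodvSr.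
have TmR k : (T ^+ (m * k) <= R k)%VS.
  elim: k => [|k IHk]; first by rewrite /R muln0 !expv0 prod1v subvf.
  rewrite mulnS expvD; apply: subv_trans (prodvSr _ IHk) _.
  by apply: subv_trans (TR m k) _; rewrite expv_line xm prod0v addv0.
by apply/eqP; rewrite -subv0; apply: subv_trans (TmR N) _; rewrite /R SN prod0v.
Qed.

(** A nilpotent subspace [S] of maximal dimension is all of [n]: enough commutators with
[S] of an element of [n] vanish, so if [S] were proper some [x] outside [S] would
have all its brackets with [S] inside [S], and [S + <[x]>] would be nilpotent. *)
Theorem engel (K : fieldType) (A : falgType K) (n : {vspace A}) :
  (forall a b, a \in n -> b \in n -> a * b - b * a \in n) ->
  (forall a, a \in n -> exists N, a ^+ N = 0) ->
  exists N, (n ^+ N = 0)%VS.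
Proof.
move=> nL nN.
pose Q d := `[< exists S : {vspace A}, [/\ (S <= n)%VS, \dim S = d & exists N, (S ^+ N = 0)%VS] >].
have exQ : exists d, Q d.
  exists 0%N; apply/asboolP; exists 0%VS; rewrite dimv0 sub0v; split=> //.
  by exists 1%N; rewrite expv1.
have ubQ d : Q d -> (d <= \dim {:A})%N.
  by move=> /asboolP[S [_ <- _]]; rewrite dimvS ?subvf.
case: (ex_maxnP exQ ubQ) => d /asboolP[S [Sn Sd [N SN]]] dmax.
have [nS|nS] := boolP (n <= S)%VS.
  by exists N; have/eqP -> : n == S by rewrite eqEsubv nS.
(* [D k y] says that [y] is a [k]-fold commutator of an element of [n] with elements of [S]. *)
pose fix D (k : nat) (y : A) {struct k} : Prop := if k is k'.+1
  then exists s y', [/\ s \in S, D k' y' & y = s * y' - y' * s] else y \in n.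
have Dn k y : D k y -> y \in n.
  elim: k y => [|k IHk] y //= [s [y' [sS /IHk y'n ->]]].
  by apply: nL => //; apply: subvP Sn _ _.
have SN0 i u : u \in (S ^+ i)%VS -> (N <= i)%N -> u = 0.
  by move=> ui Ni; move: ui; rewrite -(subnK Ni) expvD SN prodv0 memv0 => /eqP.
have D0 k y i j u v : D k y -> u \in (S ^+ i)%VS -> v \in (S ^+ j)%VS ->
    (N + N <= i + j + k)%N -> u * y * v = 0.
  elim: k y i j u v => [|k IHk] y i j u v.
    move=> _ ui vj; rewrite addn0 => le.
    have [Ni|Ni] := leqP N i; first by rewrite (SN0 i u) ?mul0r.
    rewrite (SN0 j v) ?mulr0 //; rewrite leqNgt; apply/negP => jN.
    by move: le; rewrite leqNgt -addSn leq_add // ltnW.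
  move=> /= [s [y' [sS Dy' ->]]] ui vj le.
  rewrite mulrBr mulrBl !mulrA.
  rewrite (IHk y' i.+1 j (u * s) v) ?expvSr ?memv_mul //; last by rewrite !addSn -addnS.
  by rewrite -!mulrA [u * _]mulrA (IHk y' i j.+1) ?subrr ?expvSl ?memv_mul //
     addnS addSn -addnS.
pose E k := `[< forall y, D k y -> y \in S >].
have exE : exists k, E k.
  exists (N + N)%N; apply/asboolP => y Dy; rewrite -[y]mul1r -[_ * _]mulr1.
  by rewrite (D0 _ _ 0%N 0%N _ _ Dy) ?mem0v ?expv0 ?memv_line.
(* The first [k] for which all [k]-fold commutators lie in [S] yields [x] one step before. *)
case: (ex_minnP exE) => -[|k] /asboolP kE kmin.
  by case/negP: nS; apply/subvP => y; apply: kE.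
have /asboolPn/existsNP[x /not_implyP[xk /negP xS]] : ~~ E k.
  by apply/negP => /kmin; rewrite ltnn.
have Sx s : s \in S -> s * x - x * s \in S by move=> sS; apply: kE; exists s, x.
have xn := Dn _ _ xk; have [m xm] := nN _ xn.
have := dmax (\dim (S + <[x]>)); rewrite leqNgt => /(_ _)/negP[].
  apply/asboolP; exists (S + <[x]>)%VS; split=> //.
    by rewrite subv_add Sn -memvE.
  by exists (m * N)%N; apply: engel_step.
rewrite -Sd ltn_neqAle dimvS ?addvSl // andbT; apply: contra xS => /eqP e.
have /eqP -> : S == (S + <[x]>)%VS by rewrite eqEdim addvSl -e leqnn.
by rewrite (subvP (addvSr _ _)) ?memv_line.
Qed.

Lemma engel_perfect (K : fieldType) (A : falgType K) (n : {vspace A}) :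
  (forall a b, a \in n -> b \in n -> a * b - b * a \in n) ->
  (forall a, a \in n -> exists N, a ^+ N = 0) ->
  (n <= n * n)%VS -> n = 0%VS.
Proof.
move=> nL nN nn; have [N n0] := engel nL nN.
have nk k : (n <= n ^+ k.+1)%VS.
  elim: k => [|k IHk]; first by rewrite expv1.
  by rewrite expvSl; apply: subv_trans nn (prodvSr _ IHk).
by apply/eqP; rewrite -subv0 (subv_trans (nk N)) // expvSr n0 prod0v.
Qed.

(** * Fitting decomposition, coordinates and dual bases *)

Lemma nilpotent_mxtrace (K : fieldType) n (X : 'M[K]_n) N : X ^+ N = 0 -> \tr X = 0.
Proof.
case: n => [|n] in X *; first by move=> _; rewrite /mxtrace big_ord0.
move=> XN; have : \prod_(z <- nseq N 0) (X - z%:M) = 0.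
  rewrite -XN; elim: (N) => [|k IHk]; first by rewrite big_nil expr0.
  by rewrite exprS /= big_cons IHk raddf0 subr0.
move=> /mxtrace_horner_split [t [ts _ _ tE]].
rewrite -[X]horner_mx_X tE big_seq big1 // => lk lkt.
have /ts : lk.1 \in unzip1 t by apply: map_f.
by rewrite mem_nseq => /andP[_ /eqP ->]; rewrite hornerX mul0rn.
Qed.

(** The trace of an idempotent is its rank, which is read off from the multiplicity of
the eigenvalue 1. *)
Lemma idempotent_mxtrace0 (K : fieldType) n (X : 'M[K]_n) : [pchar K] =i pred0 ->
  X *m X = X -> \tr X = 0 -> X = 0.
Proof.
case: n => [|n] in X *; first by move=> *; rewrite [X]flatmx0.
move=> ch0 XX trX; have : \prod_(z <- [:: 0; 1]) (X - z%:M) = 0.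
  by rewrite !big_cons big_nil raddf0 subr0 mulr1 mulrBr mulr1 -mulmxE XX subrr.
move=> /mxtrace_horner_split [t [ts tp t0 tE]].
have tall : all (fun lk => lk.1 == 0) t.
  have := trX; rewrite -[X]horner_mx_X tE => e.
  have {}e : ((\sum_(lk <- t) (if lk.1 == 0%R then 0 else lk.2))%N)%:R == 0 :> K.
    apply/eqP; rewrite -[RHS]e natr_sum big_seq [RHS]big_seq.
    apply: eq_bigr => lk lkt; rewrite hornerX.
    have /ts : lk.1 \in unzip1 t by apply: map_f.
    by rewrite !inE => /orP[] /eqP ->;
       rewrite ?eqxx ?mul0rn ?oner_eq0.
  move: e; rewrite char0_natr_eq0 // sum_nat_seq_eq0 => /allP e.
  apply/allP => lk lkt; have := e _ lkt; case: ifP => //= _ /eqP k0.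
  by have := allP tp _ (map_f snd lkt); rewrite k0.
have Xk k : X ^+ k.+1 = X.
  by elim: k => // k IHk; rewrite exprS IHk -mulmxE XX.
have : X ^+ size t = 0.
  rewrite -t0; elim: (t) tall => [|lk t' IHt] /=; first by rewrite big_nil.
  by move=> /andP[/eqP lk0 /IHt {}IHt]; rewrite big_cons exprS IHt lk0 raddf0 subr0.
case: (size t) => [/eqP|k]; first by rewrite oner_eq0.
by rewrite Xk.
Qed.

(** [T *m S] is the projection onto the part on which [T] is invertible, along the
part on which it is nilpotent. Both [S] and the projection are polynomials in [T],
whence the two invariance clauses. *)
Lemma fitting_mx (K : fieldType) n (T : 'M[K]_n) :
  exists (S : 'M[K]_n) N, [/\ forall X, comm_mx X T -> comm_mx X S,
    forall P : 'cV[K]_n -> Prop, P 0 -> (forall a u v, P u -> P v -> P (a *: u + v)) ->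
      (forall u, P u -> P (T *m u)) -> forall u, P u -> P (S *m u),
    (T *m S) *m (T *m S) = T *m S & T ^+ N *m (1%:M - T *m S) = 0].
Proof.
case: n => [|n] in T *.
  exists 0, 0%N; split=> [X _|P P0 _ _ u _||]; rewrite ?[_ *m u]flatmx0 //;
    by rewrite /comm_mx [LHS]flatmx0 // [RHS]flatmx0.
have [a [q nq qE]] := multiplicity_XsubC (char_poly T) 0.
have : coprimep ('X ^+ a.+1) q.
  rewrite coprimep_expl // coprimep_sym coprimepX.
  by apply: (implyP nq); rewrite monic_neq0 ?char_poly_monic.
move=> /Bezout_eq1_coprimepP [[u v] /= uv].
have T0 r : horner_mx T (r * (q * 'X ^+ a)) = 0.
  have -> : q * 'X ^+ a = char_poly T by rewrite qE subr0.
  by rewrite rmorphM /= Cayley_Hamilton mulr0.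
exists (horner_mx T (u * 'X^a)), a.+1.
have TSE : T *m horner_mx T (u * 'X^a) = horner_mx T (u * 'X ^+ a.+1).
  by rewrite -{1}[T]horner_mx_X mulmxE -rmorphM /=; congr horner_mx; rewrite exprS; ring.
have oneB : 1%:M - horner_mx T (u * 'X ^+ a.+1) = horner_mx T (v * q).
  by rewrite -[1%:M](rmorph1 (horner_mx T)) -rmorphB -uv addrAC subrr add0r.
split.
- by move=> X XT; apply: comm_mx_horner.
- move=> P P0 PD PT w Pw; elim/poly_ind: (u * 'X^a) => [|p c IHp].
    by rewrite rmorph0 mul0mx.
  rewrite rmorphD rmorphM /= horner_mx_X horner_mx_C mulmxDl mul_scalar_mx addrC.
  by apply: PD => //; rewrite -mulmxE (comm_horner_mx p (erefl : comm_mx T T)) -mulmxA; apply: PT.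
- rewrite TSE; set E := horner_mx T _; apply/eqP; rewrite eq_sym -subr_eq0 -{1}[E]mulmx1 -mulmxBr.
  rewrite oneB mulmxE -rmorphM /= exprS.
  have -> : u * ('X * 'X^a) * (v * q) = (u * 'X * v) * (q * 'X^a) by ring.
  by rewrite T0.
rewrite TSE oneB -{1}[T]horner_mx_X -rmorphXn mulmxE -rmorphM /= exprS.
have -> : 'X * 'X^a * (v * q) = ('X * v) * (q * 'X^a) by ring.
by rewrite T0.
Qed.

Section VectorForms.
Variables (K : fieldType) (V : vectType K).
Local Notation n := (\dim {:V}).
Local Notation bs := (vbasis {:V}).

Definition cvec (v : V) : 'cV[K]_n := \col_i coord bs i v.
Definition vecc (c : 'cV[K]_n) : V := \sum_i c i 0 *: bs`_i.
Definition mxl (T : V -> V) : 'M[K]_n := \matrix_(i, j) coord bs i (T bs`_j).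

Lemma cvecK : cancel cvec vecc.
Proof.
by move=> v; rewrite [RHS](coord_vbasis (memvf v)); apply: eq_bigr => i _; rewrite mxE.
Qed.
Lemma veccK : cancel vecc cvec.
Proof.
move=> c; apply/colP => i; rewrite mxE coord_sum_free //.
exact: basis_free (vbasisP _).
Qed.
Lemma cvec_is_linear : linear cvec.
Proof. by move=> a u v; apply/colP => i; rewrite !mxE linearP. Qed.
HB.instance Definition _ := GRing.isLinear.Build K V 'cV[K]_n *:%R cvec cvec_is_linear.
Lemma vecc_is_linear : linear vecc.
Proof. by apply: can2_linear cvecK veccK. Qed.
HB.instance Definition _ := GRing.isLinear.Build K 'cV[K]_n V *:%R vecc vecc_is_linear.

Lemma mxlE (T : V -> V) v : linear T -> mxl T *m cvec v = cvec (T v).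
Proof.
move=> Tl; pose lT : {linear V -> V} := HB.pack T (GRing.isLinear.Build _ _ _ _ T Tl).
rewrite -[RHS]/(cvec (lT v)) {2}(coord_vbasis (memvf v)) !linear_sum /=.
apply/colP => i; rewrite mxE summxE; apply: eq_bigr => j _.
by rewrite -[T _]/(lT _) !linearZ /= !mxE mulrC.
Qed.

Lemma cvec_mx_inj m (A B : 'M[K]_(m, n)) :
  (forall v, A *m cvec v = B *m cvec v) -> A = B.
Proof.
move=> AB; apply/matrixP => i j.
have := congr1 (fun M : 'cV_m => M i 0) (AB (vecc (delta_mx j 0))).
by rewrite veccK -!colE !mxE.
Qed.

(** The basis dual to [vbasis] is given by the inverse of the Gram matrix of [B]. *)
Lemma dual_basis (B : V -> V -> K) :
  (forall u, linear (B u : V -> K^o)) -> (forall u v, B u v = B v u) ->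
  (forall u, (forall v, B u v = 0) -> u = 0) ->
  exists d : 'I_n -> V,
    (forall y, y = \sum_(i < n) B y (d i) *: bs`_i) /\
    (forall y, y = \sum_(i < n) B y bs`_i *: d i).
Proof.
move=> Bl Bs Bnd.
pose lB u : {linear V -> K^o} := HB.pack (B u) (GRing.isLinear.Build _ _ _ _ (B u) (Bl u)).
have Bsum u I r (P : pred I) (c : I -> K) (F : I -> V) :
    B u (\sum_(i <- r | P i) c i *: F i) = \sum_(i <- r | P i) c i * B u (F i).
  by rewrite -[B u]/(lB u : V -> K) linear_sum; apply: eq_bigr => i _; rewrite linearZ.
pose G : 'M[K]_n := \matrix_(i, j) B bs`_i bs`_j.
have Gu : G \in unitmx.
  rewrite -row_free_unit; apply/inj_row_free => v vG.
  have : vecc v^T = 0.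
    apply: Bnd => w; rewrite Bs [w](coord_vbasis (memvf w)) Bs Bsum big1 // => j _.
    rewrite Bs /vecc Bsum; have := congr1 (fun M : 'rV_n => M 0 j) vG.
    rewrite !mxE => e; rewrite (eq_bigr (fun i => v 0 i * G i j)) ?e ?mulr0 // => i _.
    by rewrite !mxE Bs.
  move/(congr1 cvec); rewrite veccK linear0 => /(congr1 trmx).
  by rewrite trmxK trmx0.
pose d i := \sum_j invmx G i j *: bs`_j.
have dE (i j : 'I_n) : B bs`_j (d i) = (i == j)%:R.
  rewrite Bsum; have := mulVmx Gu; move/matrixP/(_ i j); rewrite !mxE => <-.
  by apply: eq_bigr => k _; rewrite !mxE Bs.
have d1 y : y = \sum_i B y (d i) *: bs`_i.
  rewrite [LHS](coord_vbasis (memvf y)); apply: eq_bigr => i _; congr (_ *: _).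
  rewrite [in RHS](coord_vbasis (memvf y)) Bs Bsum (bigD1 i) //= big1 => [|j ji].
    by rewrite Bs dE eqxx mulr1 addr0.
  by rewrite Bs dE eq_sym (negPf ji) mulr0.
exists d; split=> // y; apply/eqP; rewrite -subr_eq0; apply/eqP; apply: Bnd => v.
rewrite [v](coord_vbasis (memvf v)) Bsum big1 // => j _.
have BB u a b : B u (a - b) = B u a - B u b := raddfB (lB u) a b.
rewrite Bs BB Bsum.
rewrite (bigD1 j) //= big1 => [|i ij]; last by rewrite dE (negPf ij) mulr0.
by rewrite dE eqxx mulr1 addr0 Bs subrr mulr0.
Qed.
End VectorForms.

(** * The Killing form of a semisimple Lie algebra *)

Section Killing.
Variables (K : fieldType) (g : lieAlgType K).
Hypothesis (ch0 : [pchar K] =i pred0).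

Lemma lie_suml I (r : seq I) (P : pred I) (F : I -> g) y :
  lie (\sum_(i <- r | P i) F i) y = \sum_(i <- r | P i) lie (F i) y.
Proof. exact: (big_morph (fun x => lie x y) (lieDl y) (lie0l y)). Qed.
Lemma lie_sumr I (r : seq I) (P : pred I) (F : I -> g) y :
  lie y (\sum_(i <- r | P i) F i) = \sum_(i <- r | P i) lie y (F i).
Proof. exact: (big_morph (lie y) (lieDr y) (lie0r y)). Qed.

Lemma lie_leibniz (x y z : g) : lie x (lie y z) = lie (lie x y) z + lie y (lie x z).
Proof.
have /eqP := lie_jacobi x y z; rewrite -addrA addr_eq0 => /eqP ->.
by rewrite opprD -(lieC (lie x y)) -lieNr -(lieC x z) addrC.
Qed.

Lemma lievP (U V : {vspace g}) x : x \in liev U V ->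
  exists (r : seq (g * g)), {in r, forall uv, uv.1 \in U /\ uv.2 \in V} /\
    x = \sum_(uv <- r) lie uv.1 uv.2.
Proof.
rewrite /liev; set X := [seq _ | _ <- _, _ <- _] => xX.
have xE := coord_span (xX : x \in <<in_tuple X>>%VS).
have : forall i : 'I_(size X), exists uv : g * g, [/\ uv.1 \in U, uv.2 \in V & X`_i = lie uv.1 uv.2].
  move=> i; have /allpairsP[[u v] /= [uU vV ->]] : X`_i \in X by apply: mem_nth.
  by exists (u, v); split=> //; apply: vbasis_mem.
move=> /choice[F FP].
exists [seq (coord (in_tuple X) i x *: (F i).1, (F i).2) | i <- index_enum 'I_(size X)]; split.
  by move=> _ /mapP[i _ ->] /=; have [? ? _] := FP i; rewrite memvZ.
by rewrite big_map [LHS]xE; apply: eq_bigr => i _; have [_ _ ->] := FP i; rewrite lieZl.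
Qed.

Lemma mem_liev (U V : {vspace g}) u v : u \in U -> v \in V -> lie u v \in liev U V.
Proof.
move=> uU vV; rewrite (coord_vbasis uU) (coord_vbasis vV) lie_suml memv_suml // => i _.
rewrite lie_sumr memv_suml // => j _; rewrite lieZl lieZr !memvZ // memv_span //.
by apply/allpairsP; exists ((vbasis U)`_i, (vbasis V)`_j);
   split=> //=; apply: mem_nth; rewrite size_tuple.
Qed.

Lemma liev_sub (U V W : {vspace g}) :
  (forall u v, u \in U -> v \in V -> lie u v \in W) -> (liev U V <= W)%VS.
Proof.
move=> UVW; apply/subvP => x /lievP[r [rP ->]]; rewrite big_seq memv_suml // => uv /rP[].
exact: UVW.
Qed.

Lemma rep_trace_radical m (phi : {linear g -> 'M[K]_m}) (U : {vspace g}) x :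
  is_rep phi -> (forall u y, u \in U -> \tr (phi u *m phi y) = 0) ->
  x \in liev U fullv -> exists N, phi x ^+ N = 0.
Proof.
case: m phi => [|m] phi rep_phi U0; first by exists 0%N; rewrite [LHS]flatmx0 [RHS]flatmx0.
move=> /lievP[r [rP ->]].
pose u i := (nth (0, 0) r i).1; pose v i := (nth (0, 0) r i).2.
have [|N] := @trace_radical_nilpotent _ _ _ phi ch0 rep_phi _ (index_iota 0 (size r)) u v.
  move=> i y; apply: U0; rewrite /u; have [lt|le] := ltnP i (size r).
    by have [] := rP _ (mem_nth (0, 0) lt).
  by rewrite nth_default // mem0v.
by rewrite /u /v -(big_nth (0, 0) xpredT (fun uv => lie uv.1 uv.2)) => ?; exists N.
Qed.

(** By Engel's theorem the image is nilpotent, and a perfect nilpotent algebra is zero. *)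
Lemma rep_perfect_nilpotent m (phi : {linear g -> 'M[K]_m}) (P : {vspace g}) :
  is_rep phi -> subalgebra P -> (P <= liev P P)%VS ->
  (forall x, x \in P -> exists N, phi x ^+ N = 0) -> forall x, x \in P -> phi x = 0.
Proof.
case: m phi => [|m] phi rep_phi Psub Pperf Pnil x xP.
  by rewrite [LHS]flatmx0 [RHS]flatmx0.
pose f : 'Hom(g, 'M[K]_m.+1) := linfun phi.
have fE y : f y = phi y by rewrite lfunE.
suff n0 : (f @: P = 0)%VS.
  by apply/eqP; rewrite -memv0 -n0 -fE memv_img.
apply: engel_perfect.
- move=> _ _ /memv_imgP[a aP ->] /memv_imgP[b bP ->].
  by rewrite !fE -[_ * _ - _](rep_phi a b) -fE memv_img // Psub.
- by move=> _ /memv_imgP[a aP ->]; rewrite fE; apply: Pnil.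
apply/subvP => _ /memv_imgP[a aP ->]; have /lievP[r [rP ->]] := subvP Pperf _ aP.
rewrite fE linear_sum big_seq memv_suml // => uv /rP[uP vP].
by rewrite rep_phi -!fE rpredB // memv_mul // memv_img.
Qed.

Definition adm (x : g) : 'M[K]_(\dim {:g}) := mxl (lie x).
Lemma adm_is_linear : linear adm.
Proof.
by move=> a x y; apply/matrixP=> i j; rewrite !mxE lieDl lieZl linearP.
Qed.
HB.instance Definition _ := GRing.isLinear.Build K g 'M[K]_(\dim {:g}) *:%R adm adm_is_linear.

Lemma admE x y : adm x *m cvec y = cvec (lie x y).
Proof. by rewrite mxlE //; apply: lie_is_linearr. Qed.

Lemma adm_rep : is_rep adm.
Proof.
move=> x y; apply: cvec_mx_inj => z.
by rewrite mulmxBl -!mulmxA !admE -linearB lie_leibniz addrK.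
Qed.

Definition killing (x y : g) : K := \tr (adm x *m adm y).

Lemma killingC x y : killing x y = killing y x.
Proof. exact: mxtrace_mulC. Qed.

Lemma killing_linear x : linear (killing x : g -> K^o).
Proof. by move=> a y z; rewrite /killing linearP mulmxDr -scalemxAr linearP. Qed.

Lemma trace_form_inv m (phi : g -> 'M[K]_m) x y z : is_rep phi ->
  \tr (phi (lie x y) *m phi z) = \tr (phi x *m phi (lie y z)).
Proof.
move=> rep_phi; rewrite !rep_phi mulmxBl mulmxBr !linearB /=; congr (_ - _).
  by rewrite mulmxA.
by rewrite -mulmxA mxtrace_mulC -mulmxA.
Qed.

Lemma killing_inv x y z : killing (lie x y) z = killing x (lie y z).
Proof. exact: trace_form_inv adm_rep. Qed.

Hypothesis ss : semisimple g.

(** The radical [I] is an ideal. Its derived series stabilizes at a perfect ideal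
whose elements act nilpotently in the adjoint representation, hence act as zero;
so [I] is solvable. *)
Lemma killing_nondeg x : (forall y, killing x y = 0) -> x = 0.
Proof.
have [I IP] : exists I : {vspace g}, forall x, x \in I <-> (forall y, killing x y = 0).
  apply: vspace_of_pred => [y|a u v u0 v0 y].
    by rewrite /killing linear0 mul0mx linear0.
  by rewrite killingC killing_linear 2!(killingC y) u0 v0 scaler0 addr0.
suff I0 : I = 0%VS by move=> /IP; rewrite I0 memv0 => /eqP.
have Iid : ideal I.
  move=> z u /IP u0; apply/IP => y; rewrite lieC /killing linearN mulNmx linearN /=.
  by rewrite -/(killing _ _) killing_inv u0 oppr0.
apply: ss => //.
pose D n := iter n (fun W => liev W W) I.
have Did n : ideal (D n).
  elim: n => [//|n IHn] z u /= /lievP[r [rP ->]].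
  rewrite lie_sumr big_seq memv_suml // => uv /rP[uD vD].
  by rewrite lie_leibniz memvD // mem_liev // IHn.
have Dsub n : (D n.+1 <= D n)%VS by apply: liev_sub => u v _ vD; apply: Did.
have DI n : (D n <= I)%VS.
  by elim: n => [|n IHn]; [exact: subvv | exact: subv_trans (Dsub n) IHn].
have [n Dn] : exists n, D n.+1 = D n.
  apply: contrapT => /forallNP noD.
  have dimD n : (\dim (D n) + n <= \dim I)%N.
    elim: n => [|n IHn]; first by rewrite addn0.
    apply: leq_trans IHn; rewrite addnS ltn_add2r ltn_neqAle dimvS // andbT.
    by apply/negP => /eqP e; apply: (noD n); apply/eqP; rewrite eqEdim Dsub e leqnn.
  by have := dimD (\dim I).+1; rewrite addnS ltnNge leq_addl.
have {}Dn : liev (D n) (D n) = D n := Dn.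
exists n; rewrite -/(D n); apply/eqP; rewrite -subv0 -Dn; apply: liev_sub => u v uD vD.
have P0 := @rep_perfect_nilpotent _ adm (D n) adm_rep.
rewrite memv0; apply/eqP; apply: (can_inj (@cvecK _ _)).
rewrite -admE P0 ?mul0mx ?linear0 //.
- by move=> a b _ bD; apply: Did.
- by rewrite Dn.
move=> z zD; apply: (rep_trace_radical (U := I) adm_rep) => [w y /IP/(_ y)|]; first by [].
have := zD; rewrite -{1}Dn => /lievP[r [rP ->]].
rewrite big_seq memv_suml // => ab /rP[aD bD].
by rewrite mem_liev ?memvf // (subvP (DI n)).
Qed.

Lemma ss_centerless (z : g) : (forall y, lie z y = 0) -> z = 0.
Proof.
move=> z0; apply: killing_nondeg => y; rewrite /killing.
have -> : adm z = 0 by apply: cvec_mx_inj => v; rewrite admE z0 linear0 mul0mx.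
by rewrite mul0mx linear0.
Qed.

Lemma vspace_separate (V : vectType K) (U : {vspace V}) : U != fullv ->
  exists2 xi : V -> K, linear (xi : V -> K^o) &
    (forall u, u \in U -> xi u = 0) /\ exists v, xi v != 0.
Proof.
rewrite eqEsubv subvf /= => /subvPn[v _ vU].
have : v - projv U v != 0.
  by rewrite subr_eq0; apply: contra vU => /eqP ->; apply: memv_proj.
set w := v - _ => w0.
have [j wj] : exists j, coord (vbasis {:V}) j w != 0.
  apply/existsP; rewrite -negb_forall; apply: contra w0 => /forallP w0.
  by apply/eqP/vect_coordP => j; rewrite (eqP (w0 j)) linear0.
exists (fun v => coord (vbasis {:V}) j (v - projv U v)).
  by move=> a x y; rewrite [projv U _]linearP opprD addrACA -scalerBr linearP.
split; last by exists v.
by move=> u uU; rewrite projv_id // subrr linear0.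
Qed.

(** A functional vanishing on the derived algebra is the Killing product with some [z];
by invariance [lie z a] is in the radical for every [a], so [z] is central. *)
Lemma ss_perfect : liev (fullv : {vspace g}) fullv = fullv.
Proof.
apply: contrapT => /eqP/vspace_separate[xi xil [xi0 [v]]].
have [d [_ dE]] := dual_basis killing_linear killingC killing_nondeg.
have xisum (I : Type) (r : seq I) (P : pred I) (c : I -> K) (F : I -> g) :
    xi (\sum_(i <- r | P i) c i *: F i) = \sum_(i <- r | P i) c i * xi (F i).
  pose lxi : {linear g -> K^o} := HB.pack xi (GRing.isLinear.Build _ _ _ _ xi xil).
  by rewrite -[LHS]/(lxi _) linear_sum; apply: eq_bigr => i _; rewrite linearZ.
pose z := \sum_i xi (d i) *: (vbasis {:g})`_i.
have kz y : killing z y = xi y.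
  rewrite [in RHS](dE y) xisum killingC /z.
  have := killing_linear y; move: (killing y) => k kl.
  pose lk : {linear g -> K^o} := HB.pack k (GRing.isLinear.Build _ _ _ _ k kl).
  rewrite -[LHS]/(lk _) linear_sum; apply: eq_bigr => i _.
  by rewrite linearZ /= [RHS]mulrC.
have z0 : z = 0.
  apply: ss_centerless => a; apply: killing_nondeg => b.
  by rewrite killing_inv kz xi0 // mem_liev ?memvf.
by rewrite -kz z0 /killing linear0 mul0mx linear0 eqxx.
Qed.
End Killing.

(** * Whitehead's first lemma *)

Lemma linear_sumZ (K : fieldType) (V W : lmodType K) (f : V -> W) : linear f ->
  forall I (r : seq I) (P : pred I) (c : I -> K) (F : I -> V),
  f (\sum_(i <- r | P i) c i *: F i) = \sum_(i <- r | P i) c i *: f (F i).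
Proof.
move=> fl I r P c F; pose l : {linear V -> W} := HB.pack f (GRing.isLinear.Build _ _ _ _ f fl).
by rewrite -[LHS]/(l _) linear_sum; apply: eq_bigr => i _; rewrite linearZ.
Qed.

Section Whitehead.
Variables (K : fieldType) (g : lieAlgType K).
Hypothesis (ch0 : [pchar K] =i pred0) (ss : semisimple g).
Local Notation n := (\dim {:g}).
Local Notation bs := (vbasis {:g}).

Lemma killingNr (x y : g) : killing x (- y) = - killing x y.
Proof. by rewrite /killing linearN mulmxN linearN. Qed.
Lemma killingNl (x y : g) : killing (- x) y = - killing x y.
Proof. by rewrite killingC killingNr killingC. Qed.
Lemma killingBl (x y z : g) : killing (x - y) z = killing x z - killing y z.
Proof. by rewrite /killing linearB mulmxBl linearB. Qed.

(** Invariance of the Casimir element, in the form of a pairing with an arbitrary bilinear map. *)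
Lemma casimir_inv (M : lmodType K) (F : g -> g -> M) (d : 'I_n -> g) :
  (forall v, linear (F^~ v)) -> (forall u, linear (F u)) ->
  (forall y, y = \sum_(i < n) killing y (d i) *: bs`_i) ->
  (forall y, y = \sum_(i < n) killing y bs`_i *: d i) ->
  forall x, \sum_(i < n) (F (lie x bs`_i) (d i) + F bs`_i (lie x (d i))) = 0.
Proof.
move=> Fl Fr d1 d2 x; rewrite big_split /=.
under eq_bigr => i _ do rewrite (d1 (lie x bs`_i)) (linear_sumZ (Fl _)).
under [X in _ + X]eq_bigr => i _ do rewrite (d2 (lie x (d i))) (linear_sumZ (Fr _)).
rewrite exchange_big /= -big_split /= big1 // => j _.
rewrite -big_split /= big1 // => i _; rewrite -scalerDl.
by rewrite (lieC x bs`_i) killingNl killing_inv (killingC bs`_i) addNr scale0r.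
Qed.

(** Cocycles with values in the range of an idempotent [e] commuting with the
representation are treated by induction on the rank of [e]. If the trace form
[beta] of [phi e] vanishes then [phi e = 0] by Engel's theorem, and the cocycle vanishes on
brackets, hence everywhere. Otherwise let [B] be the operator with
[beta x y = killing (B x) y]; a generalized inverse [s] of [B] commutes with [ad],
and the trace of the Casimir operator [C = sum phi (s e_i) phi (e^i) e] is the rank of the
invertible part of [B], so [C] is not nilpotent. On the range of the Fitting
projection [P] of [C] the identity [phi x m0 = C (f x)], where
[m0 = sum phi (s e_i) f (e^i)], exhibits [f] as a coboundary; the idempotent
[e (1 - P)] has smaller rank. *)
Lemma whitehead_mx m (phi : {linear g -> 'M[K]_m}) : is_rep phi ->
  forall (e : 'M[K]_m) (f : {linear g -> 'cV[K]_m}),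
  e *m e = e -> (forall x, comm_mx e (phi x)) -> (forall x, e *m f x = f x) ->
  (forall x y, f (lie x y) = phi x *m f y - phi y *m f x) ->
  exists w, forall x, f x = phi x *m w.
Proof.
move=> rep_phi e; have [k] := ubnP (\rank e); elim: k e => // k IHk e rk f ee ec ef fc.
have [d [d1 d2]] := dual_basis (@killing_linear _ g) (@killingC _ g) (killing_nondeg ch0 ss).
pose phie x := phi x *m e.
have phiel : linear phie by move=> a x y; rewrite /phie linearP mulmxDl -scalemxAl.
pose lphie : {linear g -> 'M[K]_m} := HB.pack phie (GRing.isLinear.Build _ _ _ _ phie phiel).
have rep_e : is_rep lphie.
  move=> x y; rewrite /= /phie rep_phi mulmxBl -!mulmxA.
  by rewrite !(mulmxA e) !ec -!mulmxA ee !mulmxA.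
pose beta (x y : g) : K := \tr (phie x *m phie y).
have betal x : linear (beta x : g -> K^o).
  by move=> a y z; rewrite /beta phiel mulmxDr -scalemxAr linearP.
have betaC x y : beta x y = beta y x by exact: mxtrace_mulC.
have betaN x y : beta (- x) y = - beta x y.
  by rewrite /beta /phie linearN !mulNmx linearN.
have betaI x y z : beta (lie x y) z = beta x (lie y z) := trace_form_inv x y z rep_e.
have [b0|/existsNP[y0 /existsNP[z0 /eqP bn0]]] := pselect (forall y z, beta y z = 0).
  exists 0 => x; rewrite mulmx0.
  have pe0 y : phie y = 0.
    apply: (rep_perfect_nilpotent (P := fullv) rep_e) (memvf y) => [a b _ _||a _].
    - exact: memvf.
    - by rewrite ss_perfect.
    - by apply: (rep_trace_radical ch0 (U := fullv) rep_e) => [u z _|];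
      [exact: b0 | by rewrite ss_perfect ?memvf].
  have p0 y z : phi y *m f z = 0 by rewrite -ef mulmxA -/(phie y) pe0 mul0mx.
  have := memvf x; rewrite -ss_perfect // => /lievP[r [_ ->]].
  by rewrite linear_sum big1 // => uv _; rewrite /= fc !p0 subr0.
(* The operator representing [beta] with respect to the Killing form. *)
pose B y := \sum_(i < n) beta y bs`_i *: d i.
have Bl : linear B.
  move=> a x y; rewrite /B scaler_sumr -big_split /=; apply: eq_bigr => i _.
  by rewrite betaC betal 2!(betaC bs`_i) scalerDl scalerA.
have BE y z : killing (B y) z = beta y z.
  rewrite killingC /B (linear_sumZ (killing_linear z)) [in RHS](d1 z) (linear_sumZ (betal y)).
  by apply: eq_bigr => i _; rewrite [LHS]mulrC.
have Bad x y : B (lie x y) = lie x (B y).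
  apply/eqP; rewrite -subr_eq0; apply/eqP/(killing_nondeg ch0 ss) => z.
  rewrite killingBl BE (lieC x (B y)) killingNl killing_inv BE opprK (lieC x).
  by rewrite betaN betaI addNr.
have Badl x y : B (lie x y) = lie (B x) y.
  rewrite (lieC x) (lieC (B x)) -Bad /B -sumrN.
  by apply: eq_bigr => i _; rewrite betaN scaleNr.
pose T := mxl B.
have TE y : T *m cvec y = cvec (B y) by rewrite mxlE.
have Tad x : comm_mx (adm x) T.
  by apply: cvec_mx_inj => v; rewrite -!mulmxA TE !admE TE Bad.
have [S0 [N [S0c _ S0i S0n]]] := fitting_mx T.
pose s y := vecc (S0 *m cvec y).
have sE y : cvec (s y) = S0 *m cvec y by rewrite veccK.
have sl : linear s by move=> a x y; rewrite /s linearP mulmxDr -scalemxAr linearP.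
have sad x y : s (lie x y) = lie x (s y).
  apply: (can_inj (@cvecK _ _)); rewrite sE -!admE sE !mulmxA.
  by rewrite (S0c _ (Tad x)).
(* If [T] were nilpotent, [B y0] would be in the radical of the Killing form. *)
have TS0 : T *m S0 != 0.
  apply: contra_neq bn0 => TS0; rewrite TS0 subr0 mulmx1 in S0n.
  rewrite -BE; have -> : B y0 = 0.
    apply: (killing_nondeg ch0 ss) => z; rewrite /killing.
    have -> : adm (B y0) = T *m adm y0.
      by apply: cvec_mx_inj => v; rewrite -mulmxA !admE TE Badl.
    rewrite -mulmxA; apply: (@nilpotent_mxtrace _ _ _ N).
    have c1 : comm_mx T (adm y0 *m adm z).
      by rewrite /comm_mx mulmxA -Tad -!mulmxA Tad.
    by rewrite (exprMn_comm _ c1) S0n mul0r.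
  by rewrite /killing linear0 mul0mx linear0.
have trTS : \tr (T *m S0) != 0.
  by apply: contra_neq TS0 => /idempotent_mxtrace0; apply.
pose C' := \sum_(i < n) phi (s bs`_i) *m phi (d i).
pose C := C' *m e.
have C'c x : comm_mx (phi x) C'.
  rewrite /comm_mx /C' mulmx_sumr mulmx_suml; apply/eqP; rewrite -subr_eq0 -sumrB.
  rewrite -[X in _ == X](casimir_inv (F := fun a b => phi (s a) *m phi b) _ _ d1 d2 x).
  - apply/eqP/eq_bigr => i _; rewrite sad !rep_phi mulmxBl mulmxBr !mulmxA.
    by rewrite addrA subrK.
  - by move=> v a b c; rewrite sl linearP mulmxDl -scalemxAl.
  - by move=> v a b c; rewrite linearP mulmxDr -scalemxAr.
have ec' : comm_mx e C'.
  rewrite /comm_mx /C' mulmx_sumr mulmx_suml; apply: eq_bigr => i _.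
  by rewrite mulmxA ec -!mulmxA ec.
have Cc x : comm_mx (phi x) C by rewrite /comm_mx /C mulmxA C'c -!mulmxA ec.
have eC : comm_mx e C by rewrite /comm_mx /C mulmxA ec' -!mulmxA.
have CeC : e *m C = C by rewrite eC /C -mulmxA ee.
have trC : \tr C = \tr (T *m S0).
  rewrite /C /C' mulmx_suml linear_sum /= /mxtrace [RHS](eq_bigr (fun i : 'I_n => beta (s bs`_i) (d i))).
    apply: eq_bigr => i _; rewrite /beta /phie -!mulmxA (mulmxA e) ec -!mulmxA ee.
    by rewrite !mulmxA.
  move=> i _.
  have -> : (T *m S0) i i = cvec (B (s bs`_i)) i 0.
    rewrite -TE sE mulmxA.
    have -> : cvec bs`_i = delta_mx i 0.
      apply/colP => j; rewrite !mxE coord_free ?(basis_free (vbasisP _)) //.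
      by rewrite andbT eq_sym.
    by rewrite -colE [RHS]mxE.
  rewrite -BE /cvec mxE [X in coord _ _ X]d1 coord_sum_free //.
  exact: basis_free (vbasisP _).
have [S [M [Sc _ Si Sn]]] := fitting_mx C.
pose P := C *m S.
have CS : C *m S = S *m C by apply: Sc.
have P0 : P != 0.
  apply: contra_neq trTS => P0; rewrite -trC; apply: (@nilpotent_mxtrace _ _ _ M).
  by rewrite -/P P0 subr0 mulmx1 in Sn.
have eP : e *m P = P by rewrite /P mulmxA CeC.
have Pe : P *m e = P.
  by rewrite /P -mulmxA -(Sc _ eC) mulmxA -eC CeC.
have Pc x : comm_mx (phi x) P.
  by rewrite /comm_mx /P mulmxA Cc -!mulmxA (Sc _ (Cc x)).
pose m0 := \sum_(i < n) phi (s bs`_i) *m f (d i).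
have m0E x : phi x *m m0 = C *m f x.
  rewrite /C -mulmxA ef /m0 /C' mulmx_sumr mulmx_suml; apply/eqP; rewrite -subr_eq0 -sumrB.
  rewrite -[X in _ == X](casimir_inv (F := fun a b => phi (s a) *m f b) _ _ d1 d2 x).
  - apply/eqP/eq_bigr => i _; rewrite sad rep_phi fc mulmxBl mulmxBr !mulmxA.
    by rewrite addrA subrK.
  - by move=> v a b c; rewrite sl linearP mulmxDl -scalemxAl.
  - by move=> v a b c; rewrite linearP mulmxDr -scalemxAr.
have PfE x : P *m f x = phi x *m (S *m m0).
  by rewrite mulmxA (Sc _ (Cc x)) -mulmxA m0E mulmxA -CS.
pose e' := e *m (1%:M - P).
have e'E : e' = (1%:M - P) *m e by rewrite /e' mulmxBr mulmxBl mulmx1 mul1mx eP Pe.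
have e'E2 : e' = e - P by rewrite /e' mulmxBr mulmx1 eP.
(* What remains of the cocycle on the complement of the range of [P]. *)
pose f' x := f x - P *m f x.
have f'l : linear f'.
  move=> a x y; rewrite /f' linearP mulmxDr -scalemxAr scalerBr opprD.
  by rewrite addrACA.
pose lf' : {linear g -> 'cV[K]_m} := HB.pack f' (GRing.isLinear.Build _ _ _ _ f' f'l).
have Pi : P *m P = P := Si.
have e'P : e' *m P = 0 by rewrite /e' -mulmxA mulmxBl mul1mx Pi subrr mulmx0.
have [|||||w' w'E] := IHk e' _ lf'.
- rewrite ltnNge; apply: contra P0 => rk'.
  have e'e : (e' <= e)%MS by rewrite e'E submxMl.
  have /submxP[X eX] : (e <= e')%MS.
    by rewrite -(mxrank_leqif_sup e'e) eqn_leq mxrankS // (leq_trans _ rk').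
  by rewrite -eP eX -mulmxA e'P mulmx0.
- have e'e : e' *m e = e' by rewrite e'E -mulmxA ee.
  by rewrite {2}/e' mulmxA e'e mulmxBr mulmx1 e'P subr0.
- by move=> x; rewrite /comm_mx e'E2 mulmxBl mulmxBr ec Pc.
- move=> x; rewrite /= /f' e'E2 mulmxBl !mulmxBr ef (mulmxA e) eP (mulmxA P) Pi.
  by rewrite subrr subr0.
- move=> x y; rewrite /= /f' fc !mulmxBr (mulmxA P) -Pc (mulmxA P) -Pc -!mulmxA.
  by rewrite !opprD addrACA.
exists (S *m m0 + w') => x.
by rewrite mulmxDr -PfE -w'E /= /f' addrC subrK.
Qed.
End Whitehead.

Local Notation tlift := Defs.lift.

Theorem whitehead (K : fieldType) (g : lieAlgType K) (V : vectType K)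
    (act : g -> V -> V) (f : g -> V) :
  [pchar K] =i pred0 -> semisimple g ->
  (forall v, linear (act^~ v)) -> (forall x, linear (act x)) ->
  (forall x y v, act (lie x y) v = act x (act y v) - act y (act x v)) ->
  linear f -> (forall x y, f (lie x y) = act x (f y) - act y (f x)) ->
  exists w, forall x, f x = act x w.
Proof.
move=> ch0 ss actl actr actL fl fc.
pose phi x := mxl (act x).
have phil : linear phi.
  by move=> a x y; apply/matrixP=> i j; rewrite !mxE actl linearP.
pose lphi : {linear g -> 'M[K]__} := HB.pack phi (GRing.isLinear.Build _ _ _ _ phi phil).
have phiE x v : phi x *m cvec v = cvec (act x v) by rewrite mxlE.
pose F x := cvec (f x).
have Fl : linear F by move=> a x y; rewrite /F fl linearP.
pose lF : {linear g -> 'cV[K]__} := HB.pack F (GRing.isLinear.Build _ _ _ _ F Fl).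
have [|||||w wE] := @whitehead_mx K g ch0 ss _ lphi _ 1%:M lF.
- by move=> x y; apply: cvec_mx_inj => v; rewrite mulmxBl -!mulmxA !phiE actL linearB.
- by rewrite mulmx1.
- by move=> x; rewrite /comm_mx mulmx1 mul1mx.
- by move=> x; rewrite mul1mx.
- by move=> x y; rewrite /= /F !phiE fc linearB.
exists (vecc w) => x; apply: (can_inj (@cvecK _ _)).
by rewrite -phiE veccK -wE.
Qed.

(** * Tensors of order two and three *)

Section TensorTheory.
Variable K : fieldType.

Section Lift.
Variables (U V : vectType K).

Lemma lift_is_linear (W : lmodType K) (f : U -> V -> W) : linear (tlift f).
Proof.
move=> a A B; rewrite /Defs.lift scaler_sumr -big_split; apply: eq_bigr => i _.
rewrite scaler_sumr -big_split; apply: eq_bigr => j _.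
by rewrite !mxE scalerDl scalerA.
Qed.
HB.instance Definition _ (W : lmodType K) (f : U -> V -> W) :=
  GRing.isLinear.Build K (tens U V) W *:%R (tlift f) (lift_is_linear f).

Lemma eq_lift (W : lmodType K) (f h : U -> V -> W) A :
  (forall u v, f u v = h u v) -> tlift f A = tlift h A.
Proof.
by move=> fh; apply: eq_bigr => i _; apply: eq_bigr => j _; rewrite fh.
Qed.

Lemma lift_comp (W W' : lmodType K) (F : W -> W') (f : U -> V -> W) A :
  linear F -> F (tlift f A) = tlift (fun u v => F (f u v)) A.
Proof.
move=> Fl; pose l : {linear W -> W'} := HB.pack F (GRing.isLinear.Build _ _ _ _ F Fl).
rewrite -[LHS]/(l _) linear_sum; apply: eq_bigr => i _.
by rewrite linear_sum; apply: eq_bigr => j _; rewrite linearZ.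
Qed.

Lemma tensor_linearl (v : V) : linear (fun u : U => tensor u v).
Proof.
by move=> a x y; apply/matrixP => i j; rewrite !mxE linearP /= mulrDl mulrA.
Qed.
Lemma tensor_linearr (u : U) : linear (fun v : V => tensor u v).
Proof.
by move=> a x y; apply/matrixP => i j; rewrite !mxE linearP /= mulrDr mulrCA.
Qed.
HB.instance Definition _ (u : U) :=
  GRing.isLinear.Build K V (tens U V) *:%R (tensor u) (tensor_linearr u).

Lemma tensorDl u u' (v : V) : tensor (u + u' : U) v = tensor u v + tensor u' v.
Proof. by have := tensor_linearl v 1 u u'; rewrite !scale1r. Qed.
Lemma tensor0l (v : V) : tensor (0 : U) v = 0.
Proof. by apply: (addrI (tensor 0 v)); rewrite -tensorDl !addr0. Qed.
Lemma tensorZl a (u : U) (v : V) : tensor (a *: u) v = a *: tensor u v.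
Proof. by have := tensor_linearl v a u 0; rewrite tensor0l !addr0. Qed.
Lemma tensorNl (u : U) (v : V) : tensor (- u) v = - tensor u v.
Proof. by rewrite -scaleN1r tensorZl scaleN1r. Qed.
Lemma tensorBl u u' (v : V) : tensor (u - u' : U) v = tensor u v - tensor u' v.
Proof. by rewrite tensorDl tensorNl. Qed.
Definition tensorDr (u : U) (v v' : V) : tensor u (v + v') = tensor u v + tensor u v'
  := linearD (tensor u) v v'.
Definition tensor0r (u : U) : tensor u (0 : V) = 0 := linear0 (tensor u).
Lemma tensorZr a (u : U) (v : V) : tensor u (a *: v) = a *: tensor u v.
Proof. exact: linearZ. Qed.
Lemma tensorNr (u : U) (v : V) : tensor u (- v) = - tensor u v.
Proof. exact: linearN. Qed.
Lemma tensorBr (u : U) (v v' : V) : tensor u (v - v') = tensor u v - tensor u v'.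
Proof. exact: linearB. Qed.

Lemma tens_ind (P : tens U V -> Prop) :
  P 0 -> (forall a A B, P A -> P B -> P (a *: A + B)) ->
  (forall u v, P (tensor u v)) -> forall A, P A.
Proof.
move=> P0 PD Pt A.
have PD' A' B : P A' -> P B -> P (A' + B) by rewrite -{2}[A']scale1r; apply: PD.
pose f1 : tens U V -> tens U V := tlift (@tensor K U V).
have -> : A = f1 A.
  apply: (tens_ext (f1 := GRing.Linear.clone _ _ _ _ idfun _) (f2 := GRing.Linear.clone _ _ _ _ f1 _)) => u v /=.
  by rewrite /f1 lift_tensor //; [exact: tensor_linearl | exact: tensor_linearr].
rewrite /f1 /Defs.lift; apply: (big_ind P) => // i _.
by apply: (big_ind P) => // j _; rewrite -[X in P X]addr0; apply: PD.
Qed.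

Lemma tens_lin_ext (W : lmodType K) (f1 f2 : tens U V -> W) :
  linear f1 -> linear f2 ->
  (forall u v, f1 (tensor u v) = f2 (tensor u v)) -> forall A, f1 A = f2 A.
Proof.
move=> l1 l2 e A.
pose L1 : {linear tens U V -> W} := HB.pack f1 (GRing.isLinear.Build _ _ _ _ f1 l1).
pose L2 : {linear tens U V -> W} := HB.pack f2 (GRing.isLinear.Build _ _ _ _ f2 l2).
exact: (@tens_ext _ _ _ _ L1 L2).
Qed.
End Lift.

Section Maps.
Variables (U U' V V' : vectType K).

Lemma tmap_is_linear (f : U -> U') (h : V -> V') : linear (tmap f h).
Proof. exact: lift_is_linear. Qed.
HB.instance Definition _ (f : U -> U') (h : V -> V') :=
  GRing.isLinear.Build K (tens U V) (tens U' V') *:%R (tmap f h) (tmap_is_linear f h).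

Lemma tmapE (f : U -> U') (h : V -> V') u v : linear f -> linear h ->
  tmap f h (tensor u v) = tensor (f u) (h v).
Proof.
move=> fl hl; rewrite /tmap lift_tensor // => w a x y.
  by rewrite fl tensor_linearl.
by rewrite hl tensor_linearr.
Qed.

Lemma tswap_is_linear : linear (@tswap K U V).
Proof. exact: lift_is_linear. Qed.
HB.instance Definition _ :=
  GRing.isLinear.Build K (tens U V) (tens V U) *:%R (@tswap K U V) tswap_is_linear.

Lemma tswapE (u : U) (v : V) : tswap (tensor u v) = tensor v u.
Proof.
by rewrite /tswap lift_tensor // => w a x y; rewrite (tensor_linearl, tensor_linearr).
Qed.

End Maps.

Lemma tswapK (U V : vectType K) (A : tens U V) : tswap (tswap A) = A.
Proof.
move: A; apply: tens_ind => [|a A B IHA IHB|u v]; first by rewrite !linear0.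
  by rewrite !linearP /= IHA IHB.
by rewrite !tswapE.
Qed.

Lemma tswap_mx (U : vectType K) (A : tens U U) i j : (tswap A : 'M_(_, _)) i j = (A : 'M_(_, _)) j i.
Proof.
move: A; apply: tens_ind => [|a A B IHA IHB|u v].
- by rewrite linear0 !mxE.
- by rewrite linearP /= !mxE IHA IHB.
by rewrite tswapE !mxE mulrC.
Qed.

Section Triple.
Variable U : vectType K.

Lemma lift3_is_linear (W : lmodType K) (f : U -> U -> U -> W) : linear (lift3 f).
Proof. exact: lift_is_linear. Qed.
HB.instance Definition _ (W : lmodType K) (f : U -> U -> U -> W) :=
  GRing.isLinear.Build K (tens3 U) W *:%R (lift3 f) (lift3_is_linear f).

Lemma lift3E (W : lmodType K) (f : U -> U -> U -> W) u v w :
  (forall v w, linear (fun u => f u v w)) -> (forall u w, linear (fun v => f u v w)) ->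
  (forall u v, linear (f u v)) ->
  lift3 f (tensor3 u v w) = f u v w.
Proof.
move=> f1 f2 f3; rewrite /lift3 /tensor3 lift_tensor.
- by rewrite lift_tensor.
- by move=> w'; apply: lift_is_linear.
move=> A a x y; rewrite /Defs.lift scaler_sumr -big_split; apply: eq_bigr => i _.
rewrite scaler_sumr -big_split; apply: eq_bigr => j _.
by rewrite f3 scalerDr /= !scalerA mulrC.
Qed.

Lemma tensor3_lin1 (v w : U) : linear (fun u => tensor3 u v w).
Proof. by move=> a x y; rewrite /tensor3 !tensor_linearl. Qed.
Lemma tensor3_lin2 (u w : U) : linear (fun v => tensor3 u v w).
Proof. by move=> a x y; rewrite /tensor3 tensor_linearr tensor_linearl. Qed.
Lemma tensor3_lin3 (u v : U) : linear (tensor3 u v).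
Proof. exact: tensor_linearr. Qed.

Lemma tens3_lin_ext (W : lmodType K) (f1 f2 : tens3 U -> W) :
  linear f1 -> linear f2 ->
  (forall u v w, f1 (tensor3 u v w) = f2 (tensor3 u v w)) -> forall A, f1 A = f2 A.
Proof.
move=> l1 l2 e; apply: tens_lin_ext => // A w; move: A.
apply: tens_lin_ext => [a x y|a x y|u v]; last exact: e.
  by rewrite tensor_linearl l1.
by rewrite tensor_linearl l2.
Qed.

Lemma tcycle_is_linear : linear (@tcycle K U).
Proof. exact: lift3_is_linear. Qed.
HB.instance Definition _ :=
  GRing.isLinear.Build K (tens3 U) (tens3 U) *:%R (@tcycle K U) tcycle_is_linear.
Lemma tswap12_is_linear : linear (@tswap12 K U).
Proof. exact: lift3_is_linear. Qed.
HB.instance Definition _ :=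
  GRing.isLinear.Build K (tens3 U) (tens3 U) *:%R (@tswap12 K U) tswap12_is_linear.
Lemma tswap23_is_linear : linear (@tswap23 K U).
Proof. exact: lift3_is_linear. Qed.
HB.instance Definition _ :=
  GRing.isLinear.Build K (tens3 U) (tens3 U) *:%R (@tswap23 K U) tswap23_is_linear.

Lemma tcycleE (u v w : U) : tcycle (tensor3 u v w) = tensor3 v w u.
Proof.
rewrite /tcycle lift3E // => ? ?;
  by [exact: tensor3_lin1 | exact: tensor3_lin2 | exact: tensor3_lin3].
Qed.
Lemma tswap12E (u v w : U) : tswap12 (tensor3 u v w) = tensor3 v u w.
Proof.
rewrite /tswap12 lift3E // => ? ?;
  by [exact: tensor3_lin1 | exact: tensor3_lin2 | exact: tensor3_lin3].
Qed.
Lemma tswap23E (u v w : U) : tswap23 (tensor3 u v w) = tensor3 u w v.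
Proof.
rewrite /tswap23 lift3E // => ? ?;
  by [exact: tensor3_lin1 | exact: tensor3_lin2 | exact: tensor3_lin3].
Qed.
End Triple.
End TensorTheory.

(** * The classical Yang-Baxter element and the co-Jacobi identity *)

(** Replaces the maximal subterms of [e] that are not sums, opposites or multiples by
variables, so that the unification performed by rewriting never unfolds tensors. *)
Ltac abstract_atoms e :=
  lazymatch e with
  | (?a + ?b)%R => abstract_atoms a; abstract_atoms b
  | (- ?a)%R => abstract_atoms a
  | (?k *: ?a)%R => abstract_atoms a
  | 0%R => idtac
  | _ => first [ is_var e
               | match goal with x := ?b |- _ => constr_eq e b; change e with x end
               | match goal with x := ?b |- _ => unify e b; change e with x end
               | let x := fresh "v" in pose (x := e); change e with x ]
  end.

(** Decides identities of modules by reading them coordinatewise in the base field. *)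
Ltac modring :=
  repeat match goal with x := _ |- _ => clearbody x end;
  with_strategy opaque [tensor tmap tswap tcycle ad2 ad3 lie]
    (match goal with |- (?a = ?b) => abstract_atoms a; abstract_atoms b end);
  repeat match goal with x := _ |- _ => clearbody x end;
  apply: vect_coordP => ?; rewrite !(linearD, linearN, linearZ, linear0) /=; ring.

Section LieTensor.
Variables (K : fieldType) (g : lieAlgType K).
Implicit Types (x y z : g) (r : tens g g).

Lemma ad2_is_linear x : linear (ad2 x). Proof. exact: lift_is_linear. Qed.
HB.instance Definition _ x :=
  GRing.isLinear.Build K (tens g g) (tens g g) *:%R (ad2 x) (ad2_is_linear x).
Lemma ad3_is_linear x : linear (ad3 x). Proof. exact: lift3_is_linear. Qed.
HB.instance Definition _ x :=
  GRing.isLinear.Build K (tens3 g) (tens3 g) *:%R (ad3 x) (ad3_is_linear x).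

Lemma ad2E x u v : ad2 x (tensor u v) = tensor (lie x u) v + tensor u (lie x v).
Proof.
rewrite /ad2 lift_tensor // => w a b c.
  by rewrite lie_is_linearr !tensor_linearl scalerDr addrACA.
by rewrite lie_is_linearr !tensor_linearr scalerDr addrACA.
Qed.

Lemma ad3E x u v w : ad3 x (tensor3 u v w) =
  tensor3 (lie x u) v w + tensor3 u (lie x v) w + tensor3 u v (lie x w).
Proof.
rewrite /ad3 lift3E // => p q a b c; rewrite !lie_is_linearr.
- by rewrite !tensor3_lin1; modring.
- by rewrite !tensor3_lin2; modring.
- by rewrite !tensor3_lin3; modring.
Qed.

Lemma ad2_linearl (A : tens g g) : linear (fun x : g => ad2 x A).
Proof.
move=> a x y; move: A; apply: tens_lin_ext => [k A B|k A B|u v].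
- exact: linearP.
- by rewrite !linearP /=; modring.
by rewrite !ad2E !lie_is_linearl tensor_linearl tensor_linearr scalerDr addrACA.
Qed.

Lemma ad2_lie x y (A : tens g g) : ad2 (lie x y) A = ad2 x (ad2 y A) - ad2 y (ad2 x A).
Proof.
move: A; apply: tens_lin_ext => [k A B|k A B|u v].
- exact: linearP.
- by rewrite !linearP /=; modring.
have jac z : lie (lie x y) z = lie x (lie y z) - lie y (lie x z).
  by rewrite (lie_leibniz x y z) addrK.
rewrite !ad2E !linearD /= !ad2E !jac tensorBl tensorBr.
by modring.
Qed.

Lemma tswap_ad2 x (A : tens g g) : tswap (ad2 x A) = ad2 x (tswap A).
Proof.
move: A; apply: tens_lin_ext => [k A B|k A B|u v].
- by rewrite !linearP.
- by rewrite !linearP.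
by rewrite ad2E linearD /= !tswapE ad2E addrC.
Qed.

(** Value on [r (x) r] of the linear map that [f] induces on fourth tensor powers;
Yang-Baxter and co-Jacobi expressions are of this form, and identities between
them follow from permutations of the four arguments. *)
Definition quad (W : lmodType K) r (f : g -> g -> g -> g -> W) : W :=
  tlift (fun a b => tlift (f a b) r) r.

Lemma lift_swap (W : lmodType K) r (f : g -> g -> W) :
  Lambda2 r -> tlift (fun u v => f v u) r = - tlift f r.
Proof.
move=> rL; rewrite /Defs.lift exchange_big /= -sumrN; apply: eq_bigr => i _.
rewrite -sumrN; apply: eq_bigr => j _.
by rewrite -[(r : 'M_(_, _)) j i]tswap_mx rL mxE scaleNr.
Qed.

Lemma quad_swapr (W : lmodType K) r (f : g -> g -> g -> g -> W) :
  Lambda2 r -> quad r (fun a b c d => f a b d c) = - quad r f.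
Proof.
move=> rL; rewrite /quad (eq_lift (h := fun a b => - tlift (f a b) r)).
  rewrite -(lift_comp (F := -%R)) // => a u v.
  by rewrite opprD scalerN.
by move=> a b; exact: lift_swap.
Qed.

Lemma quad_swapl (W : lmodType K) r (f : g -> g -> g -> g -> W) :
  Lambda2 r -> quad r (fun a b c d => f b a c d) = - quad r f.
Proof. by move=> rL; rewrite /quad -lift_swap. Qed.

Lemma lift_pair (U V : vectType K) (W : lmodType K) (f : U -> V -> W) (A : tens U V) :
  tlift f A = \sum_(p : 'I_(\dim {:U}) * 'I_(\dim {:V}))
    (A : 'M_(_, _)) p.1 p.2 *: f (vbasis {:U})`_p.1 (vbasis {:V})`_p.2.
Proof. by rewrite /Defs.lift pair_bigA. Qed.

Lemma quad_exch (W : lmodType K) r (f : g -> g -> g -> g -> W) :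
  quad r (fun a b c d => f c d a b) = quad r f.
Proof.
rewrite /quad !lift_pair.
under eq_bigr do rewrite lift_pair scaler_sumr.
under [RHS]eq_bigr do rewrite lift_pair scaler_sumr.
rewrite exchange_big /=; apply: eq_bigr => p _; apply: eq_bigr => q _.
by rewrite !scalerA mulrC.
Qed.

Lemma liftD (U V : vectType K) (W : lmodType K) (f h : U -> V -> W) (A : tens U V) :
  tlift (fun u v => f u v + h u v) A = tlift f A + tlift h A.
Proof.
rewrite /Defs.lift -big_split; apply: eq_bigr => i _.
by rewrite -big_split; apply: eq_bigr => j _ /=; rewrite -scalerDr.
Qed.

Lemma quadD (W : lmodType K) r (f h : g -> g -> g -> g -> W) :
  quad r (fun a b c d => f a b c d + h a b c d) = quad r f + quad r h.
Proof.
rewrite /quad /Defs.lift -big_split; apply: eq_bigr => i _.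
rewrite -big_split; apply: eq_bigr => j _ /=; rewrite -scalerDr; congr (_ *: _).
rewrite -big_split; apply: eq_bigr => k _.
by rewrite -big_split; apply: eq_bigr => l _ /=; rewrite -scalerDr.
Qed.

Lemma eq_quad (W : lmodType K) r (f h : g -> g -> g -> g -> W) :
  (forall a b c d, f a b c d = h a b c d) -> quad r f = quad r h.
Proof. by move=> fh; apply: eq_lift => a b; apply: eq_lift. Qed.

Lemma quad_comp (W W' : lmodType K) (F : W -> W') r (f : g -> g -> g -> g -> W) :
  linear F -> F (quad r f) = quad r (fun a b c d => F (f a b c d)).
Proof.
by move=> Fl; rewrite /quad lift_comp //; apply: eq_lift => a b; rewrite lift_comp.
Qed.

Lemma quadN (W : lmodType K) r (f : g -> g -> g -> g -> W) :
  quad r (fun a b c d => - f a b c d) = - quad r f.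
Proof. by rewrite [RHS](quad_comp (F := -%R)) // => a u v; rewrite opprD scalerN. Qed.

Lemma tensor3N1 (u v w : g) : tensor3 (- u) v w = - tensor3 u v w.
Proof. by rewrite /tensor3 !tensorNl. Qed.
Lemma tensor3D1 (u u' v w : g) : tensor3 (u + u') v w = tensor3 u v w + tensor3 u' v w.
Proof. by rewrite /tensor3 !tensorDl. Qed.
Lemma tensor3N2 (u v w : g) : tensor3 u (- v) w = - tensor3 u v w.
Proof. by rewrite /tensor3 tensorNr tensorNl. Qed.

Lemma tensor3N3 (u v w : g) : tensor3 u v (- w) = - tensor3 u v w.
Proof. by rewrite /tensor3 tensorNr. Qed.

(** One of the three summands of [CYB], up to a permutation of the legs; for
antisymmetric [r] the two others are its cyclic rotations. *)
Definition cycQ r : tens3 g := quad r (fun a b c d => tensor3 (lie a c) b d).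

Lemma tcycle_quad r (f1 f2 f3 : g -> g -> g -> g -> g) :
  tcycle (quad r (fun a b c d => tensor3 (f1 a b c d) (f2 a b c d) (f3 a b c d)))
  = quad r (fun a b c d => tensor3 (f2 a b c d) (f3 a b c d) (f1 a b c d)).
Proof.
by rewrite (quad_comp _ _ (@tcycle_is_linear _ _)); apply: eq_quad => *; rewrite tcycleE.
Qed.

Lemma tcycleK (A : tens3 g) : tcycle (tcycle (tcycle A)) = A.
Proof.
move: A; apply: tens3_lin_ext => [a u v|//|u v w].
  by rewrite !linearP.
by rewrite !tcycleE.
Qed.

(** The two copies of [r] play the same role, and exchanging them reverses the
bracket. *)
Lemma quad_flip r (F : g -> g -> g -> tens3 g) :
  (forall u v w, F (- u) v w = - F u v w) ->
  quad r (fun a b c d => F (lie a c) d b) = - quad r (fun a b c d => F (lie a c) b d).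
Proof.
move=> FN; rewrite -quad_exch -quadN; apply: eq_quad => a b c d.
by rewrite (lieC c) FN.
Qed.

Lemma CYB_cycQ r : Lambda2 r ->
  CYB r = cycQ r + tcycle (cycQ r) + tcycle (tcycle (cycQ r)).
Proof.
move=> rL; rewrite /cycQ !tcycle_quad.
have -> : CYB r = quad r (fun a b c d =>
    tensor3 (lie a c) b d + tensor3 a (lie b c) d + tensor3 a c (lie b d)) by [].
rewrite !quadD [RHS]addrAC; congr (_ + _ + _).
  rewrite (quad_swapl (fun a b c d => tensor3 b (lie a c) d)) //.
  by rewrite -(quad_flip _ (F := fun u v w => tensor3 v u w)) // => *; rewrite tensor3N2.
rewrite (quad_swapl (fun a b c d => tensor3 b c (lie a d))) //.
by rewrite (quad_swapr (fun a b c d => tensor3 b d (lie a c))) // opprK.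
Qed.

Lemma Lambda3_CYB r : Lambda2 r -> Lambda3 (CYB r).
Proof.
move=> rL; rewrite CYB_cycQ // /cycQ !tcycle_quad.
have sw12 f1 f2 f3 : tswap12 (quad r (fun a b c d => tensor3 (f1 a b c d) (f2 a b c d) (f3 a b c d)))
  = quad r (fun a b c d => tensor3 (f2 a b c d) (f1 a b c d) (f3 a b c d)).
  by rewrite (quad_comp _ _ (@tswap12_is_linear _ _)); apply: eq_quad => *; rewrite tswap12E.
have sw23 f1 f2 f3 : tswap23 (quad r (fun a b c d => tensor3 (f1 a b c d) (f2 a b c d) (f3 a b c d)))
  = quad r (fun a b c d => tensor3 (f1 a b c d) (f3 a b c d) (f2 a b c d)).
  by rewrite (quad_comp _ _ (@tswap23_is_linear _ _)); apply: eq_quad => *; rewrite tswap23E.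
have e1 : quad r (fun a b c d => tensor3 (lie a c) d b) = - quad r (fun a b c d => tensor3 (lie a c) b d).
  exact: (quad_flip r (F := fun u v w => tensor3 u v w) (fun u v w => tensor3N1 u v w)).
have e2 : quad r (fun a b c d => tensor3 d (lie a c) b) = - quad r (fun a b c d => tensor3 b (lie a c) d).
  exact: (quad_flip r (F := fun u v w => tensor3 v u w) (fun u v w => tensor3N2 v u w)).
have e3 : quad r (fun a b c d => tensor3 d b (lie a c)) = - quad r (fun a b c d => tensor3 b d (lie a c)).
  exact: (quad_flip r (F := fun u v w => tensor3 v w u) (fun u v w => tensor3N3 v w u)).
by rewrite /Lambda3 !linearD /= !sw12 !sw23 e1 e2 e3; split; modring.
Qed.

Lemma ad3_tcycle x (A : tens3 g) : ad3 x (tcycle A) = tcycle (ad3 x A).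
Proof.
move: A; apply: tens3_lin_ext => [a u v|a u v|u v w].
- by rewrite !linearP.
- by rewrite !linearP.
by rewrite tcycleE !ad3E !linearD /= !tcycleE; modring.
Qed.

Definition cyc3 (A : tens3 g) := A + tcycle A + tcycle (tcycle A).

Lemma cyc3_tcycle A : cyc3 (tcycle A) = cyc3 A.
Proof. by rewrite /cyc3 tcycleK; modring. Qed.
Lemma cyc3_is_linear : linear cyc3.
Proof. by move=> a u v; rewrite /cyc3 !linearP /=; modring. Qed.
HB.instance Definition _ :=
  GRing.isLinear.Build K (tens3 g) (tens3 g) *:%R cyc3 cyc3_is_linear.

Lemma ad3_CYB r x : Lambda2 r -> ad3 x (CYB r) = cyc3 (ad3 x (cycQ r)).
Proof. by move=> rL; rewrite CYB_cycQ // !linearD /= !ad3_tcycle. Qed.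

(** Both sides are cyclic sums of terms quadratic in [r]. By the Leibniz rule
[ad3 x] of the summand [cycQ r] has four terms, and the antisymmetry of [r] and the
exchange of its two copies match them with the four terms of the left-hand side
up to cyclic rotation. *)
Lemma co_jacobi_CYB r x : Lambda2 r ->
  cyc3 (tmap (fun y => ad2 y r) id (ad2 x r)) = - ad3 x (CYB r).
Proof.
move=> rL; rewrite ad3_CYB //.
have sE : tmap (fun y => ad2 y r) id (ad2 x r) = quad r (fun a b c d =>
  tensor3 (lie (lie x a) c) d b + tensor3 c (lie (lie x a) d) b
  + tensor3 (lie a c) d (lie x b) + tensor3 c (lie a d) (lie x b)).
  rewrite {2}/ad2 (lift_comp _ _ (@tmap_is_linear _ _ _ _ _ _ _)).
  apply: eq_lift => a b; rewrite linearD /= !tmapE; try exact: ad2_linearl; try by [].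
  rewrite /ad2 (lift_comp _ _ (tensor_linearl b)) (lift_comp _ _ (tensor_linearl (lie x b))).
  by rewrite -liftD; apply: eq_lift => c d; rewrite !tensorDl addrA.
rewrite sE !quadD.
set s1 := quad r _; set s2 := quad r _; set s3 := quad r _; set s4 := quad r _.
have -> : s1 = - quad r (fun a b c d => tensor3 (lie a (lie x c)) b d).
  rewrite /s1 -quad_exch -quadN; apply: eq_quad => a b c d.
  by rewrite (lieC (lie x c)) tensor3N1.
have -> : s3 = - quad r (fun a b c d => tensor3 (lie a c) b (lie x d)).
  rewrite /s3 -quad_exch -quadN; apply: eq_quad => a b c d.
  by rewrite (lieC c) tensor3N1.
have -> : s2 = - quad r (fun a b c d => tensor3 d (lie (lie x a) c) b).
  by rewrite /s2 (quad_swapr (fun a b c d => tensor3 d (lie (lie x a) c) b)).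
have -> : s4 = - quad r (fun a b c d => tensor3 d (lie a c) (lie x b)).
  by rewrite /s4 (quad_swapr (fun a b c d => tensor3 d (lie a c) (lie x b))).
rewrite -!opprD linearN /=; congr (- _).
rewrite /cycQ (quad_comp _ _ (@ad3_is_linear x)).
have -> : quad r (fun a b c d => ad3 x (tensor3 (lie a c) b d)) = quad r (fun a b c d =>
    tensor3 (lie (lie x a) c) b d + tensor3 (lie a (lie x c)) b d + tensor3 (lie a c) (lie x b) d
    + tensor3 (lie a c) b (lie x d)).
  by apply: eq_quad => a b c d; rewrite ad3E lie_leibniz tensor3D1.
rewrite !quadD !linearD /=.
rewrite -(cyc3_tcycle (quad r (fun a b c d => tensor3 d (lie (lie x a) c) b))).
rewrite -(cyc3_tcycle (quad r (fun a b c d => tensor3 d (lie a c) (lie x b)))).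
rewrite !tcycle_quad; modring.
Qed.
End LieTensor.

(** * Invariant bivectors *)

Lemma eq_tmap (K : fieldType) (U U' V V' : vectType K) (f f' : U -> U') (h h' : V -> V') A :
  f =1 f' -> h =1 h' -> tmap f h A = tmap f' h' A.
Proof. by move=> ff hh; apply: eq_lift => u v; rewrite ff hh. Qed.

Lemma tmap_ad2 (K : fieldType) (g h : lieAlgType K) (f : g -> h) z (A : tens g g) :
  linear f -> (forall x y, f (lie x y) = lie (f x) (f y)) ->
  tmap f f (ad2 z A) = ad2 (f z) (tmap f f A).
Proof.
move=> fl fL; move: A; apply: tens_lin_ext => [a u v|a u v|u v].
- by rewrite !linearP.
- by rewrite !linearP.
by rewrite ad2E linearD /= !tmapE // ad2E !fL.
Qed.

Lemma char0_two (K : fieldType) : [pchar K] =i pred0 -> (2%:R : K) != 0.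
Proof. by move=> ch0; rewrite char0_natr_eq0. Qed.

HB.instance Definition _ (K : fieldType) (g : lieAlgType K) (x : g) :=
  GRing.isLinear.Build K g g *:%R (lie x) (lie_is_linearr x).

Lemma killingZl (K : fieldType) (g : lieAlgType K) c (x y : g) :
  killing (c *: x) y = c * killing x y.
Proof. by rewrite /killing linearZ -scalemxAl linearZ. Qed.

Lemma cyc3D (K : fieldType) (g : lieAlgType K) (A B : tens3 g) : cyc3 (A + B) = cyc3 A + cyc3 B.
Proof. exact: linearD. Qed.
Lemma cyc3N (K : fieldType) (g : lieAlgType K) (A : tens3 g) : cyc3 (- A) = - cyc3 A.
Proof. exact: linearN. Qed.

Section CoboundaryFacts.
Variables (K : fieldType) (g : lieAlgType K).
Hypothesis ch0 : [pchar K] =i pred0.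

Lemma Lambda2_ad2 (r : tens g g) x : Lambda2 r -> Lambda2 (ad2 x r).
Proof. by move=> rL; rewrite /Lambda2 tswap_ad2 rL linearN. Qed.

(** The symmetric part of [R] is invariant because the cobracket takes values in
antisymmetric tensors. *)
Lemma antisymmetrize (U : lieAlgType K) (d : U -> tens U U) (R : tens U U) :
  (forall x, Lambda2 (d x)) -> (forall x, d x = ad2 x R) ->
  exists r, Lambda2 r /\ forall x, d x = ad2 x r.
Proof.
move=> dL dR; exists (2%:R^-1 *: (R - tswap R)); split.
  by rewrite /Lambda2 linearZ /= linearB /= tswapK -scalerN opprB.
move=> x; rewrite linearZ linearB /= -tswap_ad2 -dR dL opprK.
by rewrite -mulr2n -scaler_nat scalerA mulVf ?scale1r // char0_two.
Qed.

Hypothesis ss : semisimple g.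

(** Contraction with the Killing form turns [A] into an operator [s] commuting with
[ad]. Such an operator is self-adjoint, since [adm (s x) = s (adm x)] and [s] can be moved
under the trace, while the antisymmetry of [A] makes it skew. *)
Lemma ss_invariant2 (A : tens g g) :
  Lambda2 A -> (forall x, ad2 x A = 0) -> A = 0.
Proof.
move=> AL A0.
pose s y : g := tlift (fun u v => killing u y *: v) A.
have kl y : linear (fun u : g => killing u y : K^o).
  by move=> a u v; rewrite killingC killing_linear 2!(killingC y).
have tl y v : linear (fun u : g => killing u y *: (v : g)).
  by move=> a u u'; rewrite kl scalerDl scalerA.
have tr y u : linear (fun v : g => killing u y *: v).
  by move=> a v v'; rewrite scalerDr !scalerA mulrC.
have sl : linear s.
  move=> a y z; rewrite /s [a *: tlift _ _](lift_comp (F := *:%R a)) => [|k u v].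
    rewrite -liftD; apply: eq_lift => u v.
    by rewrite killing_linear scalerDl scalerA.
  by rewrite scalerDr !scalerA mulrC.
have sL x y : s (lie x y) = lie x (s y).
  apply/eqP; rewrite eq_sym -subr_eq0.
  rewrite -[X in _ == X](linear0 (tlift (fun u v => killing u y *: v))) -(A0 x).
  apply/eqP; rewrite /s; move: (A); apply: tens_lin_ext => [a B C|a B C|u v].
  - by rewrite !linearP /=; modring.
  - by rewrite !linearP.
  rewrite ad2E linearD /= !lift_tensor // linearZ /=.
  by rewrite -killing_inv (lieC u x) killingNl scaleNr opprK addrC.
have sA y z : killing (s y) z = killing y (s z).
  pose S := mxl s.
  have Sv v : S *m cvec v = cvec (s v) by apply: mxlE.
  have sNl y' : s (- y') = - s y'.
    by have := linear_sumZ sl [:: tt] xpredT (fun=> -1) (fun=> y'); rewrite !big_seq1 !scaleN1r.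
  have SE x : adm (s x) = S *m adm x.
    apply: cvec_mx_inj => v; rewrite -mulmxA !admE Sv; congr cvec.
    by rewrite lieC -sL [in RHS]lieC sNl.
  have Sc x : S *m adm x = adm x *m S.
    by apply: cvec_mx_inj => v; rewrite -!mulmxA admE !Sv admE sL.
  by rewrite /killing !SE Sc mulmxA.
have sN y z : killing (s y) z = - killing y (s z).
  have -> : killing (s y) z = tlift (fun u v => killing u y * killing v z : K^o) A.
    by rewrite /s (lift_comp _ _ (kl z)); apply: (@eq_lift _ _ _ K^o) => u v; rewrite killingZl.
  have -> : killing y (s z) = tlift (fun u v => killing v y * killing u z : K^o) A.
    rewrite /s killingC (lift_comp _ _ (kl y)).
    by apply: (@eq_lift _ _ _ K^o) => u v; rewrite killingZl mulrC.
  exact: (@lift_swap K g K^o A (fun u v => killing v y * killing u z) AL).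
have s0 y : s y = 0.
  apply: (killing_nondeg ch0 ss) => z; apply/eqP.
  by rewrite -(mulrI_eq0 _ (lregP (char0_two ch0))) mulr_natl mulr2n {1}sN sA addNr.
have [d [d1 d2]] := dual_basis (@killing_linear _ g) (@killingC _ g) (killing_nondeg ch0 ss).
(* [A] is recovered from its contractions with a basis. *)
have -> : A = \sum_(i < \dim {:g}) tensor (d i) (tlift (fun u v => killing u (vbasis {:g})`_i *: v) A).
  move: (A); apply: tens_lin_ext => [//|a B C|u v].
    by rewrite scaler_sumr -big_split; apply: eq_bigr => i _; rewrite !linearP.
  rewrite {1}(d2 u) (linear_sumZ (tensor_linearl v)); apply: eq_bigr => i _.
  by rewrite lift_tensor // tensorZr.
by rewrite big1 // => i _; rewrite -/(s _) s0 tensor0r.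
Qed.
End CoboundaryFacts.

(** * The extension by a one-dimensional centre *)

Section Extension.
Variables (K : fieldType) (g : lieAlgType K).
Local Notation L := (g * K^o)%type.
Local Notation t := (tvec g).

Lemma incl_is_linear : linear (@incl K g).
Proof. by move=> a x y; rewrite /incl; congr pair; rewrite /= scaler0 addr0. Qed.
HB.instance Definition _ := GRing.isLinear.Build K g L *:%R (@incl K g) incl_is_linear.

Lemma incl_lie (x y : g) : incl (lie x y) = lie (incl x) (incl y).
Proof. by []. Qed.

Definition prg (z : L) : g := z.1.
Lemma prg_is_linear : linear prg. Proof. by []. Qed.
HB.instance Definition _ := GRing.isLinear.Build K L g *:%R prg prg_is_linear.

Lemma tvecL (z : L) : lie t z = 0.
Proof. by rewrite /lie /= /prod_lie /= lie0l. Qed.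
Lemma tvecR (z : L) : lie z t = 0.
Proof. by rewrite lieC tvecL oppr0. Qed.

Lemma decompL (z : L) : z = incl z.1 + (z.2 : K) *: (t : L).
Proof.
case: z => x c; rewrite /incl /tvec; congr pair; rewrite /=.
  by rewrite scaler0 addr0.
by rewrite add0r [RHS]mulr1.
Qed.

Lemma ad2_tvec (A : tens L L) : ad2 t A = 0.
Proof.
move: A; apply: tens_lin_ext => [a u v|a u v|u v].
- by rewrite linearP.
- by rewrite scaler0 addr0.
by rewrite ad2E !tvecL tensor0l tensor0r addr0.
Qed.

Lemma ad2_decomp (z : L) (A : tens L L) : ad2 z A = ad2 (incl z.1) A.
Proof.
rewrite {1}(decompL z) addrC ad2_linearl.
by rewrite ad2_tvec scaler0 add0r.
Qed.

(** The component of a tensor along [g (x) t], with [t] dropped. *)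
Definition compt (A : tens L L) : g := tlift (fun u v : L => (v.2 : K) *: u.1) A.
Lemma compt_is_linear : linear compt. Proof. exact: lift_is_linear. Qed.
HB.instance Definition _ := GRing.isLinear.Build K (tens L L) g *:%R compt compt_is_linear.
Lemma comptE (u v : L) : compt (tensor u v) = (v.2 : K) *: u.1.
Proof.
rewrite /compt lift_tensor // => w a x y /=.
  by rewrite scalerDr !scalerA mulrC.
by rewrite scalerDl scalerA.
Qed.

Lemma compt_ad2 z (A : tens L L) : compt (ad2 z A) = lie z.1 (compt A).
Proof.
move: A; apply: tens_lin_ext => [a u v|a u v|u v].
- by rewrite !linearP.
- by rewrite !linearP.
by rewrite ad2E linearD /= !comptE /= scale0r addr0 lieZr.
Qed.

Definition incl2 : tens g g -> tens L L := tmap (@incl K g) (@incl K g).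
HB.instance Definition _ := GRing.Linear.copy incl2 (tmap (@incl K g) (@incl K g)).
Definition prg2 : tens L L -> tens g g := tmap prg prg.
HB.instance Definition _ := GRing.Linear.copy prg2 (tmap prg prg).
Lemma incl2E u v : incl2 (tensor u v) = tensor (incl u) (incl v).
Proof. by rewrite /incl2 tmapE //; apply: incl_is_linear. Qed.
Lemma prg2E u v : prg2 (tensor u v) = tensor (prg u) (prg v).
Proof. by rewrite /prg2 tmapE. Qed.

Lemma tswap_incl2 A : tswap (incl2 A) = incl2 (tswap A).
Proof.
move: A; apply: tens_lin_ext => [a u v|a u v|u v].
- by rewrite !linearP.
- by rewrite !linearP.
by rewrite incl2E !tswapE incl2E.
Qed.

Lemma tswap_prg2 A : tswap (prg2 A) = prg2 (tswap A).
Proof.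
move: A; apply: tens_lin_ext => [a u v|a u v|u v].
- by rewrite !linearP.
- by rewrite !linearP.
by rewrite prg2E !tswapE prg2E.
Qed.

Lemma tswap_wedge (u v : L) : tswap (wedge u v) = - wedge u v.
Proof. by rewrite /wedge linearB /= !tswapE opprB. Qed.

(** The identity holds for [B - tswap B] by bilinearity; an antisymmetric [A] is of this
form with [B = A / 2]. *)
Lemma antisym_decomp (ch0 : [pchar K] =i pred0) (A : tens L L) : Lambda2 A ->
  A = incl2 (prg2 A) + wedge (incl (compt A)) t.
Proof.
move=> AL.
pose G (B : tens L L) : tens L L := incl2 (prg2 B) + wedge (incl (compt B)) t.
have Gl : linear G.
  by move=> a u v; rewrite /G /wedge !linearP /= tensor_linearl; modring.
have key (B : tens L L) : B - tswap B =
    incl2 (prg2 (B - tswap B)) + wedge (incl (compt (B - tswap B))) t.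
  move: B; apply: tens_lin_ext => [a u v|a u v|u v].
  - by rewrite !linearP /=; modring.
  - rewrite -!/(G _) -Gl; congr G; rewrite linearP /=; modring.
  rewrite tswapE /wedge !linearB /= !prg2E !incl2E !comptE !linearZ /=.
  rewrite !(tensorDl, tensorZl, tensorNl).
  rewrite {1 2}(decompL u) {1 2}(decompL v) !(tensorDl, tensorDr, tensorZl, tensorZr) /prg.
  by rewrite /=; modring.
have := key (2%:R^-1 *: A); rewrite linearZ /= AL scalerN opprK -scalerDl.
suff -> : 2%:R^-1 + 2%:R^-1 = 1 :> K by rewrite scale1r.
by field; apply: char0_two.
Qed.

(** The two components of [A] are an invariant bivector of [g] and a central element
of [g]. *)
Lemma invariant2_ext (ch0 : [pchar K] =i pred0) (ss : semisimple g) (A : tens L L) :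
  Lambda2 A -> (forall x, ad2 (incl x) A = 0) -> A = 0.
Proof.
move=> AL A0; rewrite (antisym_decomp ch0 AL).
have -> : prg2 A = 0.
  apply: (ss_invariant2 ch0 ss); first by rewrite /Lambda2 tswap_prg2 AL linearN.
  by move=> x; rewrite -[x]/(prg (incl x)) -tmap_ad2 // A0 linear0.
have -> : compt A = 0.
  apply: (ss_centerless ch0 ss) => x.
  by rewrite lieC -[x]/((incl x).1) -compt_ad2 A0 linear0 oppr0.
by rewrite linear0 add0r /wedge linear0 tensor0l tensor0r subrr.
Qed.

Definition incl3 : tens3 g -> tens3 L := tmap incl2 (@incl K g).
HB.instance Definition _ := GRing.Linear.copy incl3 (tmap incl2 (@incl K g)).
Definition tail_t (A : tens g g) : tens3 L := tensor (incl2 A) t.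
Lemma tail_t_is_linear : linear tail_t.
Proof. by move=> a A B; rewrite /tail_t linearP /= tensor_linearl. Qed.
HB.instance Definition _ := GRing.isLinear.Build K (tens g g) (tens3 L) *:%R tail_t tail_t_is_linear.

Lemma incl3E u v w : incl3 (tensor3 u v w) = tensor3 (incl u) (incl v) (incl w).
Proof. by rewrite /incl3 tmapE ?incl2E //; apply: linearP. Qed.
Lemma tail_tE u v : tail_t (tensor u v) = tensor3 (incl u) (incl v) t.
Proof. by rewrite /tail_t incl2E. Qed.

Lemma cyc3_incl3 A : cyc3 (incl3 A) = incl3 (cyc3 A).
Proof.
have tc B : tcycle (incl3 B) = incl3 (tcycle B).
  move: B; apply: tens3_lin_ext => [a u v|a u v|u v w].
  - by rewrite !linearP.
  - by rewrite !linearP.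
  by rewrite incl3E !tcycleE incl3E.
by rewrite /cyc3 !tc !linearD.
Qed.

(** With [D = lie H], the [t]-terms come from [D] acting inside [dg x] and from
[dg (D x)]; after rotating [t] to the last leg and using the antisymmetry of
[dg x], the former sum up to [- ad2 H (dg x)]. The terms with two
factors [t] cancel in the cyclic sum. *)
Lemma co_jacobi_ext (d : 'Hom(L, tens L L)) (dg : 'Hom(g, tens g g)) (H : g) x :
  (forall y, d (incl y) = incl2 (dg y) + wedge (incl (lie H y)) t) -> d t = 0 ->
  (forall y, Lambda2 (dg y)) ->
  cyc3 (tmap d id (d (incl x))) =
  incl3 (cyc3 (tmap dg id (dg x))) + cyc3 (tail_t (dg (lie H x) - ad2 H (dg x))).
Proof.
move=> dE dt dL.
(* The two tensors with [t] in the first and in the middle leg. *)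
pose P1 (A : tens g g) : tens3 L := tlift (fun u v => tensor3 t (incl u) (incl v)) A.
pose P2 (A : tens g g) : tens3 L := tlift (fun u v => tensor3 (incl u) t (incl v)) A.
have P1E u v : P1 (tensor u v) = tensor3 t (incl u) (incl v).
  rewrite /P1 lift_tensor // => w a y z; rewrite linearP /=.
    by rewrite tensor3_lin2.
  by rewrite tensor3_lin3.
have P2E u v : P2 (tensor u v) = tensor3 (incl u) t (incl v).
  rewrite /P2 lift_tensor // => w a y z; rewrite linearP /=.
    by rewrite tensor3_lin1.
  by rewrite tensor3_lin3.
have P1l : linear P1 by apply: lift_is_linear.
have P2l : linear P2 by apply: lift_is_linear.
have tl : linear (fun u : L => tensor (d u) t) by move=> a u v; rewrite linearP /= tensor_linearl.
pose D := lie H.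
have step (A : tens g g) : tmap d id (incl2 A) =
    incl3 (tmap dg id A) + (P2 (tmap D id A) - P1 (tmap D id A)).
  move: A; apply: tens_lin_ext => [a u v|a u v|u v].
  - by rewrite !linearP.
  - by rewrite !linearP /= P1l P2l; modring.
  rewrite incl2E !tmapE //; try exact: linearP; try exact: lie_is_linearr.
  rewrite P1E P2E dE /wedge /D /id tensorDl tensorBl /tensor3; congr (_ + _).
  by rewrite /incl3 tmapE //; apply: linearP.
have tri (A : tens g g) : cyc3 (P1 A) = cyc3 (tail_t A).
  move: A; apply: tens_lin_ext => [a u v|a u v|u v].
  - by rewrite P1l linearP.
  - by rewrite !linearP.
  by rewrite P1E -cyc3_tcycle tcycleE tail_tE.
have tri2 (A : tens g g) : cyc3 (P2 A) = cyc3 (tail_t (tswap A)).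
  move: A; apply: tens_lin_ext => [a u v|a u v|u v].
  - by rewrite P2l linearP.
  - by rewrite !linearP.
  by rewrite P2E tswapE tail_tE -[RHS]cyc3_tcycle tcycleE.
rewrite dE linearD /= step /wedge linearB /= !tmapE //; try exact: linearP.
rewrite dt tensor0l subr0 dE tensorDl !cyc3D cyc3N tri tri2 cyc3_incl3.
rewrite -addrA; congr (_ + _).
have sw : tswap (tmap D id (dg x)) = - tmap id D (dg x).
  have -> : tmap id D (dg x) = - tmap id D (tswap (dg x)) by rewrite dL linearN opprK.
  rewrite opprK; move: (dg x); apply: tens_lin_ext => [a u v|a u v|u v].
  - by rewrite !linearP.
  - by rewrite !linearP.
  by rewrite !tmapE ?tswapE ?tmapE //; exact: lie_is_linearr.
have adE : ad2 H (dg x) = tmap D id (dg x) + tmap id D (dg x).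
  move: (dg x); apply: tens_lin_ext => [a u v|a u v|u v].
  - by rewrite linearP.
  - by rewrite !linearP /=; modring.
  by rewrite ad2E !tmapE //; exact: lie_is_linearr.
have tt0 : cyc3 (tensor (wedge (incl (lie H (lie H x))) t) t) = 0.
  rewrite /wedge tensorBl linearB /=; apply/eqP; rewrite subr_eq0; apply/eqP.
  by rewrite -[LHS]cyc3_tcycle -[LHS]cyc3_tcycle; rewrite !tcycleE.
rewrite tt0 addr0 -/(tail_t _) sw adE (linearB tail_t) (linearD tail_t) (linearN tail_t) /=.
move: (tail_t (dg _)) (tail_t (tmap D id _)) (tail_t (tmap id D _)) => a b c.
by rewrite !cyc3D !cyc3N !cyc3D (opprD (cyc3 b)) [LHS]addrC; congr (_ + _); rewrite addrC.
Qed.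
End Extension.

(** * Cobrackets on the semisimple Lie algebra and on its extension *)

Section Coboundaries.
Variables (K : fieldType) (g : lieAlgType K).
Hypotheses (ch0 : [pchar K] =i pred0).
Local Notation L := (g * K^o)%type.
Local Notation t := (tvec g).

Lemma cobracket_ofE (h : lieAlgType K) (r : tens h h) x : cobracket_of r x = ad2 x r.
Proof.
pose f : {linear h -> tens h h} := HB.pack (fun x => ad2 x r) (GRing.isLinear.Build _ _ _ _ _ (ad2_linearl r)).
by rewrite /cobracket_of -[LHS]/(linfun f x) lfunE.
Qed.

Lemma bialgebra_of_CYB (d : 'Hom(g, tens g g)) r : Lambda2 r -> (forall x, d x = ad2 x r) ->
  co_jacobi d <-> forall x, ad3 x (CYB r) = 0.
Proof.
move=> rL dE.
have sE x : cyc3 (tmap d id (d x)) = - ad3 x (CYB r).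
  by rewrite -co_jacobi_CYB // dE; congr cyc3; apply: eq_tmap.
split=> [co x|CY x]; last by move: (sE x); rewrite CY oppr0.
by apply/eqP; rewrite -oppr_eq0 -sE; apply/eqP; apply: co.
Qed.

Lemma coboundary_bialgebra (h : lieAlgType K) (d : 'Hom(h, tens h h)) (r : tens h h) :
  Lambda2 r -> (forall x, d x = ad2 x r) -> co_jacobi d -> lie_bialgebra d.
Proof.
move=> rL dE co; split=> // [x|x y]; first by rewrite dE; apply: Lambda2_ad2.
by rewrite !dE ad2_lie.
Qed.

Hypothesis ss : semisimple g.

Lemma bialgebra_coboundary (d : 'Hom(g, tens g g)) : lie_bialgebra d ->
  exists r, [/\ Lambda2 r, Lambda3 (CYB r), forall x, ad3 x (CYB r) = 0
               & forall x, d x = ad2 x r].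
Proof.
move=> [dL co dc].
have [R dR] := whitehead ch0 ss (fun A => @ad2_linearl _ g A) (@ad2_is_linear _ g)
  (@ad2_lie _ g) (linearP d) dc.
have [r [rL rE]] := antisymmetrize ch0 dL dR.
exists r; split=> //; first exact: Lambda3_CYB.
exact/(bialgebra_of_CYB rL rE).
Qed.

Lemma coderivation_ad (d : 'Hom(g, tens g g)) H :
  coderivation d (ad H) <-> forall x, d (lie H x) = ad2 H (d x).
Proof.
have E x : tmap (ad H) id (d x) + tmap id (ad H) (d x) = ad2 H (d x).
  move: (d x); apply: tens_lin_ext => [a u v|a u v|u v].
  - by rewrite !linearP /=; modring.
  - by rewrite linearP.
  by rewrite ad2E !tmapE ?adE //; exact: linearP.
by split=> h x; have := h x; rewrite E adE.
Qed.

(** By the cocycle identity the defect [ad2 H (d x) - d (lie H x)] is [ad2 x (d H)],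
so it vanishes for all [x] exactly when [d H] is an invariant bivector. *)
Lemma biderivation_kernel (d : 'Hom(g, tens g g)) (H : g) : lie_bialgebra d ->
  (forall x, d (lie H x) = ad2 H (d x)) <-> H \in lker d.
Proof.
move=> [dL _ dc]; rewrite memv_ker; split=> [dH|/eqP dH x]; last first.
  by rewrite dc dH linear0 subr0.
apply/eqP/(ss_invariant2 ch0 ss) => // x.
have := dc H x; rewrite dH => /eqP; rewrite eq_sym -subr_eq0 addrAC subrr add0r oppr_eq0.
by move=> /eqP.
Qed.

(** A derivation is a 1-cocycle with values in the adjoint representation. *)
Lemma derivation_inner (D : 'End(g)) : derivation D -> exists H, D = ad H.
Proof.
move=> dD.
have [|||w wE] := @whitehead K g g (fun x y => lie x y) D ch0 ss (@lie_is_linearl _ g) (@lie_is_linearr _ g).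
- by move=> x y v; rewrite (lie_leibniz x y) addrK.
- exact: linearP.
- by move=> x y; rewrite dD (lieC (D x)) addrC.
by exists (- w); apply/lfunP => x; rewrite adE wE (lieC (- w)) lieNr opprK.
Qed.

Lemma biderivation_inner (d : 'Hom(g, tens g g)) (D : 'End(g)) :
  lie_bialgebra d -> biderivation d D -> exists2 H, H \in lker d & D = ad H.
Proof.
move=> bd [dD cD]; have [H DE] := derivation_inner dD; exists H => //.
by apply/(biderivation_kernel _ bd)/coderivation_ad; rewrite -DE.
Qed.

Lemma derivation_ad H : derivation (ad H : 'End(g)).
Proof. by move=> x y; rewrite !adE lie_leibniz. Qed.

Lemma ext_tensorE (r : tens g g) (H : g) : ext_tensor r H = incl2 r - wedge (incl H) t.
Proof. by []. Qed.

Lemma Lambda2_ext (r : tens g g) H : Lambda2 r -> Lambda2 (ext_tensor r H).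
Proof.
by move=> rL; rewrite /Lambda2 ext_tensorE linearB /= tswap_incl2 rL (linearN (@incl2 K g)) tswap_wedge [RHS]opprD.
Qed.

Lemma ad2_ext (r : tens g g) H x :
  ad2 (incl x) (ext_tensor r H) = ad2 (incl x) (incl2 r) + wedge (incl (lie H x)) t.
Proof.
rewrite ext_tensorE linearB /=; congr (_ + _).
rewrite /wedge linearB /= !ad2E tvecR tensor0r tensor0l addr0 add0r -incl_lie.
by rewrite (lieC H) (linearN (@incl K g)) tensorNl tensorNr opprB opprK addrC.
Qed.

Lemma ad2_incl2 (r : tens g g) x : ad2 (incl x) (incl2 r) = incl2 (ad2 x r).
Proof. by rewrite /incl2 tmap_ad2 //; apply: incl_is_linear. Qed.

(** The cocycle identity for [x] and [t] makes [d t] invariant under [g], hence zero;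
the restriction of [d] to [g] is a cocycle, and [t] acts trivially, so the
bounding tensor found for [g] serves all of [L]. *)
Lemma ext_coboundary (d : 'Hom(L, tens L L)) : lie_bialgebra d ->
  d t = 0 /\ exists R, Lambda2 R /\ forall z, d z = ad2 z R.
Proof.
move=> [dL co dc].
have dt : d t = 0.
  apply: (invariant2_ext ch0 ss) => // x.
  have := dc (incl x) t; rewrite tvecR linear0 ad2_tvec subr0 => <- //.
split=> //.
have [|||||R dR] := @whitehead K g (tens L L) (fun x A => ad2 (incl x) A) (fun x => d (incl x)) ch0 ss.
- by move=> A a x y; rewrite linearP /= ad2_linearl.
- by move=> x; apply: ad2_is_linear.
- by move=> x y A; rewrite incl_lie ad2_lie.
- by move=> a x y; rewrite !linearP.
- by move=> x y; rewrite incl_lie dc.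
have {}dR z : d z = ad2 z R.
  rewrite ad2_decomp -dR {1}(decompL z) linearD linearZ /= dt.
  by rewrite scaler0 addr0.
by have [r [rL rE]] := antisymmetrize ch0 dL dR; exists r.
Qed.
End Coboundaries.

Section ExtStructure.
Variables (K : fieldType) (g : lieAlgType K).
Hypotheses (ch0 : [pchar K] =i pred0) (ss : semisimple g).
Local Notation L := (g * K^o)%type.
Local Notation t := (tvec g).

Definition prg3 : tens3 L -> tens3 g := tmap (@prg2 K g) (@prg K g).
HB.instance Definition _ := GRing.Linear.copy prg3 (tmap (@prg2 K g) (@prg K g)).
(** Reads off the [t]-terms: it vanishes on the range of [incl3] and inverts [cyc3] of [tail_t]. *)
Definition tail3 (A : tens3 L) : tens g g := tlift (fun (B : tens L L) (w : L) => (w.2 : K) *: prg2 B) A.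
Lemma tail3_is_linear : linear tail3. Proof. exact: lift_is_linear. Qed.
HB.instance Definition _ := GRing.isLinear.Build K (tens3 L) (tens g g) *:%R tail3 tail3_is_linear.

Lemma prg3E u v w : prg3 (tensor3 u v w) = tensor3 (prg u) (prg v) (prg w).
Proof. by rewrite /prg3 tmapE ?prg2E //; apply: linearP. Qed.
Lemma tail3E u v w : tail3 (tensor3 u v w) = (w.2 : K) *: tensor (prg u) (prg v).
Proof.
rewrite /tail3 lift_tensor ?prg2E // => [w' a x y|u' a x y] /=.
  by rewrite linearP /= scalerDr !scalerA mulrC.
by rewrite scalerDl scalerA.
Qed.

Lemma prg3_incl3 A : prg3 (incl3 A) = A.
Proof.
move: A; apply: tens3_lin_ext => [a u v|//|u v w]; first by rewrite !linearP.
by rewrite incl3E prg3E.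
Qed.

Lemma tail3_incl3 A : tail3 (incl3 A) = 0.
Proof.
move: A; apply: tens3_lin_ext => [a u v|a u v|u v w].
- by rewrite !linearP.
- by rewrite scaler0 addr0.
by rewrite incl3E tail3E scale0r.
Qed.

Lemma prg3_tail A : prg3 (cyc3 (tail_t A)) = 0.
Proof.
move: A; apply: tens_lin_ext => [a u v|a u v|u v].
- by rewrite !linearP.
- by rewrite scaler0 addr0.
rewrite tail_tE /cyc3 !tcycleE !linearD /= !prg3E /tensor3 /prg /=.
by rewrite !(tensor0r, tensor0l) !addr0.
Qed.

Lemma tail3_tail A : tail3 (cyc3 (tail_t A)) = A.
Proof.
move: A; apply: tens_lin_ext => [a u v|a u v|u v].
- by rewrite !linearP.
- by [].
rewrite tail_tE /cyc3 !tcycleE !linearD /= !tail3E /= !scale0r !addr0.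
by rewrite scale1r.
Qed.

(** The two components [prg3] and [tail3] of the co-Jacobi expression computed in
[co_jacobi_ext] separate the co-Jacobi identity of [dg] from the condition on [H]. *)
Lemma ext_bialgebraP (d : 'Hom(L, tens L L)) :
  lie_bialgebra d <->
  exists (dg : 'Hom(g, tens g g)) (D : 'End(g)) (r : tens g g) (H : g),
    [/\ lie_bialgebra dg /\ biderivation dg D,
        [/\ Lambda2 r, Lambda3 (CYB r), forall x, ad3 x (CYB r) = 0
          & forall x, dg x = ad2 x r],
        H \in lker dg /\ D = ad H,
        forall x : g,
          d (incl x) = ad2 (incl x) (tmap (@incl K g) (@incl K g) r)
                         + wedge (incl (lie H x)) (tvec g) /\
          d (incl x) = ad2 (incl x) (ext_tensor r H)
      & d (tvec g) = 0].
Proof.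
split=> [bd|]; last first.
  move=> [dg [D [r [H [[bg [_ cod]] [rL _ _ dgr] [Hk DE] dE dt]]]]].
  have dR z : d z = ad2 z (ext_tensor r H).
    rewrite ad2_decomp {1}(decompL z) linearD linearZ /= dt scaler0 addr0.
    by have [_ ->] := dE z.1.
  apply: (coboundary_bialgebra (Lambda2_ext _ rL) dR) => z.
  have e x : cyc3 (tmap d id (d (incl x))) = 0.
    rewrite (co_jacobi_ext (dg := dg) (H := H)) //.
    - have [_ co _] := bg; have -> : cyc3 (tmap dg id (dg x)) = 0 by apply: co.
      have /(biderivation_kernel ch0 ss H bg) -> := Hk.
      by rewrite linear0 subrr !linear0 addr0.
    - by move=> y; have [-> _] := dE y; rewrite dgr -ad2_incl2.
    - by have [] := bg.
  have -> : d z = d (incl z.1) by rewrite !dR ad2_decomp.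
  exact: e.
have [dt [R [RL dR]]] := ext_coboundary ch0 ss bd.
pose r := prg2 R; pose H := - compt R.
have rL : Lambda2 r by rewrite /Lambda2 tswap_prg2 RL linearN.
have RE : R = ext_tensor r H.
  rewrite (antisym_decomp ch0 RL) ext_tensorE; congr (_ + _).
  by rewrite /wedge /H (linearN (@incl K g)) tensorNl tensorNr opprB opprK addrC.
pose dg := cobracket_of r; have dgE x : dg x = ad2 x r := cobracket_ofE r x.
have dE x : d (incl x) = ad2 (incl x) (incl2 r) + wedge (incl (lie H x)) t.
  by rewrite dR RE ad2_ext.
have [_ co _] := bd.
have coE x : incl3 (cyc3 (tmap dg id (dg x))) + cyc3 (tail_t (dg (lie H x) - ad2 H (dg x))) = 0.
  rewrite -(co_jacobi_ext (d := d)) //; first exact: co.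
    by move=> y; rewrite dE dgE ad2_incl2.
  by move=> y; rewrite dgE; apply: Lambda2_ad2.
have co_g : co_jacobi dg.
  move=> x; have := congr1 prg3 (coE x).
  by rewrite linearD /= prg3_incl3 prg3_tail linear0 addr0.
have bg : lie_bialgebra dg := coboundary_bialgebra rL dgE co_g.
have dH x : dg (lie H x) = ad2 H (dg x).
  have := congr1 tail3 (coE x).
  by rewrite linearD /= tail3_incl3 tail3_tail linear0 add0r => /eqP; rewrite subr_eq0 => /eqP.
have Hk : H \in lker dg by apply/(biderivation_kernel ch0 ss H bg).
exists dg, (ad H), r, H; split=> //.
- by split=> //; split; [exact: derivation_ad | apply/coderivation_ad].
- split=> //; first exact: Lambda3_CYB.
  exact/(bialgebra_of_CYB rL dgE).
by move=> x; split; [exact: dE | rewrite dR RE].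
Qed.

Lemma ext_coboundaryP (d : 'Hom(L, tens L L)) : lie_bialgebra d -> coboundary d.
Proof. by move=> /(ext_coboundary ch0 ss)[_ [R [RL dR]]]; exists R. Qed.

(** The automorphism of [L] that is the identity on [g] and multiplies [t] by [c]. *)
Lemma ext_rescale (r : tens g g) (H : g) (c : K) : c != 0 ->
  bialgebra_iso (cobracket_of (ext_tensor r H)) (cobracket_of (ext_tensor r (c *: H))).
Proof.
move=> c0.
pose f0 k (z : L) : L := (z.1, k * z.2).
have f0l k : linear (f0 k).
  by move=> a x y; congr pair; rewrite /= mulrDr mulrCA.
pose lf k : {linear L -> L} := HB.pack (f0 k) (GRing.isLinear.Build _ _ _ _ (f0 k) (f0l k)).
pose f : 'Hom(L, L) := linfun (lf c).
have fE z : f z = f0 c z by rewrite lfunE.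
have fL x y : f0 c (lie x y) = lie (f0 c x) (f0 c y).
  by congr pair; rewrite /= mulr0.
exists f; split.
- exists (f0 c^-1) => z; rewrite ?fE /f0 /=; case: z => x s /=.
    by rewrite mulKf.
  by rewrite mulVKf.
- by move=> x y; rewrite !fE fL.
move=> z; rewrite !cobracket_ofE (eq_tmap (f' := f0 c) (h' := f0 c)) ?fE //.
rewrite tmap_ad2 //; congr ad2.
rewrite !ext_tensorE linearB /=; congr (_ - _).
  move: r; apply: tens_lin_ext => [a u v|a u v|u v].
  - by rewrite !linearP.
  - by rewrite linearP.
  by rewrite !incl2E tmapE // /f0 /= mulr0.
have ft : f0 c t = c *: (t : L) by congr pair; rewrite /= ?scaler0.
have fi x : f0 c (incl x) = incl x by rewrite /f0 /= mulr0.
have iZ : incl (c *: H) = c *: incl H by rewrite /incl; congr pair; rewrite /= scaler0.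
by rewrite /wedge linearB /= !tmapE // ft !fi iZ !tensorZl !tensorZr.
Qed.
End ExtStructure.

(** * Weights of a nilpotent subalgebra *)

Lemma lieNl (K : fieldType) (g : lieAlgType K) (x y : g) : lie (- x) y = - lie x y.
Proof. by rewrite lieC lieNr opprK lieC. Qed.

(** Applied with [P] a subspace: among the partial products of the [T - c] take the last
one that leaves [v] outside. *)
Lemma eig_mod (K : fieldType) (V : lmodType K) (P : V -> Prop) (T : V -> V) (cs : seq K) v :
  ~ P v -> P (foldr (fun c w => T w - c *: w) v cs) ->
  exists c cs', let w := foldr (fun c w => T w - c *: w) v cs' in ~ P w /\ P (T w - c *: w).
Proof.
move=> Pv; elim: cs => [//|c cs IHcs] /= Pc.
by have [/IHcs//|nP] := pselect (P (foldr (fun c w => T w - c *: w) v cs)); exists c, cs.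
Qed.

Lemma split_kill (K : closedFieldType) (V : vectType K) (T : V -> V) : linear T ->
  exists cs : seq K, forall v, foldr (fun c w => T w - c *: w) v cs = 0.
Proof.
move=> Tl; have [cs csE] := closed_field_poly_normal (char_poly (mxl T)).
exists cs => v; apply: (can_inj (@cvecK _ _)).
have -> : cvec (foldr (fun c w => T w - c *: w) v cs) =
    (\prod_(c <- cs) (mxl T - c%:M)) *m cvec v.
  elim: cs {csE} => [|c cs IHcs] /=; first by rewrite big_nil mul1mx.
  by rewrite big_cons -mulmxE -mulmxA -IHcs mulmxBl mul_scalar_mx mxlE // linearB linearZ.
have := @Cayley_Hamilton_split K K (GRing.RMorphism.clone _ _ idfun _) _ (mxl T) 1 _ cs.
rewrite mulr1 map_poly_id // map_mx_id // => /(_ _ csE) ->; first by rewrite mul0mx linear0.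
by rewrite (monicP (char_poly_monic _)) oner_neq0.
Qed.

Lemma eigen_mod_vspace (K : closedFieldType) (V : vectType K) (T : V -> V) (U0 U : {vspace V}) v :
  linear T -> (forall u, u \in U -> T u \in U) -> v \in U -> v \notin U0 ->
  exists c w, [/\ w \in U, w \notin U0 & T w - c *: w \in U0].
Proof.
move=> Tl TU vU vU0; have [cs cs0] := split_kill Tl.
have [||c [cs' [wU0 TwU0]]] := @eig_mod K V (fun w => w \in U0) T cs v.
- exact/negP.
- by rewrite cs0 mem0v.
exists c, (foldr (fun c w => T w - c *: w) v cs'); split=> //; last exact/negP.
elim: cs' {wU0 TwU0} => //= c' cs' IH.
by rewrite memvB ?memvZ ?TU.
Qed.

Section Heisenberg.
Variables (K : closedFieldType) (V : vectType K) (A B : V -> V) (U0 U : {vspace V}) (d : K).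
Hypotheses (ch0 : [pchar K] =i pred0) (Al : linear A) (Bl : linear B).
Hypotheses (A0 : forall u, u \in U0 -> A u \in U0) (AU : forall u, u \in U -> A u \in U).
Hypotheses (B0 : forall u, u \in U0 -> B u \in U0) (BU : forall u, u \in U -> B u \in U).
Hypothesis ABd : forall u, u \in U -> A (B u) - B (A u) - d *: u \in U0.

(** Let [w] be an eigenvector of [A] modulo [U0]. By the commutation relation [A]
lowers the index of the powers [B^k w], with coefficient [k d], so if [d] were nonzero
these powers would be independent modulo [U0]. *)
Lemma heisenberg v : v \in U -> v \notin U0 -> d = 0.
Proof.
move=> vU vU0; apply: contrapT => /eqP d0.
have [c [w [wU wU0 Aw]]] := eigen_mod_vspace Al AU vU vU0.
pose N u := A u - c *: u.
have Nl : linear N.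
  by move=> a x y; rewrite /N Al scalerDr opprD addrACA scalerBr !scalerA mulrC.
have ND x y : N (x + y) = N x + N y by have := Nl 1 x y; rewrite !scale1r.
have N0 : N 0 = 0 by apply: (addrI (N 0)); rewrite -ND !addr0.
have NZ a x : N (a *: x) = a *: N x by have := Nl a x 0; rewrite N0 !addr0.
have BD x y : B (x + y) = B x + B y by have := Bl 1 x y; rewrite !scale1r.
have B00 : B 0 = 0 by apply: (addrI (B 0)); rewrite -BD !addr0.
have BZ a x : B (a *: x) = a *: B x by have := Bl a x 0; rewrite B00 !addr0.
have BB x y : B (x - y) = B x - B y by rewrite -scaleN1r BD BZ scaleN1r.
pose b k := iter k B w.
have bU k : b k \in U by elim: k => //= k; apply: BU.
have Nb k : N (b k) - (k%:R * d) *: b k.-1 \in U0.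
  elim: k => [|k IHk]; first by rewrite mul0r scale0r subr0.
  have -> : N (b k.+1) - (k.+1%:R * d) *: b k =
      (A (B (b k)) - B (A (b k)) - d *: b k) + B (N (b k) - (k%:R * d) *: b k.-1).
    rewrite /N /= !BB !BZ; case: k {IHk} => [|k]; last first.
      by rewrite -[B (b k.+1.-1)]/(b k.+1) -[k.+2]addn1 natrD; modring.
    by rewrite !mul0r !scale0r mul1r /=; modring.
  by rewrite memvD ?ABd ?B0.
(* The span of [U0] and [b 0, ..., b k.-1]; its dimension would grow without bound. *)
pose F := fix F k := if k is k'.+1 then (F k' + <[b k']>)%VS else U0.
have U0F k : (U0 <= F k)%VS by elim: k => //= k IHk; apply: subv_trans IHk (addvSl _ _).
have FS k : (F k <= F k.+1)%VS by apply: addvSl.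
have NF k u : u \in F k.+1 -> N u \in F k.
  elim: k u => [|k IHk] u /memv_addP[u1 u1F [_ /vlineP[a ->] ->]]; rewrite ND NZ memvD ?memvZ //.
  - by rewrite memvB ?memvZ ?A0.
  - by rewrite (subvP (FS _)) ?IHk.
  rewrite -[N _](subrK ((k.+1%:R * d) *: b k)) memvD ?memvZ //; last first.
    by rewrite (subvP (addvSr _ _)) ?memv_line.
  by rewrite (subvP (U0F _)) ?(Nb k.+1).
have bF k : b k \notin F k.
  elim: k => // k; apply: contra => /NF NbF.
  have : (k.+1%:R * d) *: b k \in F k.
    rewrite -[_ *: _](subKr (N (b k.+1))) memvB //.
    by rewrite (subvP (U0F _)) ?(Nb k.+1).
  by rewrite rpredZeq mulf_eq0 (negPf d0) char0_natr_eq0.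
have dimF k : (k <= \dim (F k))%N.
  elim: k => // k IHk; apply: leq_ltn_trans IHk _.
  rewrite ltn_neqAle dimvS // andbT; apply: contra (bF k) => /eqP e.
  have /eqP -> : F k == F k.+1 by rewrite eqEdim FS e leqnn.
  by rewrite (subvP (addvSr _ _)) ?memv_line.
by have := leq_trans (dimF _) (dimvS (subvf (F (\dim {:V}).+1))); rewrite ltnn.
Qed.
End Heisenberg.

Section NilpotentWeights.
Variables (K : closedFieldType) (a : lieAlgType K) (h : {vspace a}).
Hypotheses (ch0 : [pchar K] =i pred0) (hsub : subalgebra h) (hnil : nilpotent h).

Definition stable_under (U : {vspace a}) := forall y u, y \in h -> u \in U -> lie y u \in U.

Lemma min_vspace (V : vectType K) (P : {vspace V} -> Prop) U : P U ->
  exists2 W, P W & forall W', P W' -> (W' <= W)%VS -> W' = W.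
Proof.
move=> PU; pose Q n := `[< exists W, P W /\ \dim W = n >].
have exQ : exists n, Q n by exists (\dim U); apply/asboolP; exists U.
case: (ex_minnP exQ) => n /asboolP[W [PW Wn]] nmin; exists W => // W' PW' sub.
by apply/eqP; rewrite eqEdim sub Wn nmin //; apply/asboolP; exists W'.
Qed.

(** On a minimal [h]-stable [U1] strictly above [U0] each term of the lower central
series of [h] acts by scalars modulo [U0]. This is shown downwards along the series: for [b]
in a term, the commutators [lie y b] lie in the next one and act by a scalar that is zero by
[heisenberg], so the eigenvectors of [b] modulo [U0] form a stable subspace. *)
Lemma weight_mod (U0 U : {vspace a}) v0 : stable_under U0 -> stable_under U ->
  (U0 <= U)%VS -> v0 \in U -> v0 \notin U0 ->
  exists (mu : a -> K) v, [/\ v \in U, v \notin U0 &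
    forall y, y \in h -> lie y v - mu y *: v \in U0].
Proof.
move=> s0 sU U0U v0U v00.
(* [U1] is minimal among the stable subspaces between [U0] and [U] other than [U0]. *)
have [U1 [s1 U01 U1U [u uU1 uU0]] U1min] := @min_vspace a (fun W : {vspace a} =>
  [/\ stable_under W, (U0 <= W)%VS, (W <= U)%VS & exists2 u, u \in W & u \notin U0]) U
  (And4 sU U0U (subvv U) (ex_intro2 _ _ v0 v0U v00)).
pose D k := iter k (liev h) h.
have Dh k : (D k <= h)%VS.
  elim: k => [|k IHk] //=; apply: liev_sub => y z yh zD; apply: hsub => //.
  exact: subvP IHk _ zD.
have scal k b : b \in D k -> exists c, forall v, v \in U1 -> lie b v - c *: v \in U0.
  have [n Dn] := hnil.
  have [m] := ubnP (n - k); elim: m k b => // m IHm k b.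
  have [nk _ bD|kn] := leqP n k.
    exists 0 => v _; suff -> : b = 0 by rewrite lie0l scale0r subr0 mem0v.
    move: bD; rewrite /D -(subnK nk) iterD Dn.
    suff -> : iter (k - n) (liev h) 0%VS = 0%VS by rewrite memv0 => /eqP.
    elim: (k - n)%N => //= j ->; apply/eqP; rewrite -subv0; apply: liev_sub => x y _.
    by rewrite memv0 => /eqP ->; rewrite lie0r mem0v.
  move=> lt bD; have bh : b \in h by apply: subvP (Dh k) _ bD.
  have commU0 y v : y \in h -> v \in U1 -> lie (lie y b) v \in U0.
    move=> yh vU1.
    have [||d dP] := IHm k.+1 (lie y b).
    - by move: lt; rewrite -(subnSK kn) ltnS.
    - exact: mem_liev.
    have d0 : d = 0.
      apply: (@heisenberg K a (lie y) (lie b) U0 U1 d ch0 (@lie_is_linearr _ a y) (@lie_is_linearr _ a b)) uU1 uU0.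
      - by move=> w; apply: s0.
      - by move=> w; apply: s1.
      - by move=> w; apply: s0.
      - by move=> w; apply: s1.
      - by move=> w wU1; rewrite (lie_leibniz y b w) addrK dP.
    by have := dP v vU1; rewrite d0 scale0r subr0.
  have [c [w [wU1 wU0 bw]]] := eigen_mod_vspace (@lie_is_linearr _ a b) (fun v => @s1 b v bh) uU1 uU0.
  have [W WP] : exists W : {vspace a}, forall v, v \in W <-> (v \in U1 /\ lie b v - c *: v \in U0).
    apply: vspace_of_pred => [|k' x y [xU xP] [yU yP]].
      by rewrite lie0r scaler0 subr0 !mem0v.
    split; first by rewrite memvD ?memvZ.
    by rewrite lie_is_linearr scalerDr scalerA mulrC -scalerA opprD addrACA -scalerBr memvD ?memvZ.
  have WE : W = U1.
    apply: U1min; last by apply/subvP => v /WP[].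
    split.
    - move=> y v yh /WP[vU1 vP]; apply/WP; split; first exact: s1.
      rewrite (lie_leibniz b y v) -addrA -lieZr -lieNr -lieDr memvD //; last exact: s0.
      by rewrite (lieC b) lieNl memvN commU0.
    - apply/subvP => v vU0; apply/WP; split; first exact: subvP U01 _ vU0.
      by rewrite memvB ?memvZ ?s0.
    - by apply: subv_trans U1U; apply/subvP => v /WP[].
    by exists w => //; apply/WP.
  by exists c => v; rewrite -WE => /WP[].
have /choice[mu muP] : forall b, exists c, b \in h -> forall v, v \in U1 -> lie b v - c *: v \in U0.
  move=> b; have [bh|] := boolP (b \in h); last by exists 0.
  by have [c cP] := scal 0%N b bh; exists c.
exists mu, u; split=> // [|y yh]; first exact: subvP U1U _ uU1.
exact: muP.
Qed.

Lemma iter_lie_nil y z : y \in h -> z \in h -> exists N, iter N (lie y) z = 0.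
Proof.
move=> yh zh; have [N hN] := hnil; exists N; apply/eqP; rewrite -memv0 -hN.
by elim: N {hN} => //= N IHN; apply: mem_liev.
Qed.

Lemma fitting_vec (V : vectType K) (T : V -> V) (u : V) : linear T ->
  exists w N, iter N T (u - w) = 0 /\
    (forall U : {vspace V}, (forall x, x \in U -> T x \in U) -> T u \in U -> w \in U).
Proof.
move=> Tl; have [S [N [Sc SP Si Sn]]] := fitting_mx (mxl T).
exists (vecc (S *m cvec (T u))), N; split.
  apply: (can_inj (@cvecK _ _)).
  have iterE k x : cvec (iter k T x) = mxl T ^+ k *m cvec x.
    by elim: k => [|k IHk] /=; rewrite ?mul1mx // -mxlE // IHk exprS -mulmxE mulmxA.
  rewrite iterE linearB /= veccK -mxlE // mulmxA.
  have -> : cvec u - S *m mxl T *m cvec u = (1%:M - mxl T *m S) *m cvec u.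
    by rewrite mulmxBl mul1mx (Sc (mxl T) (erefl _)).
  by rewrite mulmxA Sn mul0mx linear0.
move=> U TU TuU; apply: (SP (fun c => vecc c \in U)).
- by rewrite linear0 mem0v.
- by move=> k x y xU yU; rewrite linearP memvD ?memvZ.
- by move=> x xU; rewrite -[x]veccK mxlE // cvecK; apply: TU.
by rewrite cvecK.
Qed.

(** In a minimal stable subspace with a vector outside [U0] of weight [mu] modulo [U0] every
operator [lie y - mu y] is nilpotent: otherwise Fitting's lemma would give a smaller one.
A common eigenvector of [h] in it therefore has weight [mu]. *)
Lemma weight_lift (U0 U : {vspace a}) (mu : a -> K) v :
  stable_under U0 -> stable_under U -> v \in U -> v \notin U0 ->
  (forall y, y \in h -> lie y v - mu y *: v \in U0) ->
  exists2 w, w \in U /\ w != 0 & forall y, y \in h -> lie y w = mu y *: w.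
Proof.
move=> s0 sU vU vU0 vP.
pose F (W : {vspace a}) := [/\ stable_under W, (W <= U)%VS &
  exists u, [/\ u \in W, u \notin U0 & forall y, y \in h -> lie y u - mu y *: u \in U0]].
have [|W [sW WU [u [uW uU0 uP]]] Wmin] := @min_vspace a F U.
  by split=> //; exists v.
pose T y w := lie y w - mu y *: w.
have Tl y : linear (T y).
  by move=> k x z; rewrite /T lie_is_linearr scalerDr opprD addrACA scalerBr !scalerA mulrC.
have TU y V : y \in h -> stable_under V -> forall x, x \in V -> T y x \in V.
  by move=> yh sV x xV; rewrite /T memvB ?memvZ ?sV.
have nilT y w : y \in h -> w \in W -> exists N, iter N (T y) w = 0.
  move=> yh.
  have it0 N : iter N (T y) 0 = 0.
    by elim: N => //= N ->; rewrite /T lie0r scaler0 subr0.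
  have itD N x z k : iter N (T y) (k *: x + z) = k *: iter N (T y) x + iter N (T y) z.
    by elim: N => //= N ->; rewrite Tl.
  have it_le N N' x : (N <= N')%N -> iter N (T y) x = 0 -> iter N' (T y) x = 0.
    by move=> le e; rewrite -(subnK le) iterD e it0.
  have [W' W'P] : exists W' : {vspace a}, forall x, x \in W' <-> (x \in W /\ exists N, iter N (T y) x = 0).
    apply: vspace_of_pred; first by split; [exact: mem0v | exists 0%N].
    move=> k x z [xW [N xN]] [zW [N' zN']]; split; first by rewrite memvD ?memvZ.
    exists (maxn N N'); rewrite itD (it_le _ _ _ (leq_maxl _ _) xN).
    by rewrite (it_le _ _ _ (leq_maxr _ _) zN') scaler0 addr0.
  have <- : W' = W; last by move=> /W'P[].
  apply: Wmin; last by apply/subvP => x /W'P[].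
  split.
  - move=> z x zh /W'P[xW [N xN]]; apply/W'P; split; first exact: sW.
    have [M zM] := iter_lie_nil yh zh; exists (M + N)%N.
    apply: (@iter_leibniz _ _ _ (@lie _ a) (lie y) (T y) (T y)) zM xN => [p|p|p q|p q].
    + exact: lie0r.
    + exact: lie0l.
    + by have := Tl y 1 p q; rewrite !scale1r.
    by rewrite /T (lie_leibniz y p q) [in RHS]lieDr lieNr lieZr addrA.
  - by apply: subv_trans WU; apply/subvP => x /W'P[].
  (* [w1] is the invertible component of [u]; it lies in [U0], so [u - w1] is as good as [u]. *)
  have [w1 [N [wN wV]]] := fitting_vec u (Tl y).
  have wW : w1 \in W by apply: wV; [exact: TU | exact: TU].
  have wU0 : w1 \in U0 by apply: wV; [exact: TU | exact: uP].
  exists (u - w1); split.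
  - by apply/W'P; split; [rewrite memvB | exists N].
  - by apply: contra uU0 => uw; rewrite -[u](subrK w1) memvD.
  move=> z zh.
  have -> : lie z (u - w1) - mu z *: (u - w1) = T z u - T z w1.
    by rewrite /T lieDr lieNr; modring.
  by rewrite memvB ?uP // TU.
have u0 : u != 0 by apply: contraNneq uU0 => ->; apply: mem0v.
have [|||||nu [w [wW w0 wP]]] := @weight_mod 0%VS W u.
- by move=> y x _; rewrite memv0 => /eqP ->; rewrite lie0r mem0v.
- exact: sW.
- exact: sub0v.
- exact: uW.
- by rewrite memv0.
have {}wP y : y \in h -> lie y w = nu y *: w.
  by move=> yh; have := wP y yh; rewrite memv0 subr_eq0 => /eqP.
exists w; first by rewrite (subvP WU) // -memv0.
move=> y yh; rewrite wP //; congr (_ *: _); apply/eqP; rewrite -subr_eq0.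
have [N] := nilT y w yh wW.
have -> : iter N (T y) w = (nu y - mu y) ^+ N *: w.
  elim: N => [|N IHN] /=; first by rewrite scale1r.
  rewrite IHN /T lieZr wP // !scalerA -scalerBl mulrC -mulrBl exprS.
  by rewrite mulrC; congr (_ *: _); ring.
rewrite memv0 in w0.
by move/eqP; rewrite scaler_eq0 (negPf w0) orbF expf_eq0 => /andP[].
Qed.
End NilpotentWeights.

(** * Cartan subalgebras and invariant forms *)

(** This consequence of semisimplicity passes to the complexification by an
elementary argument. *)
Definition no_abelian_ideal (K : fieldType) (a : lieAlgType K) : Prop :=
  forall U : {vspace a}, ideal U ->
    (forall u v, u \in U -> v \in U -> lie u v = 0) -> U = 0%VS.

Lemma hom_sumMz (K : fieldType) (V : vectType K) (L : 'Hom(V, K^o)) (I : Type) (r : seq I)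
    (G : I -> V) (c : I -> int) : L (\sum_(i <- r) G i *~ c i) = \sum_(i <- r) (L (G i) : K) *~ c i.
Proof. by rewrite linear_sum; apply: eq_bigr => i _; rewrite raddfMz. Qed.

Lemma hom_sumMn (K : fieldType) (V : vectType K) (L : 'Hom(V, K^o)) (I : Type) (r : seq I)
    (G : I -> V) (c : I -> nat) : L (\sum_(i <- r) G i *+ c i) = \sum_(i <- r) (L (G i) : K) *+ c i.
Proof. by rewrite linear_sum; apply: eq_bigr => i _; rewrite raddfMn. Qed.

Section CartanForm.
Variables (K : closedFieldType) (a : lieAlgType K) (h : {vspace a}) (B : bilform a).
Hypotheses (ch0 : [pchar K] =i pred0) (noab : no_abelian_ideal a).
Hypotheses (hC : cartan h) (BI : invariant_form B).

Let hsub : subalgebra h. Proof. by case: hC. Qed.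
Let hnil : nilpotent h. Proof. by case: hC. Qed.
Let hnorm x : (forall u, u \in h -> lie x u \in h) -> x \in h. Proof. by case: hC => _ _; apply. Qed.
Let BC x y : B x y = B y x. Proof. by case: BI. Qed.
Let Binv x y z : B (lie x y) z = B x (lie y z). Proof. by case: BI. Qed.
Let Bnd x : (forall y, B x y = 0) -> x = 0. Proof. by case: BI => _ _; apply. Qed.
Let BDr x y z : B x (y + z) = B x y + B x z. Proof. exact: linearD. Qed.
Let BDl x y z : B (y + z) x = B y x + B z x. Proof. by rewrite !(BC _ x) BDr. Qed.
Let BZr k x y : B x (k *: y) = k * B x y. Proof. exact: linearZ. Qed.
Let BZl k x y : B (k *: y) x = k * B y x. Proof. by rewrite !(BC _ x) BZr. Qed.
Let B0r x : B x 0 = 0. Proof. exact: linear0. Qed.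
Let B0l x : B 0 x = 0. Proof. by rewrite BC B0r. Qed.
Let BNr x y : B x (- y) = - B x y. Proof. exact: linearN. Qed.
Let BNl x y : B (- y) x = - B y x. Proof. by rewrite !(BC _ x) BNr. Qed.
Let Bsumr x I (r : seq I) (P : pred I) (F : I -> a) :
  B x (\sum_(i <- r | P i) F i) = \sum_(i <- r | P i) B x (F i).
Proof. exact: linear_sum. Qed.

Lemma central0 (z : a) : (forall y, lie z y = 0) -> z = 0.
Proof.
move=> z0; have zE : <[z]>%VS = 0%VS.
  apply: noab => [x _ /vlineP[k ->]|_ v /vlineP[k ->] _].
    by rewrite lieZr lieC z0 oppr0 scaler0 mem0v.
  by rewrite lieZl z0 scaler0.
by apply/eqP; rewrite -memv0 -zE memv_line.
Qed.

Implicit Types (al be ga : hdual h).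

Lemma evalhD al be y : evalh (al + be) y = evalh al y + evalh be y.
Proof. by rewrite /evalh add_lfunE. Qed.
Lemma evalhN al y : evalh (- al) y = - evalh al y.
Proof. by rewrite /evalh opp_lfunE. Qed.
Lemma evalh_sumMz (G : seq (hdual h)) (F : hdual h -> hdual h) (c : hdual h -> int) y :
  evalh (\sum_(ga <- G) F ga *~ c ga) y = \sum_(ga <- G) evalh (F ga) y *~ c ga.
Proof.
have ev0 : evalh (0 : hdual h) y = 0 by rewrite /evalh zero_lfunE.
pose ev al := evalh al y; rewrite -/(ev _).
have evD : {morph ev : al be / al + be} by move=> al be; apply: evalhD.
rewrite (big_morph ev evD ev0); apply: eq_bigr => ga _.
have evMn n : ev (F ga *+ n) = ev (F ga) *+ n.
  by elim: n => [|n IHn]; rewrite ?mulr0n // !mulrS evD IHn.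
by case: (c ga) => n; rewrite -?pmulrn ?NegzE ?nmulrn /ev ?evalhN -/(ev _) ?evMn // evMn mulrNz.
Qed.

Lemma evalh_ext al be : (forall y, y \in h -> evalh al y = evalh be y) -> al = be.
Proof.
move=> e; apply/lfunP => s; have := e (vsval s) (subvsP s).
by rewrite /evalh vsvalK.
Qed.

Lemma evalh_neq0 al : al <> 0 -> exists2 y, y \in h & evalh al y != 0.
Proof.
move=> al0; apply: contrapT => nex; apply: al0; apply: evalh_ext => y yh.
rewrite {2}/evalh zero_lfunE; apply/eqP/negPn/negP => n0; apply: nex.
by exists y.
Qed.

Lemma rootP al v y : v \in root_space al -> y \in h -> lie y v = evalh al y *: v.
Proof. by move=> /root_spaceP vP; apply: vP. Qed.

Lemma weight_root (mu : a -> K) v : v != 0 -> (forall y, y \in h -> lie y v = mu y *: v) ->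
  exists2 al : hdual h, forall y, y \in h -> evalh al y = mu y & v \in root_space al.
Proof.
move=> v0 vP.
have mul : linear (fun s : subvs_of h => mu (vsval s) : K^o).
  move=> k s s'; apply/eqP; rewrite -subr_eq0.
  have : (mu (vsval (k *: s + s')) - (k * mu (vsval s) + mu (vsval s'))) *: v == 0.
    rewrite scalerBl scalerDl -scalerA -!vP ?subvsP // linearP /=.
    by rewrite lie_is_linearl subrr.
  by rewrite scaler_eq0 (negPf v0) orbF.
pose lmu : {linear subvs_of h -> K^o} := HB.pack (fun s : subvs_of h => mu (vsval s) : K^o) (GRing.isLinear.Build _ _ _ _ _ mul).
have muE y : y \in h -> evalh (linfun lmu) y = mu y.
  by move=> yh; rewrite /evalh lfunE /= vsprojK.
exists (linfun lmu) => //.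
by apply/root_spaceP => y yh; rewrite muE // vP.
Qed.

(** [ad y] is nilpotent on [h] but invertible on the root space, and it is skew for [B]. *)
Lemma B_h_root z v al : z \in h -> al <> 0 -> v \in root_space al -> B z v = 0.
Proof.
move=> zh al0 vr; have [y yh aly] := evalh_neq0 al0.
have [N zN] := iter_lie_nil hnil yh zh.
have e k : B (iter k (lie y) z) v = (- evalh al y) ^+ k * B z v.
  elim: k => [|k IHk] /=; first by rewrite mul1r.
  rewrite lieC BNl Binv (rootP vr yh) BZr IHk exprS; ring.
have := e N; rewrite zN B0l => /esym/eqP.
by rewrite mulf_eq0 expf_eq0 oppr_eq0 (negPf aly) andbF => /eqP.
Qed.

Lemma B_root_root u v al be : u \in root_space al -> v \in root_space be ->
  al + be <> 0 -> B u v = 0.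
Proof.
move=> ur vr /evalh_neq0[y yh]; rewrite evalhD => n0.
have := Binv u y v; rewrite (rootP vr yh) BZr lieC (rootP ur yh) BNl BZl => /eqP.
by rewrite eq_sym -subr_eq0 opprK -mulrDl addrC mulf_eq0 (negPf n0) => /eqP.
Qed.

(** Let [v] be a nonzero vector of the root space of [al]. Then [a] has weight [- al] modulo the
kernel of [B v], which is not all of [a] since [B] is nondegenerate, and
[weight_lift] produces a weight vector. *)
Lemma is_rootN al : is_root al -> is_root (- al).
Proof.
move=> [al0 /eqP r0].
have al'0 : - al <> 0 by move=> /eqP; rewrite oppr_eq0 => /eqP.
split=> // rN.
pose v := vpick (root_space al).
have vr : v \in root_space al by apply: memv_pick.
have v0 : v != 0 by rewrite vpick0.
have [U0 U0P] : exists U0 : {vspace a}, forall w, w \in U0 <-> B v w = 0.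
  apply: vspace_of_pred; first exact: B0r.
  by move=> k x y x0 y0; rewrite BDr BZr x0 y0 mulr0 addr0.
have [w0 /eqP w00] : exists w, B v w <> 0.
  by apply: contrapT => /forallNP nw; case/eqP: v0; apply: Bnd => w; apply: contrapT.
have vP y w : y \in h -> B v (lie y w) = - evalh al y * B v w.
  by move=> yh; rewrite -Binv lieC (rootP vr yh) BNl BZl mulNr.
(* Modulo [U0], the kernel of [B v], every vector has weight [- al]. *)
have [|||||w [_ wn0] wP] := @weight_lift K a h ch0 hsub hnil U0 fullv (fun y => - evalh al y) w0.
- by move=> y w yh /U0P w0'; apply/U0P; rewrite vP // w0' mulr0.
- by move=> *; apply: memvf.
- exact: memvf.
- by apply: contra w00 => /U0P ->.
- by move=> y yh; apply/U0P; rewrite BDr BNr BZr vP // subrr.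
have [be beE] := weight_root wn0 wP.
have -> : be = - al by apply: evalh_ext => y yh; rewrite beE // evalhN.
by rewrite rN memv0 (negPf wn0).
Qed.

(** A weight vector of [h] in [U] modulo [h :&: U] has weight zero, so it
normalizes [h]. *)
Lemma nil_sub_cartan (U : {vspace a}) : stable_under h U ->
  (forall y u, y \in h -> u \in U -> exists N, iter N (lie y) u = 0) -> (U <= h)%VS.
Proof.
move=> sU nU; apply/negPn/negP => /subvPn[u uU uh].
have sI : stable_under h (h :&: U)%VS.
  by move=> y w yh /memv_capP[wh wU]; apply/memv_capP; split; [apply: hsub | apply: sU].
have [|||mu [v [vU vI vP]]] := @weight_mod K a h ch0 hsub hnil (h :&: U)%VS U u sI sU.
- exact: capvSr.
- exact: uU.
- by rewrite memv_cap (negPf uh).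
have mu0 y : y \in h -> mu y = 0.
  move=> yh; have [N vN] := nU y v yh vU.
  have itE k : iter k (lie y) v - mu y ^+ k *: v \in (h :&: U)%VS.
    elim: k => [|k IHk]; first by rewrite scale1r subrr mem0v.
    have -> : iter k.+1 (lie y) v - mu y ^+ k.+1 *: v =
       lie y (iter k (lie y) v - mu y ^+ k *: v) + mu y ^+ k *: (lie y v - mu y *: v).
      by rewrite iterS lieDr lieNr lieZr scalerBr scalerA exprSr addrA subrK.
    by rewrite memvD ?sI // memvZ ?vP.
  have := itE N; rewrite vN sub0r memvN rpredZeq (negPf vI) orbF expf_eq0.
  by move=> /andP[_ /eqP].
case/negP: vI; rewrite memv_cap vU andbT; apply: hnorm => y yh.
rewrite lieC memvN; have := vP y yh; rewrite mu0 // scale0r subr0.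
by rewrite memv_cap => /andP[].
Qed.

Lemma nil_weight y v k : y \in h -> v \in h -> lie y v = k *: v -> lie y v = 0.
Proof.
move=> yh vh vy; have [N vN] := iter_lie_nil hnil yh vh.
have : k ^+ N *: v == 0.
  rewrite -vN; apply/eqP; elim: (N) => [|j IHj]; first by rewrite scale1r.
  by rewrite iterS -IHj lieZr vy scalerA exprSr.
rewrite scaler_eq0 expf_eq0 vy => /orP[/andP[_ /eqP ->]|/eqP ->].
  by rewrite scale0r.
by rewrite scaler0.
Qed.

Section Intertwiner.
Variables (Phi : seq (hdual h)) (x : hdual h -> a) (E : 'End(a)).
Hypotheses (PhiP : forall al, al \in Phi <-> is_root al).
Hypotheses (xroot : forall al, al \in Phi -> x al \in root_space al /\ x al != 0).
Hypotheses (Ead : forall y z, E (lie y z) = lie y (E z)) (Ex : forall al, al \in Phi -> E (x al) = 0).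

Let Eadl y z : E (lie y z) = lie (E y) z.
Proof. by rewrite lieC linearN /= Ead [RHS]lieC. Qed.

(** The image [J] of [E] is an ideal on which [E] is injective, as the kernel of [E] in it is
an abelian ideal. If [J] were not inside [h], it would contain a root vector [v'] of
some root [al]; since [E] kills [x al], the root [al] vanishes on [E h], and then
[al y * E v' = lie (E y) v' = 0] for every [y] in [h], so [E v' = 0]. Thus [J] lies in [h], and a
common eigenvector of [h] in [J] would be central. *)
Lemma intertwiner_eq0 u : E u = 0.
Proof.
pose J := limg E; have EJ w : E w \in J := memv_img E (memvf w).
(* The part of [J] killed by [E] is an abelian ideal. *)
have N0 w : w \in J -> E w = 0 -> w = 0.
  move=> wJ Ew; have NE : (J :&: lker E)%VS = 0%VS.
    apply: noab => [y v /memv_capP[/memv_imgP[v' _ ->]]|p q].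
      rewrite memv_ker => /eqP Ev; rewrite memv_cap -Ead EJ memv_ker.
      by rewrite !Ead Ev lie0r eqxx.
    move=> /memv_capP[/memv_imgP[p' _ ->] _] /memv_capP[_].
    by rewrite memv_ker => /eqP Eq; rewrite -Eadl Ead Eq lie0r.
  by apply/eqP; rewrite -memv0 -NE memv_cap wJ memv_ker Ew eqxx.
have itE k y z : iter k (lie y) (E z) = E (iter k (lie y) z).
  by elim: k => //= k ->; rewrite Ead.
have Eh z : z \in h -> E z \in h.
  move=> zh; suff /subvP : (E @: h <= h)%VS by apply; apply: memv_img.
  apply: nil_sub_cartan => [y _ yh /memv_imgP[w wh ->]|y _ yh /memv_imgP[w wh ->]].
    by rewrite -Ead memv_img // hsub.
  have [N wN] := iter_lie_nil hnil yh wh.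
  by exists N; rewrite itE wN linear0.
have sJ : stable_under h J by move=> y _ _ /memv_imgP[w _ ->]; rewrite -Ead.
have JP w : w \in J -> exists w', w = E w' by move=> /memv_imgP[w' _ ->]; exists w'.
have Jh : (J <= h)%VS.
  apply/negPn/negP => /subvPn[w wJ wh].
  have sI : stable_under h (h :&: J)%VS.
    by move=> y v yh /memv_capP[vh vJ]; apply/memv_capP; split; [apply: hsub | apply: sJ].
  have [|||mu [v [vJ vI vP]]] := @weight_mod K a h ch0 hsub hnil (h :&: J)%VS J w sI sJ.
  - exact: capvSr.
  - exact: wJ.
  - by rewrite memv_cap (negPf wh).
  have [mu0|] := pselect (forall y, y \in h -> mu y = 0).
    case/negP: vI; rewrite memv_cap vJ andbT; apply: hnorm => y yh.
    rewrite lieC memvN; have := vP y yh; rewrite mu0 // scale0r subr0.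
    by rewrite memv_cap => /andP[].
  move=> /existsNP[y0 /not_implyP[y0h muy0]].
  have [v' [v'J v'0] v'P] := weight_lift ch0 hsub hnil sI sJ vJ vI vP.
  have [al alE v'r] := weight_root v'0 v'P.
  have alPhi : al \in Phi.
    apply/PhiP; split=> [al0|r0].
      by apply: muy0; rewrite -alE // al0 /evalh zero_lfunE.
    by case/eqP: v'0; apply/eqP; rewrite -memv0 -r0.
  have [xr x0] := xroot alPhi.
  have alE0 z : z \in h -> evalh al (E z) = 0.
    move=> zh; apply/eqP; have : evalh al (E z) *: x al == 0.
      by rewrite -(rootP xr (Eh _ zh)) -Eadl (rootP xr zh) linearZ /= Ex // scaler0.
    by rewrite scaler_eq0 (negPf x0) orbF.
  case/eqP: v'0; apply: N0 => //; apply/eqP.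
  have : evalh al y0 *: E v' == 0.
    by rewrite -linearZ /= -(rootP v'r y0h) Eadl (rootP v'r (Eh _ y0h)) alE0 // scale0r.
  by rewrite scaler_eq0 alE // => /orP[/eqP/muy0|].
apply: contrapT => /eqP Eu0.
have [||||mu [v [vJ v0 vP]]] := @weight_mod K a h ch0 hsub hnil 0%VS J (E u) _ sJ.
- by move=> y w _; rewrite memv0 => /eqP ->; rewrite lie0r mem0v.
- exact: sub0v.
- exact: EJ.
- by rewrite memv0.
rewrite memv0 in v0.
have {}vP y : y \in h -> lie y v = 0.
  move=> yh; apply: (nil_weight (k := mu y)) => //; first exact: subvP Jh _ vJ.
  by apply/eqP; have := vP y yh; rewrite memv0 subr_eq0.
case/eqP: v0; apply: central0 => y; have [v' v'E] := JP v vJ.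
apply: N0; first by rewrite v'E -Eadl.
by rewrite Ead lieC vP ?oppr0 // (subvP Jh).
Qed.
End Intertwiner.

Definition contr (A : tens a a) (y : a) : a := tlift (fun u v => B u y *: v) A.

Lemma contr_linA y : linear (fun A => contr A y). Proof. exact: lift_is_linear. Qed.

Lemma contrE u v y : contr (tensor u v) y = B u y *: v.
Proof.
rewrite /contr lift_tensor // => [w k p q|w k p q].
  by rewrite BDl BZl scalerDl scalerA.
by rewrite scalerDr !scalerA mulrC.
Qed.

Lemma contrD A A' y : contr (A + A') y = contr A y + contr A' y.
Proof. by have := contr_linA y 1 A A'; rewrite !scale1r. Qed.
Lemma contr0 y : contr 0 y = 0.
Proof. by apply: (addrI (contr 0 y)); rewrite -contrD !addr0. Qed.
Lemma contrN A y : contr (- A) y = - contr A y.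
Proof. by apply: (addrI (contr A y)); rewrite -contrD !subrr contr0. Qed.
Lemma contr_sum I (r : seq I) (P : pred I) (F : I -> tens a a) y :
  contr (\sum_(i <- r | P i) F i) y = \sum_(i <- r | P i) contr (F i) y.
Proof. exact: (big_morph (contr^~ y) (fun A A' => contrD A A' y) (contr0 y)). Qed.

Lemma contr_linear A : linear (contr A).
Proof.
move=> k y z; move: A; apply: tens_lin_ext => [l A A'|l A A'|u v].
- exact: contr_linA.
- by rewrite !contr_linA; modring.
by rewrite !contrE BDr BZr scalerDl scalerA.
Qed.

Lemma contrZr A k y : contr A (k *: y) = k *: contr A y.
Proof.
have e0 : contr A 0 = 0.
  by apply: (addrI (contr A 0)); have := contr_linear A 1 0 0; rewrite scaler0 !addr0 scale1r => <-.
by have := contr_linear A k y 0; rewrite e0 !addr0.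
Qed.

Lemma contr_ad2 A z y : contr (ad2 z A) y = lie z (contr A y) - contr A (lie z y).
Proof.
move: A; apply: tens_lin_ext => [l A A'|l A A'|u v].
- by rewrite linearP contr_linA.
- by rewrite !contr_linA lie_is_linearr; modring.
by rewrite ad2E contrD !contrE lieZr -Binv (lieC u) BNl scaleNr opprK addrC.
Qed.

Lemma contr_swap A y z : B (contr A y) z = B y (contr (tswap A) z).
Proof.
move: A; apply: (@tens_lin_ext _ _ _ K^o (fun A => B (contr A y) z) (fun A => B y (contr (tswap A) z))).
- by move=> l A A'; rewrite contr_linA BDl BZl.
- by move=> l A A'; rewrite linearP contr_linA BDr BZr.
by move=> u v; rewrite tswapE !contrE BZl BZr mulrC (BC u).
Qed.

(** * The kernel of a Belavin-Drinfeld cobracket *)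

Section BelavinDrinfeldMatrix.
Variables (Phi Delta : seq (hdual h)) (G1 G2 : seq (hdual h)) (tau : hdual h -> hdual h).
Variables (r0 : tens a a) (x : hdual h -> a).
Hypotheses (RS : root_system Phi) (SR : simple_roots Phi Delta).
Hypotheses (BDT : BD_triple B Delta G1 G2 tau) (r0h : r0 \in tens_sub h h).
Hypothesis RV : root_vectors B Phi x.
Local Notation rho := (BD_rmatrix_of Phi Delta G1 G2 tau r0 x).
Hypothesis rho_inv : forall z, ad2 z (rho + tswap rho) = 0.

Let pos al := positive Phi Delta al.
Let prec al be := BD_prec Phi Delta G1 G2 tau al be.
Let Phi_uniq : uniq Phi. Proof. by case: RS. Qed.
Let PhiP al : al \in Phi <-> is_root al. Proof. by case: RS => _; apply. Qed.
Let PhiN al : al \in Phi -> - al \in Phi.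
Proof. by move=> /PhiP/is_rootN/PhiP. Qed.
Let Phi0 al : al \in Phi -> al <> 0. Proof. by move=> /PhiP[]. Qed.
Let xr al : al \in Phi -> x al \in root_space al. Proof. by move=> /RV[]. Qed.
Let xB al : al \in Phi -> B (x al) (x (- al)) = 1. Proof. by move=> /RV[]. Qed.
Let x0 al : al \in Phi -> x al != 0.
Proof.
move=> alP; apply/negP => /eqP e; have := xB alP; rewrite e B0l => /esym/eqP.
by rewrite oner_eq0.
Qed.

Lemma B_xx al be : al \in Phi -> be \in Phi -> B (x (- al)) (x be) = (al == be)%:R.
Proof.
move=> alP beP; case: eqP => [->|ne]; first by rewrite BC xB.
rewrite (B_root_root (xr (PhiN alP)) (xr beP)) // => /eqP.
by rewrite addrC subr_eq0 => /eqP e; apply: ne.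
Qed.

Lemma B_hx z al : z \in h -> al \in Phi -> B z (x al) = 0.
Proof. by move=> zh alP; apply: B_h_root (xr alP) => //; apply: Phi0. Qed.

Lemma coord_Delta al (c : hdual h -> K) : al = \sum_(ga <- Delta) c ga *: ga ->
  forall i : 'I_(size Delta), coord (in_tuple Delta) i al = c Delta`_i.
Proof.
have fD : free Delta by case: SR.
move=> ->; move=> i; rewrite (big_nth 0) big_mkord.
by rewrite (coord_sum_free (X := in_tuple Delta)).
Qed.

Lemma nonneg_not_both al : al \in Phi -> nonneg_comb Delta al -> ~ nonneg_comb Delta (- al).
Proof.
move=> alP [c cE] [c' c'E]; apply: (Phi0 alP).
have e1 i := coord_Delta (c := fun ga => (c ga)%:R) (etrans cE (eq_bigr _ (fun ga _ => esym (scaler_nat _ _)))) i.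
have e2 i := coord_Delta (c := fun ga => (c' ga)%:R) (etrans c'E (eq_bigr _ (fun ga _ => esym (scaler_nat _ _)))) i.
rewrite cE big_seq big1 // => ga gaD.
pose i := Ordinal (etrans (index_mem ga Delta) gaD).
have := e2 i; rewrite linearN /= e1 => /eqP; rewrite eq_sym -subr_eq0 opprK -natrD.
by rewrite char0_natr_eq0 // addn_eq0 nth_index // => /andP[_ /eqP ->]; rewrite mulr0n.
Qed.

Lemma pos_or_neg al : al \in Phi -> pos al \/ pos (- al).
Proof.
move=> alP; case: SR => _ _ /(_ al alP) [nn|nn]; [left|right]; split=> //.
exact: PhiN.
Qed.

Lemma posN al : pos al -> ~ pos (- al).
Proof. by move=> [alP nn] [_]; apply: nonneg_not_both. Qed.

Lemma tens_sub_ind (P : tens a a -> Prop) A : P 0 ->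
  (forall k A A', P A -> P A' -> P (k *: A + A')) ->
  (forall u v, u \in h -> v \in h -> P (tensor u v)) -> A \in tens_sub h h -> P A.
Proof.
move=> P0 PD Pt; rewrite /tens_sub; set X := [seq _ | _ <- _, _ <- _] => AX.
rewrite (coord_span (AX : A \in <<in_tuple X>>%VS)).
apply: (big_ind P) => // [u v Pu Pv|i _].
  by rewrite -[u]scale1r; apply: PD.
rewrite -[_ *: _]addr0; apply: PD => //.
have /allpairsP[[u v] /= [uU vV ->]] : X`_i \in X by apply: mem_nth.
by apply: Pt; apply: vbasis_mem.
Qed.

Lemma contr_r0_h y : contr r0 y \in h /\ contr (tswap r0) y \in h.
Proof.
apply: (tens_sub_ind (P := fun A => contr A y \in h /\ contr (tswap A) y \in h)) r0h
  => [|k A A' [Ah A'h] [A1 A1']|u v uh vh].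
- by rewrite linear0 contr0 !mem0v.
- by rewrite linearP !contr_linA !memvD ?memvZ.
by rewrite tswapE !contrE !memvZ.
Qed.

Lemma contr_r0_x al : al \in Phi -> contr r0 (x al) = 0 /\ contr (tswap r0) (x al) = 0.
Proof.
move=> alP.
apply: (tens_sub_ind (P := fun A => contr A (x al) = 0 /\ contr (tswap A) (x al) = 0)) r0h
  => [|k A A' [Ah A'h] [A1 A1']|u v uh vh].
- by rewrite linear0 contr0.
- by rewrite linearP !contr_linA Ah A'h A1 A1' scaler0 addr0.
by rewrite tswapE !contrE !B_hx // !scale0r.
Qed.

Lemma contr_sym y : contr (rho + tswap rho) y = contr (r0 + tswap r0) y +
  \sum_(al <- Phi | `[< pos al >]) (B (x (- al)) y *: x al + B (x al) y *: x (- al)).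
Proof.
have -> : rho + tswap rho = (r0 + tswap r0) +
    \sum_(al <- Phi | `[< pos al >]) (tensor (x (- al)) (x al) + tensor (x al) (x (- al))).
  rewrite /BD_rmatrix_of !linearD /=.
  set S1 := \sum_(al <- Phi | _) _; set S2 := \sum_(al <- Phi | _) \sum_(be <- Phi | _) _.
  have -> : tswap S2 = - S2.
    rewrite /S2 linear_sum -sumrN; apply: eq_bigr => al _.
    rewrite linear_sum -sumrN; apply: eq_bigr => be _.
    by rewrite linearB /= !tswapE opprB.
  have -> : \sum_(al <- Phi | `[< pos al >]) (tensor (x (- al)) (x al) + tensor (x al) (x (- al))) = S1 + tswap S1.
    rewrite big_split /=; congr (_ + _); rewrite /S1 linear_sum; apply: eq_bigr => al _.
    by rewrite /= tswapE.
  by modring.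
rewrite contrD contr_sum; congr (_ + _); apply: eq_bigr => al _.
by rewrite contrD !contrE.
Qed.

Lemma sum_Phi_pick (P : hdual h -> Prop) (F : hdual h -> a) ga : ga \in Phi -> P ga ->
  \sum_(al <- Phi | `[< P al >]) (al == ga)%:R *: F al = F ga.
Proof.
move=> gaP Pga; rewrite big_mkcond (bigD1_seq ga) //= eqxx scale1r big1 ?addr0.
  by case: asboolP.
by move=> al /negPf ->; rewrite scale0r; case: asboolP.
Qed.

Lemma sum_Phi_none (P : hdual h -> Prop) (F : hdual h -> a) ga : ~ P ga ->
  \sum_(al <- Phi | `[< P al >]) (al == ga)%:R *: F al = 0.
Proof.
move=> Pga; rewrite big1 // => al /asboolP Pal; case: eqP => [e|]; last by rewrite scale0r.
by case: Pga; rewrite -e.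
Qed.

Lemma contr_sym_x ga : ga \in Phi -> contr (rho + tswap rho) (x ga) = x ga.
Proof.
move=> gaP; rewrite contr_sym contrD; have [-> ->] := contr_r0_x gaP.
rewrite addr0 add0r big_split /=.
have -> : \sum_(al <- Phi | `[< pos al >]) B (x (- al)) (x ga) *: x al =
          \sum_(al <- Phi | `[< pos al >]) (al == ga)%:R *: x al.
  by apply: eq_bigr => al /asboolP[alP _]; rewrite B_xx.
have -> : \sum_(al <- Phi | `[< pos al >]) B (x al) (x ga) *: x (- al) =
          \sum_(al <- Phi | `[< pos al >]) (al == - ga)%:R *: x (- al).
  by apply: eq_bigr => al /asboolP[alP _]; rewrite -{1}[al]opprK B_xx ?PhiN // eqr_oppLR.
have [pg|ng] := pos_or_neg gaP.
  by rewrite sum_Phi_pick // sum_Phi_none ?addr0 //; apply: posN.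
rewrite sum_Phi_none => [|pg]; last exact: posN pg ng.
by rewrite (sum_Phi_pick (fun al => x (- al))) ?PhiN // opprK add0r.
Qed.

(** The difference with the identity commutes with [ad] and kills the root vectors
[x al]. *)
Lemma contr_sym_id y : contr (rho + tswap rho) y = y.
Proof.
pose q := contr (rho + tswap rho).
have ql : linear (fun y => q y - y).
  by move=> k u v; rewrite /q contr_linear; modring.
pose lq : {linear a -> a} := HB.pack (fun y => q y - y) (GRing.isLinear.Build _ _ _ _ _ ql).
have qE z : linfun lq z = q z - z by rewrite lfunE.
apply/eqP; rewrite -subr_eq0 -/(q y) -qE; apply/eqP.
apply: (intertwiner_eq0 (x := x) PhiP) => [al alP|u v|al alP].
- by split; [exact: xr | exact: x0].
- rewrite !qE lieDr lieNr; congr (_ - _); apply/eqP; rewrite eq_sym -subr_eq0.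
  by rewrite -contr_ad2 rho_inv contr0.
by rewrite qE /q contr_sym_x // subrr.
Qed.

Lemma root_decomp y : exists2 z, z \in h & y = z +
  \sum_(al <- Phi | `[< pos al >]) (B (x (- al)) y *: x al + B (x al) y *: x (- al)).
Proof.
exists (contr (r0 + tswap r0) y); last by rewrite -contr_sym contr_sym_id.
by rewrite contrD memvD //; have [] := contr_r0_h y.
Qed.

Lemma commutes_roots_central v : (forall z, z \in h -> lie v z = 0) ->
  (forall al, al \in Phi -> lie v (x al) = 0) -> v = 0.
Proof.
move=> vh vx; apply: central0 => y; have [z zh ->] := root_decomp y.
rewrite lieDr vh // lie_sumr big1 ?addr0 // => al /asboolP[alP _].
by rewrite lieDr !lieZr !vx ?PhiN // !scaler0 addr0.
Qed.

(** A common eigenvector of [h] in the derived algebra of [h] commutes with [h], and it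
commutes with root vectors because each root vanishes on brackets of [h]; so it is
central. *)
Lemma cartan_abelian y z : y \in h -> z \in h -> lie y z = 0.
Proof.
move=> yh zh; apply: contrapT => /eqP yz0.
have subh : (liev h h <= h)%VS by apply: liev_sub.
have [|||||mu [v [vU v0 vP]]] := @weight_mod K a h ch0 hsub hnil 0%VS (liev h h) (lie y z).
- by move=> y' w _; rewrite memv0 => /eqP ->; rewrite lie0r mem0v.
- by move=> y' w y'h wU; rewrite mem_liev // (subvP subh).
- exact: sub0v.
- exact: mem_liev.
- by rewrite memv0.
rewrite memv0 in v0; case/eqP: v0; apply: commutes_roots_central => [u uh|al alP].
  apply/eqP; rewrite lieC oppr_eq0; apply/eqP; apply: (nil_weight (k := mu u)) => //.
    exact: subvP subh _ vU.
  by apply/eqP; have := vP u uh; rewrite memv0 subr_eq0.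
have /lievP[r [rP ->]] := vU.
rewrite lie_suml big_seq big1 // => uv /rP[uh vh].
have := lie_leibniz uv.1 uv.2 (x al).
rewrite (rootP (xr alP) vh) (rootP (xr alP) uh) !lieZr (rootP (xr alP) vh) (rootP (xr alP) uh).
rewrite !scalerA mulrC.
by move/eqP; rewrite -subr_eq subrr eq_sym => /eqP.
Qed.

Let t ga := lie (x ga) (x (- ga)).

Lemma t_h ga : ga \in Phi -> t ga \in h.
Proof.
move=> gaP; apply: hnorm => u uh; rewrite lieC memvN /t lie_leibniz.
rewrite (rootP (xr gaP) uh) (rootP (xr (PhiN gaP)) uh) lieZl lieZr evalhN scaleNr subrr.
exact: mem0v.
Qed.

Lemma B_t ga z : ga \in Phi -> z \in h -> B (t ga) z = evalh ga z.
Proof.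
move=> gaP zh; rewrite /t Binv lieC (rootP (xr (PhiN gaP)) zh) evalhN scaleNr opprK.
by rewrite BZr xB // mulr1.
Qed.

(** If [ga] vanished on [t ga], then [t ga] would commute with [x ga] and [x (- ga)]. On
the eigenspace of [t ga] through a root vector of [de] these two operators satisfy
the Heisenberg relation with constant [de (t ga)], so every root vanishes on [t ga], which is then
central, contradicting [B_t]. *)
Lemma root_t_neq0 ga : ga \in Phi -> evalh ga (t ga) != 0.
Proof.
move=> gaP; apply/negP => /eqP g0; have th := t_h gaP.
have tx : lie (t ga) (x ga) = 0 by rewrite (rootP (xr gaP)) // g0 scale0r.
have txN : lie (t ga) (x (- ga)) = 0.
  by rewrite (rootP (xr (PhiN gaP))) // evalhN g0 oppr0 scale0r.
suff t0 : t ga = 0.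
  have [y yh] := evalh_neq0 (Phi0 gaP); rewrite -B_t // t0 B0l eqxx //.
apply: commutes_roots_central => [z zh|de deP]; first exact: cartan_abelian.
suff de0 : evalh de (t ga) = 0 by rewrite (rootP (xr deP)) // de0 scale0r.
have [U UP] : exists U : {vspace a}, forall w, w \in U <-> lie (t ga) w = evalh de (t ga) *: w.
  apply: vspace_of_pred; first by rewrite lie0r scaler0.
  by move=> k u w uE wE; rewrite lie_is_linearr uE wE scalerDr !scalerA mulrC.
have UL y : lie (t ga) y = 0 -> forall u, u \in U -> lie y u \in U.
  move=> ty u /UP uE; apply/UP.
  by rewrite lie_leibniz ty lie0l add0r uE lieZr.
have s0 (y : a) : forall u : a, u \in 0%VS -> lie y u \in 0%VS.
  by move=> u; rewrite memv0 => /eqP ->; rewrite lie0r mem0v.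
apply: (@heisenberg K a (lie (x ga)) (lie (x (- ga))) 0%VS U (evalh de (t ga)) ch0
  (@lie_is_linearr _ a (x ga)) (@lie_is_linearr _ a (x (- ga)))
  (s0 _) (UL _ tx) (s0 _) (UL _ txN) _ (x de)).
- move=> u /UP uE; rewrite (lie_leibniz (x ga)) addrK -/(t ga) uE subrr.
  exact: mem0v.
- by apply/UP; rewrite (rootP (xr deP)).
by rewrite memv0 x0.
Qed.

(** Let [w = lie H (x ga)]. Since [w] is orthogonal to every [x al] with [S al], in
the root decomposition of [w] only the component in [h] contributes to [B w w], and invariance
of [B] computes this contribution as a multiple of [ga (t ga)] by the square of [B H (x ga)]. *)
Lemma isotropic_root_coord (H : a) (S : hdual h -> Prop) (W : a -> Prop) :
  (forall al, al \in Phi -> S al \/ S (- al)) ->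
  (forall al, al \in Phi -> S al -> W (x al)) ->
  (forall u v, W u -> W v -> B u v = 0) -> (forall u, W u -> W (lie H u)) ->
  forall ga, ga \in Phi -> S ga -> B H (x ga) = 0.
Proof.
move=> SS WS Wiso WH ga gaP Sga.
pose w := lie H (x ga); have Ww : W w by apply/WH/WS.
have wS al : al \in Phi -> S al -> B (x al) w = 0 by move=> alP Sal; apply: Wiso => //; apply: WS.
have [z zh wE] := root_decomp w.
have wh z' : z' \in h -> B w z' = - (evalh ga z' * B H (x ga)).
  by move=> z'h; rewrite /w Binv lieC BNr (rootP (xr gaP)) // BZr.
have th := t_h gaP.
have tz : B (t ga) z = B (t ga) w.
  rewrite [in RHS]wE BDr Bsumr big1 ?addr0 // => al /asboolP[alP _].
  by rewrite BDr !BZr !B_hx ?PhiN // !mulr0 addr0.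
have : B w w = 0 by apply: Wiso.
rewrite {2}wE BDr Bsumr big1 => [|al /asboolP[alP _]]; last first.
  rewrite BDr !BZr (BC w (x al)) (BC w (x (- al))) mulrC -mulrDl.
  by have [/(wS _ alP) ->|/(wS _ (PhiN alP)) ->] := SS _ alP; ring.
rewrite addr0 wh // -B_t // tz BC wh // => /eqP.
rewrite oppr_eq0 mulNr oppr_eq0 -mulrA !mulf_eq0 (negPf (root_t_neq0 gaP)) /= orbb.
by move/eqP.
Qed.

Lemma char0_natr_inj (m n : nat) : m%:R = n%:R :> K -> m = n.
Proof.
wlog le : m n / (m <= n)%N.
  by move=> W e; have [le|/ltnW le] := leqP m n; [apply: W | apply/esym/W].
move=> e; apply/eqP; rewrite eqn_leq le -subn_eq0 -(char0_natr_eq0 ch0) natrB //.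
by rewrite e subrr eqxx.
Qed.

(** Used as an induction principle: to put [v] in the generalized kernel of [T] it suffices to
put [T v] there. *)
Lemma gen_kernel (V : vectType K) (T : V -> V) : linear T ->
  exists U : {vspace V}, (forall v, v \in U <-> exists N, iter N T v = 0) /\
    forall v, T v \in U -> v \in U.
Proof.
move=> Tl; have itD N c p q : iter N T (c *: p + q) = c *: iter N T p + iter N T q.
  by elim: N => //= N ->; rewrite Tl.
have it0 N : iter N T 0 = 0.
  by have := itD N 1 0 0; rewrite scaler0 addr0 scale1r -{1}[iter N T 0]addr0 => /addrI.
have it_le N N' p : (N <= N')%N -> iter N T p = 0 -> iter N' T p = 0.
  by move=> le e; rewrite -(subnK le) iterD e it0.
have [U UP] : exists U : {vspace V}, forall v, v \in U <-> exists N, iter N T v = 0.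
  apply: vspace_of_pred; first by exists 0%N.
  move=> c p q [N pN] [N' qN']; exists (maxn N N').
  by rewrite itD (it_le _ _ _ (leq_maxl _ _) pN) (it_le _ _ _ (leq_maxr _ _) qN') scaler0 addr0.
by exists U; split=> // v /UP[N vN]; apply/UP; exists N.+1; rewrite iterSr.
Qed.

Local Notation P := (contr rho).

Lemma contr_swap_rho y : contr (tswap rho) y = y - P y.
Proof. by rewrite -{2}(contr_sym_id y) contrD addrAC subrr add0r. Qed.

(** The adjoint of the operator of [rho] is that of [tswap rho], which is [1 - P]. *)
Lemma B_P v w : B (P v) w + B v (P w) = B v w.
Proof. by rewrite contr_swap contr_swap_rho BDr BNr subrK. Qed.

Lemma contr_rho y : P y = contr r0 y
  + \sum_(al <- Phi | `[< pos al >]) B (x (- al)) y *: x al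
  + \sum_(al <- Phi | `[< pos al >])
      \sum_(be <- Phi | `[< prec al be >]) (B (x (- al)) y *: x be - B (x be) y *: x (- al)).
Proof.
rewrite /BD_rmatrix_of !contrD !contr_sum; congr (_ + _ + _).
  by apply: eq_bigr => al _; rewrite contrE.
apply: eq_bigr => al _; rewrite contr_sum; apply: eq_bigr => be _.
by rewrite contrD contrN !contrE.
Qed.

Lemma prec_pos al be : prec al be -> pos al /\ pos be.
Proof. by move=> [[? _] [? _] _]. Qed.

Lemma P_pos ga : pos ga -> P (x ga) = x ga + \sum_(be <- Phi | `[< prec ga be >]) x be.
Proof.
move=> pg; have gaP : ga \in Phi by case: pg.
rewrite contr_rho; have [-> _] := contr_r0_x gaP; rewrite add0r; congr (_ + _).
  rewrite -[RHS](sum_Phi_pick (P := pos) x gaP pg).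
  by apply: eq_bigr => al /asboolP[alP _]; rewrite B_xx.
rewrite -[RHS](sum_Phi_pick (P := pos) (fun al => \sum_(be <- Phi | `[< prec al be >]) x be) gaP pg).
apply: eq_bigr => al /asboolP[alP _]; rewrite scaler_sumr; apply: eq_bigr => be /asboolP.
move=> /prec_pos[_ pb]; have beP : be \in Phi by case: pb.
have e0 : B (x be) (x ga) = 0.
  rewrite -[be]opprK B_xx ?PhiN //; case: eqP => // e.
  by case: (posN pb); rewrite e.
by rewrite e0 scale0r subr0 B_xx.
Qed.

Lemma P_neg ga : pos ga -> P (x (- ga)) =
  - \sum_(al <- Phi | `[< pos al >]) (if `[< prec al ga >] then x (- al) else 0).
Proof.
move=> pg; have gaP : ga \in Phi by case: pg.
rewrite contr_rho; have [-> _] := contr_r0_x (PhiN gaP); rewrite add0r big1 => [|al /asboolP pal].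
  rewrite add0r -sumrN; apply: eq_bigr => al /asboolP pal.
  have alP : al \in Phi by case: pal.
  have e0 : B (x (- al)) (x (- ga)) = 0.
    rewrite B_xx ?PhiN //; case: eqP => // e.
    by case: (posN pg); rewrite -e.
  rewrite [LHS](eq_bigr (fun be => - ((be == ga)%:R *: x (- al)))) => [|be /asboolP/prec_pos[_ [beP _]]].
    rewrite sumrN; congr (- _); case: asboolP => [pag|npag].
      by rewrite (sum_Phi_pick (P := prec al) (fun=> x (- al))).
    by rewrite (sum_Phi_none (P := prec al) (fun=> x (- al))).
  by rewrite e0 scale0r sub0r BC B_xx // eq_sym.
have alP : al \in Phi by case: pal.
rewrite B_xx ?PhiN //; case: eqP => [e|_]; last by rewrite scale0r.
by case: (posN pg); rewrite -e.
Qed.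

(** Give a simple root [ga] the weight [e ga], the number of times [tau] can be applied to it
within [G1], and extend additively. One application of [tau] to a root in the span of [G1]
lowers the weight by the height of the root, which is positive and invariant under [tau]. *)
Lemma prec_measure : exists m : hdual h -> nat, forall al be, prec al be -> (m be < m al)%N.
Proof.
have [[uG1 uG2 G1D G2D] [tau_inj tauG2] _ exitG] := BDT.
have [fD _ _] := SR.
(* [e al] is the first time at which the orbit of [al] under [tau] is outside [G1]. *)
have /choice[e eP] : forall al, exists k,
    (forall j, (j < k)%N -> iter j tau al \in G1) /\ iter k tau al \notin G1.
  move=> al; have [/exitG[n [_ nG _ nnG]]|] := boolP (al \in G1); first by exists n.
  by exists 0%N.
have eS al : al \in G1 -> e al = (e (tau al)).+1.
  move=> alG; have [lo hi] := eP al; have [lo' hi'] := eP (tau al).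
  apply/eqP; rewrite eqn_leq; apply/andP; split; rewrite leqNgt; apply/negP => lt.
    by case/negP: hi'; rewrite -iterSr lo.
  case/negP: hi; case: (e al) lt => [|k] lt //; rewrite iterSr lo' //.
have functional (F : hdual h -> K) : exists L : 'Hom(hdual h, K^o), {in Delta, forall ga, L ga = F ga}.
  have [L LP] := linear_of_free Delta [seq (F ga : K^o) | ga <- Delta].
  have /= LE := LP fD (size_map _ _); exists (linfun L) => ga gaD.
  by rewrite lfunE /=; have /eq_in_map := LE; apply.
have [psi psiD] := functional (fun ga => (e ga)%:R).
have [ht htD] := functional (fun=> 1).
have tauD ga : ga \in G1 -> tau ga \in Delta.
  by move=> gaG; apply: G2D; rewrite -tauG2; apply: map_f.
have step s s' : tau_additive G1 tau s s' -> psi s = psi s' + ht s /\ ht s' = ht s.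
  move=> [c [-> ->]].
  have e1 := hom_sumMz psi G1 id c; have e2 := hom_sumMz psi G1 tau c.
  have e3 := hom_sumMz ht G1 id c; have e4 := hom_sumMz ht G1 tau c.
  rewrite e1 e2 e3 e4 -big_split {e1 e2 e3 e4}.
  split; rewrite big_seq [RHS]big_seq; apply: eq_bigr => ga gaG /=.
    by rewrite !psiD ?htD ?tauD ?G1D // eS // -mulrzDl natr1.
  by rewrite !htD ?tauD ?G1D.
have natE al (c : hdual h -> nat) : al = \sum_(ga <- Delta) ga *+ c ga ->
    psi al = (\sum_(ga <- Delta) c ga * e ga)%:R /\ ht al = (\sum_(ga <- Delta) c ga)%:R.
  move=> ->; rewrite (hom_sumMn psi) (hom_sumMn ht) !natr_sum.
  split; rewrite big_seq [RHS]big_seq; apply: eq_bigr => ga gaD.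
    by rewrite psiD // mulnC natrM mulr_natr.
  by rewrite htD.
have /choice[m mP] : forall al, exists p : nat, pos al -> psi al = p%:R.
  move=> al; have [[_ [c /natE[cE _]]]|np] := pselect (pos al); last by exists 0%N.
  by exists (\sum_(ga <- Delta) c ga * e ga)%N.
have posh al : pos al -> exists2 q : nat, (0 < q)%N & ht al = q%:R.
  move=> [alP [c cE]]; have [_ hE] := natE _ _ cE.
  exists (\sum_(ga <- Delta) c ga)%N => //; rewrite lt0n; apply/negP => /eqP c0.
  apply: (Phi0 alP); rewrite cE big_seq big1 // => ga gaD.
  by move/eqP: c0; rewrite sum_nat_seq_eq0 => /allP/(_ ga gaD)/eqP ->.
exists m => al be pab; have [pal pbe] := prec_pos pab.
have [_ _ [n [s [n0 sal sbe st]]]] := pab.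
have [q q0 hq] := posh al pal.
have sk k : (k <= n)%N -> psi al = psi (s k) + ht al *+ k /\ ht (s k) = ht al.
  elim: k => [|k IHk] kn; first by rewrite sal addr0.
  have [-> hk] := IHk (ltnW kn); have [-> hk'] := step _ _ (st k kn).
  by rewrite hk' hk -addrA mulrS.
have [] := sk n (leqnn n); rewrite sbe mP // mP // hq -mulrnA -natrD => /char0_natr_inj -> _.
by rewrite -[X in (X < _)%N]addn0 ltn_add2l muln_gt0 q0.
Qed.

Lemma pos_gen_kernel ga : pos ga -> exists N, iter N (fun y => P y - y) (x ga) = 0.
Proof.
have [m mP] := prec_measure.
have Tl : linear (fun y => P y - y) by move=> k u v; rewrite contr_linear; modring.
have [U [UP UT]] := gen_kernel Tl.
move=> pga; apply/UP; have [k] := ubnP (m ga); elim: k ga pga => // k IHk ga pga lek.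
apply: UT; rewrite P_pos // addrC addKr; apply: memv_suml => be /asboolP pab.
have [_ pbe] := prec_pos pab; apply: IHk => //.
exact: leq_trans (mP _ _ pab) _.
Qed.

Lemma neg_gen_kernel ga : pos ga -> exists N, iter N P (x (- ga)) = 0.
Proof.
have [m mP] := prec_measure.
have [U [UP UT]] := gen_kernel (contr_linear rho).
move=> pga; apply/UP; pose M := (\sum_(al <- Phi) m al)%N.
have mM al : al \in Phi -> (m al <= M)%N.
  by move=> alP; rewrite /M (big_rem al) //= leq_addr.
have [k] := ubnP (M - m ga)%N; elim: k ga pga => // k IHk ga pga lek.
apply: UT; rewrite P_neg // memvN; apply: memv_suml => al /asboolP pal.
case: asboolP => [pag|_]; last exact: mem0v.
apply: IHk => //; have lt := mP _ _ pag; have [alP _] := pal.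
by rewrite ltnS in lek; apply: leq_trans lek; rewrite ltn_sub2l // (leq_trans lt) ?mM.
Qed.

(** [T] acts on the values of [B] by multiplication by the nonzero [c], so
[iter_leibniz] makes [c ^+ n * B u v] vanish for large [n]. *)
Lemma gen_kernel_isotropic (T : a -> a) (c : K) u v : c != 0 ->
  (forall p q, B (T p) q + B p (T q) = c * B p q) ->
  (exists N, iter N T u = 0) -> (exists N, iter N T v = 0) -> B u v = 0.
Proof.
move=> c0 TB [N uN] [N' vN].
have TL p q : c * B p q = B (T p) q + B p (T q) by rewrite TB.
have /= := @iter_leibniz _ _ K^o (fun p q => B p q) T T (fun k => c * k) N N' u v B0r B0l
  (mulrDr c) TL uN vN.
have -> n : iter n (fun k : K^o => c * k) (B u v) = c ^+ n * B u v.
  by elim: n => [|n IHn] /=; rewrite ?mul1r // IHn exprS mulrA.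
by move/eqP; rewrite mulf_eq0 expf_eq0 (negPf c0) andbF => /eqP.
Qed.

Lemma gen_kernel_ad (T : a -> a) (H : a) u : (forall y, T (lie H y) = lie H (T y)) ->
  (exists N, iter N T u = 0) -> exists N, iter N T (lie H u) = 0.
Proof.
move=> TH [N uN]; exists N.
have -> n : iter n T (lie H u) = lie H (iter n T u) by elim: n => //= n ->; rewrite TH.
by rewrite uN lie0r.
Qed.

(** [isotropic_root_coord] is applied to the generalized eigenspaces of [P]: the one for 1
contains the positive root vectors, the one for 0 the negative ones. *)
Lemma ad2_rho_ker_cartan H : ad2 H rho = 0 -> H \in h.
Proof.
move=> Hrho; have PH y : P (lie H y) = lie H (P y).
  by apply/eqP; rewrite eq_sym -subr_eq0 -contr_ad2 Hrho contr0.
have Bpos ga : pos ga -> B H (x ga) = 0.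
  move=> pga; have gaP : ga \in Phi by case: pga.
  apply: (isotropic_root_coord (S := pos) (W := fun w => exists N, iter N (fun y => P y - y) w = 0))
    => // [al alP|al _|u v|u].
  - exact: pos_or_neg.
  - exact: pos_gen_kernel.
  - apply: (gen_kernel_isotropic (c := -1)); first by rewrite oppr_eq0 oner_neq0.
    by move=> p q; rewrite !BDl !BDr !BNl !BNr addrACA B_P addrA subrr add0r mulN1r.
  by apply: gen_kernel_ad => y; rewrite PH lieDr lieNr.
have Bneg ga : pos (- ga) -> B H (x ga) = 0.
  move=> pga; have gaP : ga \in Phi by rewrite -[ga]opprK PhiN //; case: pga.
  apply: (isotropic_root_coord (S := fun al => pos (- al)) (W := fun w => exists N, iter N P w = 0))
    => // [al alP|al _ pal|u v|u].
  - by rewrite opprK; have [?|?] := pos_or_neg alP; [right | left].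
  - by rewrite -[al]opprK; apply: neg_gen_kernel.
  - by apply: (gen_kernel_isotropic (oner_neq0 _)) => p q; rewrite B_P mul1r.
  exact: gen_kernel_ad.
have [z zh ->] := root_decomp H; rewrite big1 ?addr0 // => al /asboolP pal.
by rewrite BC Bneg ?opprK // BC Bpos // !scale0r addr0.
Qed.

(** The component of [P (x al)] along [x (tau al)] is 1, and [ad H] acts by [al H] on the
source and by [tau al H] on this component. *)
Lemma ad2_rho_ker_tau H : ad2 H rho = 0 ->
  {in G1, forall al, evalh (tau al) H = evalh al H}.
Proof.
move=> Hrho al alG; have Hh := ad2_rho_ker_cartan Hrho.
have [[uG1 uG2 G1D G2D] [tau_inj tauG2] _ _] := BDT; have [fD DPhi _] := SR.
have simple_pos ga : ga \in Delta -> pos ga.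
  move=> gaD; split; first exact: DPhi.
  exists (fun be => (be == ga) : nat); rewrite (bigD1_seq ga) ?free_uniq //= eqxx mulr1n.
  by rewrite big1 ?addr0 // => be /negPf ->; rewrite mulr0n.
have span_mem G ga : uniq G -> ga \in G -> ga = \sum_(be <- G) be *~ (be == ga)%:Z.
  move=> uG gaG; rewrite (bigD1_seq ga) //= eqxx mulr1z.
  by rewrite big1 ?addr0 // => be /negPf ->; rewrite mulr0z.
have tG2 : tau al \in G2 by rewrite -tauG2 map_f.
have palbe : prec al (tau al).
  split.
  - by split; [apply/simple_pos/G1D | exists (fun be => (be == al)%:Z); apply: span_mem].
  - by split; [apply/simple_pos/G2D | exists (fun be => (be == tau al)%:Z); apply: span_mem].
  exists 1%N, (fun k => if k is 0%N then al else tau al); split=> // -[|//] _.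
  exists (fun be => (be == al)%:Z); split; first exact: span_mem.
  rewrite (bigD1_seq al) //= eqxx mulr1z big1 ?addr0 // => be /negPf ->.
  by rewrite mulr0z.
have [pal pbe] := prec_pos palbe; have [alP _] := pal; have [beP _] := pbe.
have Px : B (x (- tau al)) (P (x al)) = 1.
  rewrite P_pos // BDr B_xx // Bsumr.
  (* The relation is irreflexive because it decreases the measure. *)
  have -> : (tau al == al) = false.
    apply/negP => /eqP e; have [m mP] := prec_measure.
    by have := mP _ _ palbe; rewrite e ltnn.
  rewrite add0r big_mkcond (bigD1_seq (tau al)) //= asboolT // B_xx // eqxx big1 ?addr0 //.
  move=> be /negPf ne; case: asboolP => // /prec_pos[_ [beP' _]].
  by rewrite B_xx // eq_sym ne.
have := contr_ad2 rho H (x al); rewrite Hrho contr0 (rootP (xr alP)) // => /(congr1 (B (x (- tau al)))).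
rewrite B0r BDr BNr contrZr.
rewrite BZr Px mulr1 -Binv lieC (rootP (xr (PhiN beP))) // evalhN scaleNr opprK BZl Px mulr1.
by move/eqP; rewrite eq_sym subr_eq0 => /eqP.
Qed.

Lemma ad2_tensor_roots H al be : H \in h -> al \in Phi -> be \in Phi ->
  ad2 H (tensor (x al) (x be)) = (evalh al H + evalh be H) *: tensor (x al) (x be).
Proof.
move=> Hh alP beP; rewrite ad2E (rootP (xr alP)) // (rootP (xr beP)) //.
by rewrite tensorZl tensorZr scalerDl.
Qed.

(** Conversely, [ad2 H] kills the Cartan part because [h] is abelian, kills the terms of the
positive roots because their two legs have opposite weights, and multiplies the other terms by
differences [be H - al H] with [al] and [be] in one [tau]-orbit. *)
Lemma ad2_rho_kerP H : ad2 H rho = 0 <->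
  H \in h /\ {in G1, forall al, evalh (tau al) H = evalh al H}.
Proof.
split=> [Hrho|[Hh Ht]]; first by split; [exact: ad2_rho_ker_cartan | exact: ad2_rho_ker_tau].
have ev_prec al be : prec al be -> evalh be H = evalh al H.
  move=> [_ _ [n [s [_ <- <- st]]]].
  have sk k : (k <= n)%N -> evalh (s k) H = evalh (s 0%N) H.
    elim: k => // k IHk kn; rewrite -IHk ?(ltnW kn) //.
    have [c [-> ->]] := st k kn; rewrite !evalh_sumMz big_seq [RHS]big_seq.
    by apply: eq_bigr => ga gaG; rewrite Ht.
  exact: sk.
rewrite /BD_rmatrix_of !linearD /= !linear_sum /=.
have -> : ad2 H r0 = 0.
  apply: (tens_sub_ind (P := fun A => ad2 H A = 0)) r0h => [|k A A' A0 A'0|u v uh vh].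
  - exact: linear0.
  - by rewrite linearP /= A0 A'0 scaler0 addr0.
  by rewrite ad2E !cartan_abelian // tensor0l tensor0r addr0.
rewrite add0r !big1 ?addr0 // => al /asboolP[alP _].
  rewrite linear_sum big1 // => be /asboolP pab; have [_ [beP _]] := prec_pos pab.
  by rewrite linearB /= !ad2_tensor_roots ?PhiN // evalhN (ev_prec _ _ pab) addNr subrr !scale0r subr0.
by rewrite ad2_tensor_roots ?PhiN // evalhN addNr scale0r.
Qed.

End BelavinDrinfeldMatrix.
End CartanForm.

Theorem BD_kernel (K : closedFieldType) (a : lieAlgType K) (h : {vspace a})
    (G1 G2 : seq (hdual h)) (tau : hdual h -> hdual h) (rho : tens a a) :
  [pchar K] =i pred0 -> no_abelian_ideal a -> BD_rmatrix G1 G2 tau rho ->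
  (forall z, ad2 z (rho + tswap rho) = 0) ->
  forall H, ad2 H rho = 0 <-> H \in h /\ {in G1, forall al, evalh (tau al) H = evalh al H}.
Proof.
move=> ch0 noab [hC [B [Phi [Delta [r0 [x [BI [RS SR] BDT [r0h _ _] [RV ->]]]]]]]] inv H.
exact (ad2_rho_kerP ch0 noab hC BI RS SR BDT r0h RV inv H).
Qed.

Lemma semisimple_no_abelian (K : fieldType) (a : lieAlgType K) :
  semisimple a -> no_abelian_ideal a.
Proof.
move=> ss U Ui Uab; apply: ss => //; exists 1%N => /=.
by apply/eqP; rewrite -subv0; apply: liev_sub => u v uU vU; rewrite Uab ?mem0v.
Qed.

Lemma Lambda2_sym_inv (K : fieldType) (a : lieAlgType K) (rho : tens a a) z :
  Lambda2 (ad2 z rho) -> ad2 z (rho + tswap rho) = 0.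
Proof. by move=> L; rewrite linearD /= -tswap_ad2 L subrr. Qed.

(** * Complexification *)

Section RealForm.
Variables (R : rcfType) (g : lieAlgType R).
Local Notation C := R[i].

Lemma cplx_scaleE (c : C) (z : cplx g) : c *: z = (complex.Re c *: z.1 - complex.Im c *: z.2,
   complex.Re c *: z.2 + complex.Im c *: z.1) :> cplx g.
Proof. by []. Qed.

Lemma cplx_addE (z w : cplx g) : z + w = (z.1 + w.1, z.2 + w.2) :> cplx g.
Proof. by []. Qed.
Lemma cplx_oppE (z : cplx g) : - z = (- z.1, - z.2) :> cplx g.
Proof. by []. Qed.
Lemma cplx_lieE (z w : cplx g) :
  lie z w = (lie z.1 w.1 - lie z.2 w.2, lie z.1 w.2 + lie z.2 w.1) :> cplx g.
Proof. by []. Qed.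

(** Let [A] be an abelian ideal of the complexification. The real elements of [A] form an
abelian ideal of [g], so they vanish, and with them the intersection of [A] with its
conjugate. This intersection contains the bracket of an element of [A] with a conjugate of
one; hence real parts of elements of [A] commute, they form an abelian ideal of [g], and they
vanish as well. *)
Lemma cplx_no_abelian : no_abelian_ideal g -> no_abelian_ideal (cplx g).
Proof.
move=> noab A Ai Aab.
have addself0 (x : g) : x + x = 0 -> x = 0.
  by move/eqP; rewrite -mulr2n -scaler_nat scaler_eq0 pnatr_eq0 => /eqP.
have mulI (x y : g) : ((x, y) : cplx g) \in A -> ((- y, x) : cplx g) \in A.
  move=> xyA; have := memvZ (Complex 0 1) xyA.
  by rewrite cplx_scaleE /= !scale0r !scale1r sub0r add0r.
have real0 (x : g) : ((x, 0) : cplx g) \in A -> x = 0.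
  have [U UP] : exists U : {vspace g}, forall x, x \in U <-> ((x, 0) : cplx g) \in A.
    apply: vspace_of_pred => [|k u v uA vA]; first exact: mem0v.
    have := memvD (memvZ (Complex k 0) uA) vA.
    by rewrite cplx_scaleE cplx_addE /= !scaler0 !scale0r !addr0 subr0.
  move=> /UP xU; apply/eqP; rewrite -memv0; suff <- : U = 0%VS by [].
  apply: noab => [y u /UP uA|u v /UP uA /UP vA].
    apply/UP; have := Ai ((y, 0) : cplx g) _ uA.
    by rewrite cplx_lieE /= !lie0l !lie0r subr0 addr0.
  have := Aab _ _ uA vA.
  by rewrite cplx_lieE /= !lie0l !lie0r subr0 addr0 => -[].
have conj0 (x y : g) : ((x, y) : cplx g) \in A -> ((x, - y) : cplx g) \in A -> x = 0 /\ y = 0.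
  move=> xyA xNyA; split; apply/addself0/real0.
    by have := memvD xyA xNyA; rewrite cplx_addE /= subrr.
  have := memvB (mulI _ _ xNyA) (mulI _ _ xyA).
  by rewrite cplx_oppE cplx_addE /= !opprK subrr.
have comm (x y x' y' : g) : ((x, y) : cplx g) \in A -> ((x', y') : cplx g) \in A -> lie x x' = 0.
  move=> zA wA; have := Aab _ _ zA wA; rewrite cplx_lieE /= => -[e1 _].
  have zwA := Ai ((x', - y') : cplx g) _ zA; have wzA := Ai ((x, - y) : cplx g) _ wA.
  rewrite cplx_lieE /= in zwA; rewrite cplx_lieE /= in wzA.
  have [] := conj0 _ _ zwA.
    have -> : (lie x' x - lie (- y') y, - (lie x' y + lie (- y') x)) =
              - ((lie x x' - lie (- y) y', lie x y' + lie (- y) x') : cplx g) :> cplx g.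
      rewrite cplx_oppE /= (lieC x') (lieC _ y) !lieNl !lieNr (lieC x' y) (lieC y' x).
      by congr (_, _); rewrite ?opprB ?opprD ?opprK // addrC.
    by rewrite memvN.
  rewrite lieNl opprK => e2 _; apply: addself0.
  have {}e2 : lie x x' + lie y y' = 0.
    by apply/eqP; rewrite -oppr_eq0 opprD -(lieC x') -(lieC y') e2.
  have := congr2 (fun p q : g => p + q) e1 e2.
  by rewrite addrACA addNr !addr0.
have re0 (x y : g) : ((x, y) : cplx g) \in A -> x = 0.
  have [U UP] : exists U : {vspace g}, forall x, x \in U <-> exists y, ((x, y) : cplx g) \in A.
    apply: vspace_of_pred => [|k u v [u' uA] [v' vA]]; first by exists 0; apply: mem0v.
    exists (k *: u' + v'); have := memvD (memvZ (Complex k 0) uA) vA.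
    by rewrite cplx_scaleE cplx_addE /= !scale0r subr0 addr0.
  move=> xyA; have /UP xU : exists y, ((x, y) : cplx g) \in A by exists y.
  apply/eqP; rewrite -memv0; suff <- : U = 0%VS by [].
  apply: noab => [y' u /UP[u' uA]|u v /UP[u' uA] /UP[v' vA]]; last exact: comm uA vA.
  apply/UP; exists (lie y' u'); have := Ai ((y', 0) : cplx g) _ uA.
  by rewrite cplx_lieE /= !lie0l subr0 addr0.
apply/eqP; rewrite -subv0; apply/subvP => -[x y] zA; rewrite memv0.
have /oppr_inj := etrans (re0 _ _ (mulI _ _ zA)) (esym (oppr0 _)).
by rewrite (re0 _ _ zA) => ->.
Qed.

Lemma to_cplx2_linear (k : R) (A A' : tens g g) :
  to_cplx2 (k *: A + A') = real_complex R k *: to_cplx2 A + to_cplx2 A'.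
Proof.
rewrite /to_cplx2 scaler_sumr -big_split; apply: eq_bigr => i _ /=.
rewrite scaler_sumr -big_split; apply: eq_bigr => j _ /=.
by rewrite !mxE rmorphD rmorphM /= scalerDl scalerA.
Qed.

Lemma to_cplx2D (A A' : tens g g) : to_cplx2 (A + A') = to_cplx2 A + to_cplx2 A'.
Proof. by have := to_cplx2_linear 1 A A'; rewrite !scale1r. Qed.
Lemma to_cplx20 : to_cplx2 (0 : tens g g) = 0.
Proof. by apply: (addrI (to_cplx2 0)); rewrite -to_cplx2D !addr0. Qed.
Lemma to_cplx2Z k (A : tens g g) : to_cplx2 (k *: A) = real_complex R k *: to_cplx2 A.
Proof. by have := to_cplx2_linear k A 0; rewrite to_cplx20 !addr0. Qed.
Lemma to_cplx2N (A : tens g g) : to_cplx2 (- A) = - to_cplx2 A.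
Proof. by apply: (addrI (to_cplx2 A)); rewrite -to_cplx2D !subrr to_cplx20. Qed.

Lemma to_cplx2_swap (A : tens g g) : to_cplx2 (tswap A) = tswap (to_cplx2 A).
Proof.
move: A; apply: tens_ind => [|k A A' AE A'E|u v].
- by rewrite linear0 to_cplx20 linear0.
- by rewrite linearP to_cplx2_linear AE A'E to_cplx2_linear linearP.
by rewrite tswapE !to_cplx2_tensor tswapE.
Qed.

(** The coordinates of [to_cplx2 A] with respect to the complexified basis are the entries of [A]. *)
Lemma to_cplx2_inj (A : tens g g) : to_cplx2 A = 0 -> A = 0.
Proof.
move=> A0; apply/matrixP => k l; rewrite !mxE.
pose b := vbasis {:g}; pose xi i (z : cplx g) : C := Complex (coord b i z.1) (coord b i z.2).
have xil i : linear (xi i : cplx g -> C^o).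
  move=> [c c'] [x y] [x' y']; apply/eqP; rewrite eq_complex /=.
  by apply/andP; split; apply/eqP; rewrite !(linearD, linearN, linearZ) /= ?mulrN.
have xib i (j : 'I_(\dim {:g})) : xi i (to_cplx b`_j) = (i == j)%:R.
  rewrite /xi /= linear0 coord_free ?(basis_free (vbasisP _)) // eq_sym.
  by case: eqP.
have xit u v : tlift (fun u v => xi k u * xi l v : C^o) (tensor u v) = xi k u * xi l v.
  rewrite lift_tensor // => [w c p q|w c p q].
    by rewrite xil mulrDl -mulrA.
  by rewrite xil mulrDr mulrCA.
have := congr1 (tlift (fun u v => xi k u * xi l v : C^o)) A0.
rewrite linear0 linear_sum (bigD1 k) //= [X in _ + X]big1 => [|i ik].
  rewrite addr0 linear_sum (bigD1 l) //= big1 => [|j jl]; rewrite linearZ /= xit !xib.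
    by rewrite !eqxx addr0 mulr1 => /(congr1 (@complex.Re R)); rewrite /= mulr1 mulr0 subr0.
  by rewrite [l == j]eq_sym (negPf jl) mulr0 scaler0.
rewrite linear_sum big1 // => j _; rewrite linearZ /= xit xib [k == i]eq_sym (negPf ik).
by rewrite mul0r scaler0.
Qed.

Lemma cplx_cobracketE (d : 'Hom(g, tens g g)) z :
  cplx_cobracket d z = to_cplx2 (d z.1) + Complex 0 1 *: to_cplx2 (d z.2).
Proof.
pose f (z : cplx g) := to_cplx2 (d z.1) + Complex 0 1 *: to_cplx2 (d z.2).
have fl : linear f.
  move=> [c c'] [x y] [x' y']; rewrite /f /= !linearD /= !linearN /= !linearZ /=.
  rewrite !(to_cplx2D, to_cplx2N, to_cplx2Z).
  have ii : Complex 0 1 * Complex 0 1 = -1 :> C by rewrite -expr2 sqr_i.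
  have cE : Complex c c' = real_complex R c + Complex 0 1 * real_complex R c' :> C.
    by rewrite /GRing.mul /GRing.add /=; congr Complex; ring.
  rewrite cE -[- to_cplx2 (d y)]scaleN1r -ii.
  modring.
pose F : {linear cplx g -> tens (cplx g) (cplx g)} := HB.pack f (GRing.isLinear.Build _ _ _ _ _ fl).
by rewrite /cplx_cobracket -[LHS]/(linfun F z) lfunE.
Qed.

Lemma real_lkerP (d : 'Hom(g, tens g g)) (rho : tens (cplx g) (cplx g)) :
  (forall z, cplx_cobracket d z = ad2 z rho) ->
  forall H, H \in lker d <-> ad2 (to_cplx H) rho = 0.
Proof.
move=> dE H; rewrite -dE cplx_cobracketE /= linear0 to_cplx20 scaler0 addr0 memv_ker.
by split=> [/eqP ->|/to_cplx2_inj ->]; first exact: to_cplx20.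
Qed.

Lemma real_cobracket_inv (d : 'Hom(g, tens g g)) (rho : tens (cplx g) (cplx g)) :
  (forall x, Lambda2 (d x)) -> (forall z, cplx_cobracket d z = ad2 z rho) ->
  forall z, ad2 z (rho + tswap rho) = 0.
Proof.
move=> dL dE z; apply: Lambda2_sym_inv; rewrite -dE cplx_cobracketE /Lambda2.
by rewrite linearD linearZ /= -!to_cplx2_swap !dL !to_cplx2N scalerN opprD.
Qed.
End RealForm.

(** * Lie bialgebra structures on a product with a one-dimensional centre *)

Theorem corollary3p6 :
  (forall (K : fieldType) (g : lieAlgType K),
     [pchar K] =i pred0 -> semisimple g ->
     [/\ forall dg : 'Hom(g, tens g g), lie_bialgebra dg ->
           exists r : tens g g,
             [/\ Lambda2 r, Lambda3 (CYB r), forall x, ad3 x (CYB r) = 0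
               & forall x, dg x = ad2 x r],
         forall (dg : 'Hom(g, tens g g)) (D : 'End(g)),
           lie_bialgebra dg -> biderivation dg D ->
           exists2 H, H \in lker dg & D = ad H,
         forall d : 'Hom((g * K^o)%type, tens (g * K^o)%type (g * K^o)%type),
           lie_bialgebra d -> coboundary d,
         forall d : 'Hom((g * K^o)%type, tens (g * K^o)%type (g * K^o)%type),
           lie_bialgebra d <->
           exists (dg : 'Hom(g, tens g g)) (D : 'End(g)) (r : tens g g) (H : g),
             [/\ lie_bialgebra dg /\ biderivation dg D,
                 [/\ Lambda2 r, Lambda3 (CYB r), forall x, ad3 x (CYB r) = 0
                   & forall x, dg x = ad2 x r],
                 H \in lker dg /\ D = ad H,
                 forall x : g,
                   d (incl x) = ad2 (incl x) (tmap (@incl K g) (@incl K g) r)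
                                  + wedge (incl (lie H x)) (tvec g) /\
                   d (incl x) = ad2 (incl x) (ext_tensor r H)
               & d (tvec g) = 0]
       & forall (dg : 'Hom(g, tens g g)) (r : tens g g) (H : g) (c : K),
           lie_bialgebra dg -> Lambda2 r -> (forall x, dg x = ad2 x r) ->
           H \in lker dg -> c != 0 ->
           bialgebra_iso (cobracket_of (ext_tensor r H))
                         (cobracket_of (ext_tensor r (c *: H)))]) /\
  (forall (R : realType) (g : lieAlgType R[i]) (dg : 'Hom(g, tens g g))
      (h : {vspace g}) (G1 G2 : seq (hdual h)) (tau : hdual h -> hdual h)
      (rho : tens g g),
     semisimple g -> lie_bialgebra dg -> factorizable dg ->
     BD_rmatrix G1 G2 tau rho -> (forall x, dg x = ad2 x rho) ->
     forall H : g,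
       H \in lker dg <->
       H \in h /\ {in G1, forall al, evalh (tau al) H = evalh al H}) /\
  (forall (R : realType) (g : lieAlgType R) (dg : 'Hom(g, tens g g))
      (h : {vspace cplx g}) (G1 G2 : seq (hdual h)) (tau : hdual h -> hdual h)
      (rho : tens (cplx g) (cplx g)),
     semisimple g -> lie_bialgebra dg ->
     factorizable dg \/ almost_factorizable dg ->
     BD_rmatrix G1 G2 tau rho ->
     (forall z, cplx_cobracket dg z = ad2 z rho) ->
     forall H : g,
       H \in lker dg <->
       to_cplx H \in h /\
       {in G1, forall al, evalh (tau al) (to_cplx H) = evalh al (to_cplx H)}).
Proof.
split; last split.
- move=> K g ch0 ss; split.
  + exact: bialgebra_coboundary.
  + exact: biderivation_inner.
  + exact: ext_coboundaryP.
  + exact: ext_bialgebraP.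
  by move=> dg r H c _ _ _ _; apply: ext_rescale.
- move=> R g dg h G1 G2 tau rho ss [dL _ _] _ BD dE H.
  have inv z : ad2 z (rho + tswap rho) = 0 by apply: Lambda2_sym_inv; rewrite -dE.
  have ker := @BD_kernel R[i] g h G1 G2 tau rho (@pchar_num _) (semisimple_no_abelian ss) BD inv H.
  by apply: iff_trans ker; rewrite memv_ker dE; split=> /eqP.
move=> R g dg h G1 G2 tau rho ss [dL _ _] _ BD dE H.
have inv := real_cobracket_inv dL dE.
have noab := cplx_no_abelian (semisimple_no_abelian ss).
apply: iff_trans (real_lkerP dE H) _.
exact: (@BD_kernel R[i] (cplx g) h G1 G2 tau rho (@pchar_num _) noab BD inv).
Qed.
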